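(* Let $O\subset\mathbb{R}^d$ be a non-empty Greenian open set, and let $\mu,\vartheta$ be positive Borel measures on $O$ with compact supports in $O$. If $\mu$ is a balayage of $\vartheta$ for the class $\operatorname{sbh}(O)\cap C^\infty(O)$, then $\mu$ is a balayage of $\vartheta$ for the class $\operatorname{sbh}(O)$.
   Context: $d\ge 1$. An open set is Greenian if it possesses a Green function (equivalently, each of its connected components carries a non-constant positive superharmonic function). $\operatorname{sbh}(O)$ is the class of all subharmonic functions $O\to[-\infty,+\infty)$ (locally convex functions if $d=1$); the function identically equal to $-\infty$ is included in $\operatorname{sbh}(O)$. The convention $0\cdot(\pm\infty)=0$ is used. Measures with compact support are Radon, hence finite. Balayage: for measures $\vartheta,\mu$ on $O$ and a class $H$ of Borel functions on $O$ whose integrals against $\vartheta$ and $\mu$ are well defined with values in $[-\infty,+\infty]$, $\mu$ is a balayage of $\vartheta$ for $H$ if $\int h\,d\vartheta\le\int h\,d\mu$ for all $h\in H$. *)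

(* Defs.v *)
From HB Require Import structures.
From mathcomp Require Import all_boot all_order all_algebra.
From mathcomp Require Import all_classical all_reals all_analysis.
From mathcomp Require Import measurable_realfun lra.

Set Implicit Arguments.
Unset Strict Implicit.
Unset Printing Implicit Defensive.

Import Order.TTheory GRing.Theory Num.Theory.
Import numFieldNormedType.Exports.

Local Open Scope classical_set_scope.
Local Open Scope ring_scope.

(* [open] is taken for the product topology, so this is the Borel sigma-algebra
   of R^d; it makes ['rV[R]_d] a [measurableType]. *)
HB.instance Definition _ (R : realType) (m n : nat) :=
  @isMeasurable.Build (sigma_display (@open 'M[R]_(m, n))) 'M[R]_(m, n)
    <<s (@open 'M[R]_(m, n)) >> (@sigma_algebra0 _ setT _)
    (@sigma_algebraC _ _) (@sigma_algebra_bigcup _ setT _).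

Section Lebesgue.
Variable R : realType.

Definition qball n (p : 'rV[rat]_n * nat) : set 'rV[R]_n :=
  ball (map_mx ratr p.1 : 'rV[R]_n) (p.2.+1%:R^-1 : R).

Lemma open_bigcup_qball n (U : set 'rV[R]_n) : open U ->
  U = \bigcup_p (if `[< qball p `<=` U >] then qball p else set0).
Proof.
move=> oU; apply/seteqP; split=> [x Ux|x [p _]]; last first.
  by case: asboolP => // pU /pU.
have /nbhs_ballP[e /= e0 eU] : nbhs x U by apply: open_nbhs_nbhs; split.
pose k := Num.truncn (2 / e).
have ke : k.+1%:R^-1 < e / 2.
  rewrite -[ltRHS]invrK ltf_pV2 ?posrE ?invr_gt0 ?divr_gt0//.
  by rewrite invf_div truncnS_gt.
have k0 : (0 : R) < k.+1%:R^-1 by rewrite invr_gt0.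
have qP i : exists q : rat, `|x 0 i - ratr q| < k.+1%:R^-1.
  have /rat_in_itvoo[q] : x 0 i - k.+1%:R^-1 < x 0 i + k.+1%:R^-1.
    by rewrite ltrBlDr -addrA ltrDl addr_gt0.
  rewrite in_itv/= => /andP[h1 h2]; exists q.
  by move: h1 h2; set y := ratr q; set w := _^-1 => h1 h2;
    rewrite ltr_norml; apply/andP; split; lra.
pose p : 'rV[rat]_n * nat := (\row_i xchoose (qP i), k).
have pE i : `|(map_mx ratr p.1 : 'rV[R]_n) 0 i - x 0 i| < k.+1%:R^-1.
  by rewrite distrC !mxE; exact: (xchooseP (qP i)).
have px : qball p x.
  by split=> // i j; rewrite (ord1 i) /ball/=; exact: pE.
exists p => //; case: asboolP => // -[] y [_ py]; apply: eU; split => // i j.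
rewrite (ord1 i) /ball/=.
have -> : x 0 j - y 0 j = ((map_mx ratr p.1 : 'rV[R]_n) 0 j - y 0 j)
   - ((map_mx ratr p.1 : 'rV[R]_n) 0 j - x 0 j).
  by rewrite opprB [RHS]addrC subrKA.
rewrite (le_lt_trans (ler_normB _ _))// (splitr e) ltrD//.
  exact: lt_trans (py 0 j) ke.
exact: lt_trans (pE j) ke.
Qed.

Lemma measurable_fun_rV d (T : measurableType d) n (f : T -> 'rV[R]_n) :
  (forall i, measurable_fun [set: T] (fun t => f t 0 i)) ->
  measurable_fun [set: T] f.
Proof.
move=> mf; apply: (measurability (@open 'rV[R]_n)) => //.
move=> _ [U oU <-]; rewrite setTI (open_bigcup_qball oU) preimage_bigcup.
apply: countable_bigcupT_measurable => [|p]; first exact: countableP.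
case: asboolP => _; last first.
  by rewrite preimage_set0.
have -> : f @^-1` qball p = \bigcap_(i in [set: 'I_n])
    ((fun t => f t 0 i) @^-1` ball ((map_mx ratr p.1 : 'rV[R]_n) 0 i) p.2.+1%:R^-1).
  apply/seteqP; split=> [t [_ h] i _|t h]; first exact: h.
  by split=> [|i j]; [rewrite invr_gt0|rewrite (ord1 i); exact: h].
apply: fin_bigcap_measurable => // i _; rewrite -[X in measurable X]setTI.
by apply: mf => //; exact: open_measurable (ball_open _ _).
Qed.

Lemma measurable_coord_rV n (i : 'I_n) :
  measurable_fun [set: 'rV[R]_n] (fun v => v 0 i).
Proof.
apply: (measurability _ (RGenOpens.measurableE R)) => // _ [_ [a [b ->]] <-].
rewrite setTI; apply: sub_sigma_algebra.
by move/continuousP: (@coord_continuous R 1 n 0 i); apply; exact: interval_open.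
Qed.

Definition rV_cons n (p : 'rV[R]_n * R) : 'rV[R]_n.+1 :=
  row_mx (p.2%:M : 'rV[R]_1) p.1.

Lemma measurable_rV_cons n : measurable_fun [set: 'rV[R]_n * R] (@rV_cons n).
Proof.
apply: measurable_fun_rV => i.
case: (split_ordP (i : 'I_(1 + n))) => j ->.
  rewrite (_ : (fun p => _) = snd); first exact: measurable_snd.
  apply/funext => p; rewrite (ord1 j).
  by apply: etrans (row_mxEl _ _ _ _) _; rewrite mxE eqxx mulr1n.
rewrite (_ : (fun p => _) = (fun v : 'rV[R]_n => v 0 j) \o fst).
  exact: (measurableT_comp (measurable_coord_rV j) measurable_fst).
by apply/funext => p; exact: row_mxEr.
Qed.

(* One more coordinate is added in front: lambda_(n+1) is the image of
   lambda_n \x lambda_1 under (v, t) |-> (t, v). *)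
Definition lebesgue_step n (m : {measure set 'rV[R]_n -> \bar R}) :
    set 'rV[R]_n.+1 -> \bar R :=
  pushforward (m \x (@lebesgue_measure R))%E (@rV_cons n).

HB.instance Definition _ n (m : {measure set 'rV[R]_n -> \bar R}) :=
  Measure.copy (lebesgue_step m)
    (measure_function_pushforward__canonical__measure_function_Measure
      (m \x (@lebesgue_measure R))%E (@measurable_rV_cons n)).

Fixpoint lebesgue_rV (n : nat) : {measure set 'rV[R]_n -> \bar R} :=
  if n is k.+1 then lebesgue_step (lebesgue_rV k) else \d_(0 : 'rV[R]_0).

End Lebesgue.

Section Potential.
Variables (R : realType) (d : nat).
Implicit Types (O : set 'rV[R]_d) (u : 'rV[R]_d -> \bar R) (f h : 'rV[R]_d -> R).

(* The norm carried by ['rV[R]_d] in the library is the sup norm; potential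
   theory needs the Euclidean one. *)
Definition enorm (x : 'rV[R]_d) : R := Num.sqrt (\sum_i x 0 i ^+ 2).

Definition closed_eball (x : 'rV[R]_d) (r : R) : set 'rV[R]_d :=
  [set y | enorm (y - x) <= r].

Definition ball_mean u (x : 'rV[R]_d) (r : R) : \bar R :=
  ((fine (lebesgue_rV R d (closed_eball x r)))^-1%:E *
   \int[lebesgue_rV R d]_(y in closed_eball x r) u y)%E.

Definition upper_semicontinuous_on O u : Prop :=
  forall x (a : R), O x -> (u x < a%:E)%E ->
    \forall y \near x, O y -> (u y < a%:E)%E.

(* [0 * -oo = 0] in [\bar R], so the endpoints t = 0, 1 give no constraint. *)
Definition locally_convex O u : Prop :=
  forall x, O x -> exists r : R, [/\ 0 < r, closed_eball x r `<=` O &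
    forall y z (t : R), closed_eball x r y -> closed_eball x r z -> 0 <= t <= 1 ->
      (u (t *: y + (1 - t) *: z)%R <= t%:E * u y + (1 - t)%R%:E * u z)%E].

(* A function on O is represented by a total function of which only the
   restriction to O matters. Values lie in [-oo, +oo), and -oo is allowed
   everywhere. *)
Definition sbh O : set ('rV[R]_d -> \bar R) :=
  [set u | (forall x, O x -> (u x < +oo)%E) /\
    if d == 1%N then locally_convex O u
    else upper_semicontinuous_on O u /\
      forall x (r : R), 0 < r -> closed_eball x r `<=` O ->
        (u x <= ball_mean u x r)%E].

Definition partial (i : 'I_d) f : 'rV[R]_d -> R := 'D_(delta_mx 0 i) f.

Fixpoint Ck (k : nat) O f : Prop :=
  (forall x, O x -> {for x, continuous f}) /\
  if k is j.+1 then
    forall i, (forall x, O x -> derivable f x (delta_mx 0 i)) /\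
              Ck j O (partial i f)
  else True.

Definition Cinfty O : set ('rV[R]_d -> \bar R) :=
  [set u | exists2 f, (forall k, Ck k O f) & forall x, O x -> u x = (f x)%:E].

Definition harmonic_on O h : Prop :=
  Ck 2 O h /\ forall x, O x -> \sum_i partial i (partial i h) x = 0.

(* Fundamental solution, up to a positive multiplicative constant:
   -|z| for d = 1, -ln |z| for d = 2, |z|^(2-d) for d >= 3. *)
Definition fundamental (z : 'rV[R]_d) : \bar R :=
  if d == 1%N then (- enorm z)%:E
  else if z == 0 then +oo%E
  else if d == 2%N then (- ln (enorm z))%:E
  else (enorm z ^- (d - 2)%N)%:E.

Definition harmonic_minorant O (y : 'rV[R]_d) h : Prop :=
  harmonic_on O h /\ forall x, O x -> ((h x)%:E <= fundamental (x - y)%R)%E.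

(* G(., y) is the fundamental solution with pole y minus its greatest harmonic
   minorant on O; in particular it vanishes on the components of O that do not
   contain y. *)
Definition green_function O (G : 'rV[R]_d -> 'rV[R]_d -> \bar R) : Prop :=
  forall y, O y -> exists h,
    [/\ harmonic_minorant O y h,
        forall h', harmonic_minorant O y h' -> forall x, O x -> h' x <= h x &
        forall x, O x -> G x y = (fundamental (x - y)%R - (h x)%:E)%E].

Definition greenian O : Prop := open O /\ exists G, green_function O G.

Definition measure_support (mu : {measure set 'rV[R]_d -> \bar R}) : set 'rV[R]_d :=
  [set x | forall U, open U -> U x -> (0 < mu U)%E].

(* A Borel measure on O with compact support in O is identified with its
   extension by zero to R^d. *)
Definition compactly_supported_in O (mu : {measure set 'rV[R]_d -> \bar R}) : Prop :=
  compact (measure_support mu) /\ measure_support mu `<=` O.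

(* mu is a balayage of theta for the class H of functions on O. *)
Definition balayage O (H : set ('rV[R]_d -> \bar R))
    (theta mu : {measure set 'rV[R]_d -> \bar R}) : Prop :=
  forall u, H u -> (\int[theta]_(x in O) u x <= \int[mu]_(x in O) u x)%E.

End Potential.

(* Main.v *)
(* Fix u subharmonic, n, and the truncation w = max(u, -n). Let K contain both
   supports. It suffices to find v_j in sbh(O) and C^oo(O), uniformly bounded on
   K, with w <= v_j on K and v_j -> w on K: the hypothesis gives
   int w dtheta <= int v_j dtheta <= int v_j dmu -> int w dmu, and n -> oo
   concludes by monotone convergence.
   Convolving w with a radial bump at a small scale gives U_j that is smooth on
   R^d, satisfies lap U_j >= 0 on a given compact L of O, dominates w there and
   converges to w by upper semicontinuity. To leave L, take W smooth and strictly
   subharmonic on O with W < 1/2 on K and W > 2 on O \ L: a finite sum of powers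
   of 1/|x - a|^2 with poles a outside O, plus a power of 1 + |x|^2. Then
     v_j = eta(W) U_j + A psi(W),
   with eta = 1 on (-oo, 1], eta = 0 on [2, +oo), psi = 0 on (-oo, 1/2] and psi
   convex increasing beyond, is smooth and subharmonic on O for A large, and
   equals U_j on K. *)
Require Import Defs.
From HB Require Import structures.
From mathcomp Require Import all_boot all_order all_algebra.
From mathcomp Require Import all_classical all_reals all_analysis.
From mathcomp Require Import measurable_realfun ring lra.

Set Implicit Arguments.
Unset Strict Implicit.
Unset Printing Implicit Defensive.

Import Order.TTheory GRing.Theory Num.Theory.
Import numFieldNormedType.Exports.

Local Open Scope classical_set_scope.
Local Open Scope ring_scope.

(** * Invariance of Lebesgue measure *)

Section LebesgueInvariance.
Variable R : realType.

(** The obstacle is that the hypothesis tests only functions smooth and subharmonic on all of [O],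
    while a mollification is controlled only on compact parts of [O]. The correction [A psi(W)]
    lives off [K], so [A] may grow with [j] without any effect on bounds or limits over [K]. Gluing
    is done on Laplacians, because the sign of [lap] is a pointwise condition, whereas
    subharmonicity is stated with means. Two passages are therefore needed: from means to [lap >= 0]
    for the mollified truncation, and from [lap >= 0] back to means for the glued function.
    Truncating makes the mollified function bounded, so that limits in [j] follow by dominated
    convergence. Means over balls control means against the bump because its superlevel sets are
    balls. In dimension one, local convexity is first converted into semicontinuity and a submean
    inequality, and is recovered at the end from the second derivative. Large powers in [W] serve
    twice: they make the pole terms subharmonic in every dimension, and they beat the number of
    poles, which is not known in advance. *)

Definition preserves d (T : measurableType d) (m : set T -> \bar R) (S : T -> T) :=
  measurable_fun [set: T] S /\
  forall A, measurable A -> m (S @^-1` A) = m A.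

Lemma rV_cons_surj n (x : 'rV[R]_n.+1) : exists v t, x = rV_cons (v, t).
Proof.
exists (rsubmx (x : 'rV_(1 + n))), (lsubmx (x : 'rV_(1 + n)) 0 0).
rewrite /rV_cons/= -[LHS](@hsubmxK _ 1 1 n);
apply: (congr1 (fun y => @row_mx R 1 1 n y _)).
by apply/matrixP => i j; rewrite (ord1 i) (ord1 j) !mxE eqxx mulr1n.
Qed.

Lemma preserves_integral d (T : measurableType d) (m : {measure set T -> \bar R})
    (S : T -> T) (f : T -> \bar R) :
  preserves m S -> measurable_fun [set: T] f -> (forall x, 0 <= f x)%E ->
  (\int[m]_x f (S x) = \int[m]_x f x)%E.
Proof.
move=> [mS SE] mf f0.
rewrite -(@ge0_integral_pushforward _ _ T T R S mS m setT f)//.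
by apply: eq_measure_integral => A mA _; exact: SE.
Qed.

(** By Fubini: the section at [v] of the preimage of [A] under [U] is the preimage under [s] of the
    section of [A] at [S v]. So [s] takes care of the inner measure and [S] of the outer integral,
    and invariance in any dimension reduces to the line. *)
Lemma preserves_step n (S : 'rV[R]_n -> 'rV[R]_n) (s : R -> R)
    (U : 'rV[R]_n.+1 -> 'rV[R]_n.+1) :
  preserves (lebesgue_rV R n) S -> preserves (@lebesgue_measure R) s ->
  measurable_fun setT U ->
  (forall v t, U (rV_cons (v, t)) = rV_cons (S v, s t)) ->
  preserves (lebesgue_rV R n.+1) U.
Proof.
move=> pS ps mU UE; split=> // A mA.
have mUA : measurable (U @^-1` A) by rewrite -[X in measurable X]setTI; exact: mU.
rewrite /= /lebesgue_step /pushforward /= /product_measure1/=.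
have mB B : measurable B -> measurable (@rV_cons R n @^-1` B).
  by move=> mB; rewrite -[X in measurable X]setTI; exact: measurable_rV_cons.
pose g v := lebesgue_measure (xsection (@rV_cons R n @^-1` A) v).
rewrite (eq_integral (fun v => g (S v))); last first.
  move=> v _; rewrite /= /g -(proj2 ps (xsection _ (S v)))//; last first.
    by apply: measurable_xsection; exact: mB.
  congr lebesgue_measure; apply/seteqP; split=> t; rewrite /xsection/= !inE/=;
    by rewrite UE.
rewrite preserves_integral//.
apply: (@measurable_fun_xsection _ _ _ _ _ (@lebesgue_measure R)).
exact: mB.
Qed.

Lemma preserves_shift1 (a : R) : preserves (@lebesgue_measure R) (fun t => t + a).
Proof.
have mf : measurable_fun [set: measurableTypeR R]
    (fun t : R => (t + a : measurableTypeR R)).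
  exact: measurable_funD.
split; first exact: mf.
move=> A mA; have := @lebesgue_measure_unique R
  (pushforward (@lebesgue_measure R) (fun t : R => (t + a : measurableTypeR R))).
move=> /(_ mf) leb_unique; apply/esym/leb_unique => //.
move=> _ [[x y] _ <-]; rewrite /pushforward.
transitivity (@lebesgue_measure R `]x - a, y - a]%classic); last first.
  congr lebesgue_measure; apply/seteqP.
  by split=> t/=; rewrite !in_itv/= ltrBlDr lerBrDr.
rewrite !lebesgue_measure_itv/= !lte_fin ltrD2r.
by case: ifP => // _; rewrite -!EFinB; congr EFin; ring.
Qed.

Lemma preserves_opp1 : preserves (@lebesgue_measure R) (-%R).
Proof.
split=> [|A mA]; first exact: oppr_measurable.
exact: lebesgue_measureN.
Qed.

Lemma measurable_shift n (a : 'rV[R]_n) :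
  measurable_fun [set: 'rV[R]_n] (fun v => v + a : 'rV[R]_n).
Proof.
apply: measurable_fun_rV => i; under eq_fun do rewrite mxE.
by apply: measurable_funD => //; exact: measurable_coord_rV.
Qed.

Lemma measurable_opp_rV n : measurable_fun [set: 'rV[R]_n] (fun v => - v : 'rV[R]_n).
Proof.
apply: measurable_fun_rV => i; under eq_fun do rewrite mxE.
by apply: measurableT_comp => //; exact: measurable_coord_rV.
Qed.

Lemma preserves_id0 (U : 'rV[R]_0 -> 'rV[R]_0) : preserves (lebesgue_rV R 0) U.
Proof.
have -> : U = id by apply/funext => x; apply/matrixP => i [].
by split.
Qed.

Lemma lebesgue_rV_shift n (a : 'rV[R]_n) :
  preserves (lebesgue_rV R n) (fun v => v + a : 'rV[R]_n).
Proof.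
elim: n a => [a|n IH a]; first exact: preserves_id0.
have [v [t ->]] := rV_cons_surj a.
apply: (preserves_step (IH v) (preserves_shift1 t)); first exact: measurable_shift.
move=> w s; rewrite /rV_cons/= (@add_row_mx _ 1 1 n);
apply: (congr1 (fun y => @row_mx R 1 1 n y _)); by rewrite -raddfD.
Qed.

Lemma lebesgue_rV_opp n : preserves (lebesgue_rV R n) (fun v => - v : 'rV[R]_n).
Proof.
elim: n => [|n IH]; first exact: preserves_id0.
apply: (preserves_step IH preserves_opp1); first exact: measurable_opp_rV.
move=> w s; rewrite /rV_cons/= (@opp_row_mx _ 1 1 n);
apply: (congr1 (fun y => @row_mx R 1 1 n y _)); by rewrite -raddfN.
Qed.

Definition box n (a : R) : set 'rV[R]_n := [set x | forall i, `|x 0 i| <= a].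

Lemma measurable_box n (a : R) : measurable (@box n a).
Proof.
have -> : @box n a = \bigcap_(i in [set: 'I_n]) ((fun v => v 0 i) @^-1` `[-a, a]).
  apply/seteqP; split=> x.
    by move=> xa i _; rewrite /= in_itv/= -ler_norml.
  by move=> xa i; have := xa i I; rewrite /= in_itv/= -ler_norml.
apply: fin_bigcap_measurable => // i _; rewrite -[X in measurable X]setTI.
by apply: measurable_coord_rV.
Qed.

(** Boxes are the only sets whose volume is computed; balls are compared with them, for finiteness,
    for positivity and for smallness of their volume. *)
Lemma lebesgue_rV_box n (a : R) : 0 <= a ->
  lebesgue_rV R n (@box n a) = ((2 * a) ^+ n)%:E.
Proof.
move=> a0; elim: n => [|n IH].
  by rewrite /= diracE expr0 (_ : _ \in _)//; apply/mem_set => -[].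
have -> : lebesgue_rV R n.+1 (@box n.+1 a) =
    ((lebesgue_rV R n \x @lebesgue_measure R) (@box n a `*` [set` `[- a, a]%R]))%E.
  rewrite /=/lebesgue_step /pushforward; congr (_ _); apply/seteqP.
  split=> [[v t] H|[v t] [/= H1 H2] i].
    split=> /= [i|].
      have := H (rshift 1 i); rewrite /rV_cons/=.
      by rewrite (@row_mxEr R 1 1 n).
    have := H (lshift n (0 : 'I_1)); rewrite /rV_cons/= (@row_mxEl R 1 1 n).
    by rewrite mxE eqxx mulr1n in_itv/= ler_norml.
  rewrite /rV_cons/=; case: (split_ordP (i : 'I_(1 + n))) => j ->.
    rewrite (@row_mxEl R 1 1 n) (ord1 j) mxE eqxx mulr1n.
    by move: H2; rewrite in_itv/= ler_norml.
  by rewrite (@row_mxEr R 1 1 n); exact: H1.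
rewrite product_measure1E//; last exact: measurable_box.
rewrite IH [X in (_ * X)%E](_ : _ = (2 * a)%:E) -?EFinM ?exprSr//.
apply: (etrans (lebesgue_measure_itv _)); rewrite /= lte_fin.
case: ltP => [_|aN]; first by rewrite -EFinB; congr EFin; ring.
by congr EFin; lra.
Qed.

Lemma bigcup_box n : \bigcup_k @box n (k%:R : R) = [set: 'rV[R]_n].
Proof.
apply/seteqP; split=> // x _; exists (Num.truncn (\sum_i `|x 0 i|)).+1 => // i.
apply/ltW; apply: le_lt_trans (truncnS_gt _).
by rewrite (bigD1 i)//= lerDl sumr_ge0.
Qed.

End LebesgueInvariance.

(* An alias of [lebesgue_rV] carrying the sigma-finiteness needed by Fubini. *)
Definition leb (R : realType) n : set 'rV[R]_n -> \bar R := lebesgue_rV R n.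
HB.instance Definition _ (R : realType) n :=
  Measure.copy (@leb R n) (lebesgue_rV R n).

Lemma leb_sigma_finite (R : realType) n : sigma_finite setT (@leb R n).
Proof.
exists (fun k => @box R n k%:R); first by rewrite bigcup_box.
move=> k; split; first exact: measurable_box.
by rewrite /leb lebesgue_rV_box ?ltry.
Qed.

HB.instance Definition _ (R : realType) n :=
  @Measure_isSigmaFinite.Build _ _ R (@leb R n) (@leb_sigma_finite R n).

(** * Smooth functions and the Laplacian *)

Section Smooth.
Variables (R : realType) (d : nat).
Local Notation V := 'rV[R]_d.
Implicit Types (f g : V -> R) (O : set V) (k : nat).

Definition dirgrad (G : 'I_d -> V -> R) (x a : V) : R := \sum_i a 0 i * G i x.

(* Asking for all directional derivatives, and not only for those along the axes,
   makes the chain rule available without going through differentiability. *)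
Fixpoint smooth_at k f (x : V) : Prop :=
  {for x, continuous f} /\
  if k is j.+1 then
    (forall a, is_derive x a f (dirgrad (fun i => partial i f) x a)) /\
    forall i, smooth_at j (partial i f) x
  else True.

Definition smooth k O f := forall x, O x -> smooth_at k f x.

Lemma smooth_continuous k O f x : smooth k O f -> O x -> {for x, continuous f}.
Proof. by case: k => [|k] fO /fO[]. Qed.

Lemma smooth_derive k O f x a : smooth k.+1 O f -> O x ->
  is_derive x a f (dirgrad (fun i => partial i f) x a).
Proof. by move=> fO /fO[_ []]. Qed.

Lemma smooth_partial k O f i : smooth k.+1 O f -> smooth k O (partial i f).
Proof. by move=> fO x Ox; have [_ [_ sf]] := fO _ Ox; exact: sf. Qed.

Lemma smoothW k O f : smooth k.+1 O f -> smooth k O f.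
Proof.
elim: k f => [|k IH] f fO x Ox; first by have [cf _] := fO _ Ox; split.
have [cf [df sf]] := fO _ Ox; split => //; split => // i.
exact: (IH (partial i f) (smooth_partial i fO)).
Qed.

Lemma smooth_le k l O f : (k <= l)%N -> smooth l O f -> smooth k O f.
Proof.
by move=> /subnK <-; elim: (l - k)%N => [//|m IH]; rewrite addSn => /smoothW.
Qed.

Lemma smooth_sub k O U f : U `<=` O -> smooth k O f -> smooth k U f.
Proof. by move=> UO fO x /UO/fO. Qed.

Lemma near_open O (P : V -> Prop) x : open O -> (forall y, O y -> P y) -> O x ->
  \near x, P x.
Proof.
move=> oO OP Ox; have : nbhs x O by apply: open_nbhs_nbhs.
by apply: filterS => y; exact: OP.
Qed.

Lemma dirgrad_delta G x i : dirgrad G x (delta_mx 0 i) = G i x.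
Proof.
rewrite /dirgrad (bigD1 i)//= mxE !eqxx mul1r big1 ?addr0// => j ji.
by rewrite mxE eqxx/= (negPf ji) mul0r.
Qed.

Lemma smooth_congr k O f g : open O -> (forall x, O x -> f x = g x) ->
  smooth k O f -> smooth k O g.
Proof.
move=> oO; elim: k f g => [|k IH] f g fg fO x Ox;
    have nfg y (Oy : O y) : \forall z \near y, f z = g z := near_open oO fg Oy;
    have cg : {for x, continuous f} -> {for x, continuous g}.
- by rewrite /prop_for /continuous_at -(fg _ Ox); apply: cvg_trans;
    exact: near_eq_cvg (nfg _ Ox).
- by have [cf _] := fO _ Ox; split => //; exact: cg.
- by rewrite /prop_for /continuous_at -(fg _ Ox); apply: cvg_trans;
    exact: near_eq_cvg (nfg _ Ox).
have pE i y : O y -> partial i f y = partial i g y.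
  by move=> Oy; exact: near_eq_derive (nfg _ Oy).
have [cf [df sf]] := fO _ Ox; split; first exact: cg.
split=> [a|i]; last exact: (IH _ _ (pE i) (smooth_partial i fO)).
rewrite (_ : dirgrad _ x a = dirgrad (fun i => partial i f) x a).
  exact: near_eq_is_derive (nfg _ Ox) (df a).
by apply: eq_bigr => i _; rewrite pE.
Qed.

Lemma partial_eq (G : 'I_d -> V -> R) f x i :
  (forall a, is_derive x a f (dirgrad G x a)) -> partial i f x = G i x.
Proof. by move=> fG; rewrite /partial derive_val dirgrad_delta. Qed.

(** Lets a candidate gradient [G] replace [partial i f], with which it agrees only on [O]. The
    closure properties below all go through it. *)
Lemma smooth_intro k O f (G : 'I_d -> V -> R) : open O ->
  (forall x, O x -> {for x, continuous f}) ->
  (forall x a, O x -> is_derive x a f (dirgrad G x a)) ->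
  (forall i, smooth k O (G i)) -> smooth k.+1 O f.
Proof.
move=> oO cf df sG x Ox.
have pE i y : O y -> partial i f y = G i y.
  by move=> Oy; apply: partial_eq => a; exact: df.
split; first exact: cf.
split=> [a|i]; last first.
  by apply: (smooth_congr oO _ (sG i)) => // y Oy; rewrite pE.
rewrite (_ : dirgrad _ x a = dirgrad G x a); first exact: df.
by apply: eq_bigr => i _; rewrite pE.
Qed.

Lemma smooth_Ck k O f : smooth k O f -> Ck k O f.
Proof.
elim: k f => [|k IH] f fO; split => //; try by move=> x /fO[].
move=> i; split=> [x Ox|]; first by have [_ [df _]] := fO _ Ox.
exact/IH/smooth_partial.
Qed.

Lemma smooth_cst k O (c : R) : open O -> smooth k O (fun=> c).
Proof.
move=> oO; elim: k c => [|k IH] c.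
  by move=> x Ox; split => //; apply: cst_continuous.
apply: (@smooth_intro _ _ _ (fun _ _ => 0)) => //.
- by move=> x _; apply: cst_continuous.
- move=> x a _; rewrite /dirgrad big1; last by move=> i _; rewrite mulr0.
  exact: is_derive_cst.
Qed.

(** Turns a directional derivative into a derivative in one variable, where the library chain rule
    and mean value theorem apply. *)
Lemma is_derive_line f (x a : V) (df : R) :
  is_derive x a f df <-> is_derive (0 : R) 1 (fun t => f (t *: a + x)) df.
Proof.
have E : 'D_a f x = 'D_1 (fun t : R => f (t *: a + x)) 0.
  rewrite /derive; apply: (congr1 (fun F : R -> R => lim (F @ 0^'))).
  by apply/funext => h /=; rewrite addr0 scale0r add0r [_%:A]mulr1.
split=> -[fd <-].
  by apply: DeriveDef => //; exact: (iffLR (derivable1P _ _ _) fd).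
by apply: DeriveDef => //; exact: (iffRL (derivable1P _ _ _) fd).
Qed.

Lemma is_derive_coord (i : 'I_d) (x a : V) :
  is_derive x a (fun y : V => y 0 i) (a 0 i).
Proof.
apply/is_derive_line; under [X in is_derive _ _ X]eq_fun do rewrite !mxE.
have -> : (fun t : R => t * a 0 i + x 0 i) =
    ((fun t : R => t) \* (cst (a 0 i))) \+ cst (x 0 i) by [].
apply: is_derive_eq.
by rewrite scaler0 add0r addr0 [LHS]mulr1.
Qed.

Lemma smooth_coord k O (i : 'I_d) : open O -> smooth k O (fun y : V => y 0 i).
Proof.
move=> oO; case: k => [|k].
  by move=> x _; split => //; apply: coord_continuous.
apply: (@smooth_intro _ _ _ (fun j _ => (j == i)%:R)) => //.
- by move=> x _; apply: coord_continuous.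
- move=> x a _; rewrite /dirgrad (bigD1 i)//= eqxx mulr1 big1 ?addr0.
    exact: is_derive_coord.
  by move=> j /negPf ->; rewrite mulr0.
- by move=> j; exact: smooth_cst.
Qed.

Lemma smoothD k O f g : open O -> smooth k O f -> smooth k O g ->
  smooth k O (fun x => f x + g x).
Proof.
move=> oO; elim: k f g => [|k IH] f g fO gO.
  move=> x Ox; split=> //; apply: continuousD.
    exact: (smooth_continuous fO).
  exact: (smooth_continuous gO).
apply: (@smooth_intro _ _ _ (fun i x => partial i f x + partial i g x)) => //.
- move=> x Ox; apply: continuousD.
    exact: (smooth_continuous fO).
  exact: (smooth_continuous gO).
- move=> x a Ox; have df := smooth_derive a fO Ox; have dg := smooth_derive a gO Ox.
  apply: is_derive_eq; rewrite /dirgrad -big_split/=.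
  by apply: eq_bigr => i _; rewrite mulrDr.
- by move=> i; apply: IH; exact: smooth_partial.
Qed.

Lemma smoothM k O f g : open O -> smooth k O f -> smooth k O g ->
  smooth k O (fun x => f x * g x).
Proof.
move=> oO; elim: k f g => [|k IH] f g fO gO.
  move=> x Ox; split=> //; apply: continuousM.
    exact: (smooth_continuous fO).
  exact: (smooth_continuous gO).
apply: (@smooth_intro _ _ _ (fun i x => f x * partial i g x + g x * partial i f x)) => //.
- move=> x Ox; apply: continuousM.
    exact: (smooth_continuous fO).
  exact: (smooth_continuous gO).
- move=> x a Ox; have df := smooth_derive a fO Ox; have dg := smooth_derive a gO Ox.
  apply: is_derive_eq; rewrite /dirgrad /GRing.scale/= !mulr_sumr -big_split/=.
  by apply: eq_bigr => i _; ring.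
- move=> i; apply: smoothD => //; apply: IH.
  + exact: smoothW.
  + exact: smooth_partial.
  + exact: smoothW.
  + exact: smooth_partial.
Qed.

Lemma smoothZ k O (c : R) f : open O -> smooth k O f ->
  smooth k O (fun x => c * f x).
Proof. by move=> oO fO; apply: smoothM => //; exact: smooth_cst. Qed.

Lemma smooth_sum k O (I : Type) (r : seq I) (F : I -> V -> R) : open O ->
  (forall i, smooth k O (F i)) -> smooth k O (fun x => \sum_(i <- r) F i x).
Proof.
move=> oO FO; elim: r => [|i r IH].
  by under eq_fun do rewrite big_nil; exact: smooth_cst.
by under eq_fun do rewrite big_cons; exact: smoothD.
Qed.

(** The derivative is asked only on [I], which admits [1/t] away from 0, and is given existentially,
    so that no iterated derivative has to be computed. *)
Fixpoint rsmooth k (I : set R) (h : R -> R) : Prop :=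
  if k is j.+1 then
    exists2 h', (forall t, I t -> is_derive t 1 h (h' t)) & rsmooth j I h'
  else forall t, I t -> {for t, continuous h}.

Lemma rsmooth_continuous k I h t : rsmooth k I h -> I t -> {for t, continuous h}.
Proof.
case: k => [|k]; first exact.
move=> [h' hh' _] It; apply: differentiable_continuous.
by apply/derivable1_diffP; have [] := hh' _ It.
Qed.

Lemma is_derive_comp f (h : R -> R) (x a : V) (df dh : R) :
  is_derive x a f df -> is_derive (f x) 1 h dh ->
  is_derive x a (fun y => h (f y)) (dh * df).
Proof.
move=> /is_derive_line fd hd; apply/is_derive_line.
have hd' : is_derive (f ((0 : R) *: a + x)) 1 h dh by rewrite scale0r add0r.
by apply: (@is_derive1_comp _ h (fun t => f (t *: a + x)) 0).
Qed.

Lemma smooth_comp k O I f (h : R -> R) : open O ->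
  (forall x, O x -> I (f x)) -> rsmooth k I h -> smooth k O f ->
  smooth k O (fun x => h (f x)).
Proof.
move=> oO fI; elim: k h => [|k IH] h hI fO.
  move=> x Ox; split=> //; apply: continuous_comp.
    exact: (smooth_continuous fO).
  exact/hI/fI.
have [h' hh' h'I] := hI.
apply: (@smooth_intro _ _ _ (fun i x => h' (f x) * partial i f x)) => //.
- move=> x Ox; apply: continuous_comp; first exact: (smooth_continuous fO).
  by apply: (rsmooth_continuous hI); exact: fI.
- move=> x a Ox; apply: is_derive_eq.
    exact: (is_derive_comp (smooth_derive a fO Ox) (hh' _ (fI _ Ox))).
  by rewrite /dirgrad mulr_sumr; apply: eq_bigr => i _; rewrite mulrCA.
- move=> i; apply: smoothM => //; last exact: smooth_partial.
  by apply: IH => //; exact: smoothW.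
Qed.

End Smooth.

(** * One-variable calculus around [e^(-1/t)] *)

Section RealBump.
Variable R : realType.

Lemma is_derive_cvg (V W : normedModType R) (f : V -> W) (x v : V) (l : W) :
  h^-1 *: (f (h *: v + x) - f x) @[h --> 0^'] --> l -> is_derive x v f l.
Proof.
by move=> fl; apply: DeriveDef; [apply/cvg_ex; exists l|exact: cvg_lim fl].
Qed.

(** Handles the junction point of functions defined by cases: [flat p] and [possq] at 0. *)
Lemma is_derive0_sq (f : R -> R) (x C : R) :
  (forall h, `|f (h + x) - f x| <= C * h ^+ 2) -> is_derive x 1 f 0.
Proof.
move=> fC; apply: is_derive_cvg; apply/cvgr0Pnorm_lt => e e0.
have C0 : 0 <= C.
  by have := le_trans (normr_ge0 _) (fC 1); rewrite expr1n mulr1.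
exists (e / (C + 1)) => /=; first by rewrite divr_gt0// ltr_wpDl.
move=> h /=; rewrite sub0r normrN => he h0.
rewrite normrM normfV [h *: 1]mulr1 ltr_pdivrMl ?normr_gt0//.
apply: le_lt_trans (fC h) _; rewrite -(real_normK (num_real h)) expr2 mulrCA ltr_pM2l ?normr_gt0//.
have [->|C1] := eqVneq C 0; first by rewrite mul0r.
rewrite -ltr_pdivlMl; last by rewrite lt_neqAle eq_sym C1.
apply: lt_le_trans he _; rewrite mulrC ler_wpM2r ?(ltW e0)// lef_pV2 ?posrE ?lerDl//.
  by rewrite ltr_wpDl.
by rewrite lt_neqAle eq_sym C1.
Qed.

Lemma exprn_expRN_le (n : nat) (x : R) : 0 <= x ->
  x ^+ n * expR (- x) <= n`!%:R.
Proof.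
case: n => [|n] x0; first by rewrite expr0 mul1r fact0 expR_le1 oppr_le0.
rewrite expRN ler_pdivrMr ?expR_gt0// mulrC -ler_pdivrMr ?ltr0n ?fact_gt0//.
by apply: le_trans (expR_ge1Dxn n x0); rewrite lerDr.
Qed.

(** The power [n] is quantified so that the induction step on [p * 'X + c] can absorb the new factor
    [x]. The case [n = 2] bounds [flat p t / t^2] near 0. *)
Lemma horner_expRN_le (p : {poly R}) (n : nat) :
  exists C, forall x, 0 <= x -> `|p.[x]| * x ^+ n * expR (- x) <= C.
Proof.
elim/poly_ind: p n => [|p c IH] n.
  by exists 0 => x _; rewrite horner0 normr0 !mul0r.
have [C CP] := IH n.+1; exists (C + `|c| * n`!%:R) => x x0.
apply: le_trans (lerD (CP _ x0) (ler_wpM2l (normr_ge0 c) (exprn_expRN_le n x0))).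
rewrite mulrA -mulrDl ler_wpM2r ?expR_ge0// exprS mulrA -mulrDl.
rewrite ler_wpM2r ?exprn_ge0// !hornerE (le_trans (ler_normD _ _))//.
by rewrite normrM (ger0_norm x0).
Qed.

(* Derivatives of [exp (-1/t)] at [t > 0] are of the form [p(1/t) exp (-1/t)]. *)
Definition flat (p : {poly R}) (t : R) : R :=
  if 0 < t then p.[t^-1] * expR (- t^-1) else 0.

(** With [s = 1/t], deriving [p(s) e^(-s)] in [t] gives [s^2 (p - p')(s) e^(-s)]: the family is
    stable under derivation, and smoothness of every order follows by induction. At [t = 0] the
    function is [O(t^2)], so its derivative vanishes. *)
Lemma is_derive_flat (p : {poly R}) (t : R) :
  is_derive t 1 (flat p) (flat ('X^2 * (p - p^`())) t).
Proof.
have [t0|t0|->] := ltrgtP t 0.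
- rewrite {2}/flat ltNge (ltW t0)/=; apply: near_eq_is_derive (@is_derive_cst R R R 0 t 1).
  have : nbhs t [set s : R | s < 0] by apply: open_nbhs_nbhs; split => //; exact: open_lt.
  by apply: filterS => s /= s0; rewrite /flat ltNge (ltW s0).
- rewrite {2}/flat t0.
  have tn0 : t != 0 by rewrite gt_eqF.
  have dI : is_derive t 1 (fun s : R => s^-1) (- t ^- 2).
    by apply: is_derive_eq; [exact: (is_deriveV tn0)|rewrite [LHS]mulr1].
  have dE : is_derive t 1 (fun s : R => expR (- s^-1)) (expR (- t^-1) * t ^- 2).
    have dN : is_derive t 1 (fun s : R => - s^-1) (t ^- 2).
      by apply: is_derive_eq; rewrite opprK.
    exact: (@is_derive1_comp _ expR (fun s : R => - s^-1)).
  have dp : is_derive t 1 (fun s : R => p.[s^-1]) ((p^`()).[t^-1] * - t ^- 2).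
    exact: (@is_derive1_comp _ (horner p) (fun s : R => s^-1)).
  apply: (@near_eq_is_derive _ _ _ (fun s : R => p.[s^-1] * expR (- s^-1))).
    have : nbhs t [set s : R | 0 < s] by apply: open_nbhs_nbhs; split => //; exact: open_gt.
    by apply: filterS => s /= s0; rewrite /flat s0.
  by apply: is_derive_eq; rewrite /GRing.scale/= hornerM hornerXn hornerD hornerN exprVn; ring.
- rewrite {2}/flat ltxx.
  have [C CP] := horner_expRN_le p 2.
  have C0 : 0 <= C by apply: le_trans (CP 0 (lexx _)); rewrite !mulr_ge0 ?expR_ge0.
  apply: (@is_derive0_sq _ _ C) => h; rewrite addr0 {2}/flat ltxx subr0 /flat.
  case: ifPn => h0; last by rewrite normr0 mulr_ge0// sqr_ge0.
  have hV : 0 <= h^-1 by rewrite invr_ge0 ltW.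
  rewrite -ler_pdivrMr ?exprn_gt0// normrM (ger0_norm (expR_ge0 _)).
  by rewrite -exprVn mulrAC CP.
Qed.

Lemma rsmooth_flat k I (p : {poly R}) : rsmooth k I (flat p).
Proof.
elim: k p => [|k IH] p.
  move=> t _; apply: differentiable_continuous; apply/derivable1_diffP.
  by have [] := is_derive_flat p t.
by exists (flat ('X^2 * (p - p^`()))) => // t _; exact: is_derive_flat.
Qed.

Definition ebump : R -> R := flat 1.

Lemma ebump_gt0 t : 0 < t -> 0 < ebump t.
Proof. by move=> t0; rewrite /ebump/flat t0 hornerE mul1r expR_gt0. Qed.

Lemma ebump_le0 t : t <= 0 -> ebump t = 0.
Proof. by move=> t0; rewrite /ebump/flat ltNge t0. Qed.

Lemma ebump_ge0 t : 0 <= ebump t.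
Proof. by have [/ebump_gt0/ltW//|/ebump_le0 ->] := ltrP 0 t. Qed.

Lemma ebump_le s t : s <= t -> ebump s <= ebump t.
Proof.
move=> st; have [s0|/ebump_le0 ->] := ltrP 0 s; last exact: ebump_ge0.
have t0 := lt_le_trans s0 st; rewrite /ebump/flat s0 t0 !hornerE ler_expR.
by rewrite lerN2 lef_pV2.
Qed.

(** The function [psi] of the overview, up to a shift. The factor [t] is there for convexity:
    [e^(-1/t)] alone has an inflection at [t = 1/2], whereas [t e^(-1/t)] has second derivative
    [t^(-3) e^(-1/t)]. *)
Lemma is_derive_tebump (t : R) : is_derive t 1 (fun s => s * ebump s) (flat (1 + 'X) t).
Proof.
have db := is_derive_flat 1 t.
apply: is_derive_eq; rewrite /GRing.scale/= /flat; case: ifPn => t0.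
  have tn0 : t != 0 by rewrite gt_eqF.
  by rewrite /ebump/flat t0 !hornerE /= derivC !hornerE; field.
by rewrite ebump_le0 ?leNgt// mulr0 mul0r addr0.
Qed.

Lemma is_derive_tebump2 (t : R) : is_derive t 1 (flat (1 + 'X)) (flat 'X^3 t).
Proof.
apply: is_derive_eq; first exact: is_derive_flat.
congr (flat _ t); rewrite derivD derivC derivX add0r.
by rewrite (addrC 1) addrK -exprSr.
Qed.

Lemma flat_gt0 (p : {poly R}) t : 0 < t -> 0 < p.[t^-1] -> 0 < flat p t.
Proof. by move=> t0 pt; rewrite /flat t0 mulr_gt0 ?expR_gt0. Qed.

Lemma flat_ge0 (p : {poly R}) t : (forall s, 0 <= s -> 0 <= p.[s]) -> 0 <= flat p t.
Proof.
by move=> p0; rewrite /flat; case: ifP => // t0; rewrite mulr_ge0 ?expR_ge0// p0// invr_ge0 ltW.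
Qed.

Lemma is_derive_pow (V : normedModType R) (f : V -> R) n x v (df : R) :
  is_derive x v f df ->
  is_derive x v (fun y => f y ^+ n) (n%:R * f x ^+ n.-1 * df).
Proof. by move=> fd; have := @is_deriveX _ _ f n x v df fd; rewrite exprfctE. Qed.

Lemma is_derive_invX k (t : R) : t != 0 ->
  is_derive t 1 (fun s : R => s^-1 ^+ k) (- (k%:R * t^-1 ^+ k.+1)).
Proof.
move=> tn0.
have dI : is_derive t 1 (fun s : R => s^-1) (- t ^- 2).
  by apply: is_derive_eq; [exact: (is_deriveV tn0)|rewrite [LHS]mulr1].
case: k => [|k].
  by rewrite mul0r oppr0 (_ : (fun s : R => _) = cst 1)//; apply: is_derive_cst.
apply: is_derive_eq; first exact: is_derive_pow.
by rewrite /= -exprVn !exprS; ring.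
Qed.

Lemma is_derive_X k (t : R) :
  is_derive t 1 (fun s : R => s ^+ k.+1) (k.+1%:R * t ^+ k).
Proof.
apply: is_derive_eq; first exact: (@is_derive_pow _ id).
by rewrite mulr1.
Qed.

Lemma rsmooth_inv k : rsmooth k [set t : R | t != 0] (fun t => t^-1).
Proof.
(* The monomials [c t^(-n)] are stable under derivation, which [1/t] alone is not. *)
suff H c n : rsmooth k [set t : R | t != 0] (fun t => c * t^-1 ^+ n).
  rewrite (_ : (fun t : R => t^-1) = fun t => 1 * t^-1 ^+ 1); first exact: H.
  by apply/funext => t; rewrite mul1r expr1.
have dH a m (t : R) : t != 0 ->
    is_derive t 1 (fun t => a * t^-1 ^+ m) (a * - m%:R * t^-1 ^+ m.+1).
  move=> tn0; have dI := is_derive_invX m tn0.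
  by apply: (is_derive_eq (is_deriveZ _ dI)); rewrite /GRing.scale/=; ring.
elim: k c n => [|k IH] c n.
  move=> t /= t0; apply: differentiable_continuous; apply/derivable1_diffP.
  by have [] := dH c n _ t0.
by exists (fun t => c * - n%:R * t^-1 ^+ n.+1) => //; exact: dH.
Qed.

Definition possq (s : R) : R := Num.max s 0 ^+ 2.

Lemma is_derive_possq (t : R) : is_derive t 1 possq (2 * Num.max t 0).
Proof.
have [t0|t0|->] := ltrgtP t 0.
- rewrite mulr0; apply: near_eq_is_derive (@is_derive_cst R R R 0 t 1).
  have : nbhs t [set s : R | s < 0] by apply: open_nbhs_nbhs; split => //; exact: open_lt.
  by apply: filterS => s /= s0; rewrite /possq max_r ?ltW// expr0n.
- apply: near_eq_is_derive (is_derive_X 1 t).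
  have : nbhs t [set s : R | 0 < s] by apply: open_nbhs_nbhs; split => //; exact: open_gt.
  by apply: filterS => s /= s0; rewrite /possq max_l ?ltW.
- rewrite mulr0; apply: (@is_derive0_sq _ _ 1) => h.
  rewrite /possq addr0 maxxx expr0n/= subr0 mul1r ger0_norm ?sqr_ge0//.
  by case: (ltrP 0 h) => h0 //; rewrite expr0n/= sqr_ge0.
Qed.

End RealBump.

Section Laplacian.
Variables (R : realType) (d : nat).
Local Notation V := 'rV[R]_d.
Implicit Types (f g : V -> R) (O : set V).

Definition lap f (x : V) : R := \sum_i partial i (partial i f) x.

Lemma partial_near f g (x : V) i : (\forall y \near x, f y = g y) ->
  \forall y \near x, partial i f y = partial i g y.
Proof.
by move=> /near_join; apply: filterS => y fg; exact: near_eq_derive.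
Qed.

Lemma lap_near f g (x : V) : (\forall y \near x, f y = g y) -> lap f x = lap g x.
Proof.
move=> fg; apply: eq_bigr => i _.
by apply: near_eq_derive; exact: partial_near.
Qed.

Lemma smooth_lap k O f : open O -> smooth k.+2 O f -> smooth k O (lap f).
Proof.
by move=> oO fO; apply: smooth_sum => // i; do 2!apply: smooth_partial.
Qed.

Lemma partialD O f g x i : smooth 1 O f -> smooth 1 O g -> O x ->
  partial i (fun y => f y + g y) x = partial i f x + partial i g x.
Proof.
move=> fO gO Ox; have df := smooth_derive (delta_mx 0 i) fO Ox.
have dg := smooth_derive (delta_mx 0 i) gO Ox.
by rewrite /partial deriveD.
Qed.

Lemma partialM O f g x i : smooth 1 O f -> smooth 1 O g -> O x ->
  partial i (fun y => f y * g y) x = f x * partial i g x + g x * partial i f x.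
Proof.
move=> fO gO Ox; have df := smooth_derive (delta_mx 0 i) fO Ox.
have dg := smooth_derive (delta_mx 0 i) gO Ox.
by rewrite /partial deriveM.
Qed.

Lemma partial_cst x i (c : R) : partial i (fun _ : V => c) x = 0.
Proof. exact: derive_cst. Qed.

Lemma lapD O f g x : open O -> smooth 2 O f -> smooth 2 O g -> O x ->
  lap (fun y => f y + g y) x = lap f x + lap g x.
Proof.
move=> oO fO gO Ox; rewrite /lap -big_split/=; apply: eq_bigr => i _.
rewrite -(@partialD O) //; try exact: smooth_partial.
apply: near_eq_derive; apply: (near_open oO) Ox => y Oy.
by apply: (@partialD O) => //; exact: smoothW.
Qed.

Lemma lapZ O f x c : open O -> smooth 2 O f -> O x ->
  lap (fun y => c * f y) x = c * lap f x.
Proof.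
move=> oO fO Ox; rewrite /lap mulr_sumr; apply: eq_bigr => i _.
have pE g y : smooth 1 O g -> O y ->
    partial i (fun z => c * g z) y = c * partial i g y.
  move=> gO Oy; rewrite (@partialM O)//; last exact: smooth_cst.
  by rewrite partial_cst mulr0 addr0.
rewrite -pE//; last exact: smooth_partial.
apply: near_eq_derive; apply: (near_open oO) Ox => y Oy.
by apply: pE => //; exact: smoothW.
Qed.

Lemma partial_comp O f (h h1 : R -> R) x i : smooth 1 O f -> O x ->
  is_derive (f x) 1 h (h1 (f x)) ->
  partial i (fun y => h (f y)) x = h1 (f x) * partial i f x.
Proof.
move=> fO Ox hd; have df := smooth_derive (delta_mx 0 i) fO Ox.
have := is_derive_comp df hd; rewrite dirgrad_delta => dhf.
by rewrite {1}/partial derive_val.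
Qed.

Lemma lap_comp O f (h h1 h2 : R -> R) x : open O -> smooth 2 O f ->
  (forall y, O y -> is_derive (f y) 1 h (h1 (f y))) ->
  (forall y, O y -> is_derive (f y) 1 h1 (h2 (f y))) -> O x ->
  lap (fun y => h (f y)) x =
    h2 (f x) * (\sum_i partial i f x ^+ 2) + h1 (f x) * lap f x.
Proof.
move=> oO fO hd h1d Ox; rewrite /lap !mulr_sumr -big_split/=.
apply: eq_bigr => i _.
have dp := smooth_derive (delta_mx 0 i) (smooth_partial i fO) Ox.
have df := smooth_derive (delta_mx 0 i) (smoothW fO) Ox.
have dh1 := is_derive_comp df (h1d _ Ox).
transitivity (partial i (fun y => h1 (f y) * partial i f y) x).
  apply: near_eq_derive; apply: (near_open oO) Ox => y Oy.
  by apply: (@partial_comp O) => //; [exact: smoothW|exact: hd].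
rewrite {1}/partial derive_val /GRing.scale/= !dirgrad_delta; ring.
Qed.

Definition N2 (x : V) : R := \sum_i x 0 i ^+ 2.

Lemma N2_ge0 x : 0 <= N2 x.
Proof. by apply: sumr_ge0 => i _; exact: sqr_ge0. Qed.

Lemma N2N x : N2 (- x) = N2 x.
Proof. by apply: eq_bigr => i _; rewrite mxE sqrrN. Qed.

Lemma N20 : N2 0 = 0.
Proof. by apply: big1 => i _; rewrite mxE expr0n. Qed.

Lemma N2B x y : N2 (x - y) = N2 (y - x).
Proof. by rewrite -N2N opprB. Qed.

Lemma N2_eq0 x : N2 x = 0 -> x = 0.
Proof.
move=> /eqP; rewrite psumr_eq0; last by move=> i _; exact: sqr_ge0.
move=> /allP x0; apply/rowP => i; rewrite mxE; apply/eqP.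
by rewrite -(sqrf_eq0 (x 0 i)); apply: x0; rewrite mem_index_enum.
Qed.

(* Stands in for the triangle inequality: losing the factor 2 is harmless
   below and avoids Cauchy-Schwarz. *)
Lemma N2D_le x y : N2 (x + y) <= 2 * N2 x + 2 * N2 y.
Proof.
rewrite /N2 !mulr_sumr -big_split/=; apply: ler_sum => i _; rewrite mxE.
have := sqr_ge0 (x 0 i - y 0 i); lra.
Qed.

Lemma smooth_N2B k O (a : V) : open O -> smooth k O (fun x => N2 (x - a)).
Proof.
move=> oO; apply: smooth_sum => // i.
rewrite (_ : (fun x : V => _) = (fun x : V => (x 0 i + - a 0 i) * (x 0 i + - a 0 i))).
  by apply: smoothM => //; apply: smoothD => //;
    do ?[exact: smooth_coord|exact: smooth_cst].
by apply/funext => x; rewrite !mxE expr2.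
Qed.

Lemma partial_N2B (a x : V) i : partial i (fun x => N2 (x - a)) x = 2 * (x 0 i - a 0 i).
Proof.
apply: (@partial_eq _ _ (fun i x => 2 * (x 0 i - a 0 i))) => b.
apply/is_derive_line.
have -> : (fun t : R => N2 (t *: b + x - a)) =
    \sum_i (fun t : R => (t * b 0 i + (x 0 i - a 0 i)) ^+ 2).
  apply/funext => t; rewrite fct_sumE; apply: eq_bigr => j _.
  by rewrite !mxE addrA.
rewrite (_ : dirgrad _ _ _ = \sum_i b 0 i * (2 * (x 0 i - a 0 i)))//.
apply: is_derive_sum => j.
have dl : is_derive (0 : R) 1 (fun t : R => t * b 0 j + (x 0 j - a 0 j)) (b 0 j).
  have -> : (fun t : R => t * b 0 j + (x 0 j - a 0 j)) =
    ((fun t : R => t) \* (cst (b 0 j))) \+ cst (x 0 j - a 0 j) by [].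
  by apply: is_derive_eq; rewrite scaler0 add0r addr0 [LHS]mulr1.
apply: is_derive_eq.
by rewrite /GRing.scale/= mul0r add0r; ring.
Qed.

Lemma lap_N2B (a x : V) : lap (fun x => N2 (x - a)) x = 2 * d%:R.
Proof.
rewrite /lap (eq_bigr (fun=> 2)); last first.
  move=> i _.
  have -> : partial i (fun x => N2 (x - a)) = fun x => 2 * (x 0 i - a 0 i).
    by apply/funext => y; exact: partial_N2B.
  apply: (etrans (y := 2 * 1)); last by rewrite mulr1.
  have dc := is_derive_coord i x (delta_mx 0 i).
  have -> : (fun x0 : V => 2 * (x0 0 i - a 0 i)) =
    2 *: ((fun x0 : V => x0 0 i) \- cst (a 0 i)) by [].
  by rewrite /partial derive_val subr0 mxE !eqxx.
by rewrite sumr_const card_ord mulr_natr.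
Qed.

Lemma grad_N2B (a x : V) :
  \sum_i partial i (fun x => N2 (x - a)) x ^+ 2 = 4 * N2 (x - a).
Proof.
rewrite mulr_sumr; apply: eq_bigr => i _.
by rewrite partial_N2B !mxE; ring.
Qed.

Lemma N2B_continuous a : continuous (fun x : V => N2 (x - a)).
Proof. by move=> x; have [] := @smooth_N2B 0 setT a openT x I. Qed.

Lemma N2_continuous : continuous N2.
Proof.
by move=> x; have := @N2B_continuous 0 x; under eq_fun do rewrite subr0.
Qed.

End Laplacian.

(** * Integrals over R^d *)

Section Integrals.
Variables (R : realType) (d : nat).
Local Notation V := 'rV[R]_d.
Local Notation lam := (@leb R d).
Implicit Types (f g : V -> R).

Lemma measurable_open (U : set V) : open U -> measurable U.
Proof. by move=> oU; apply: sub_sigma_algebra. Qed.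

Lemma measurable_closed (U : set V) : closed U -> measurable U.
Proof.
by move=> cU; rewrite -(setCK U); apply: measurableC; apply: measurable_open; exact: closed_openC.
Qed.

Lemma continuous_measurable_rV f : continuous f -> measurable_fun [set: V] f.
Proof.
move=> cf; apply: (measurability _ (RGenOpens.measurableE R)) => // _ [_ [a [b ->]] <-].
rewrite setTI; apply: measurable_open.
by move/continuousP: cf; apply; exact: interval_open.
Qed.

Lemma smooth_measurable k f : smooth k setT f -> measurable_fun [set: V] f.
Proof.
by move=> sf; apply: continuous_measurable_rV => x; exact: (smooth_continuous sf).
Qed.

(** Balls are indexed by the square of the radius throughout, so that only the polynomial [N2]
    occurs and no root. *)
Definition cball0 (c : R) : set V := [set y | N2 y <= c].

Lemma measurable_cball0 c : measurable (cball0 c).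
Proof.
apply: measurable_closed; apply: (@closed_comp _ _ _ [set t : R | t <= c]).
  by move=> x _; exact: N2_continuous.
exact: closed_le.
Qed.

Lemma coord_le_N2 (x : V) i : x 0 i ^+ 2 <= N2 x.
Proof.
by rewrite /N2 (bigD1 i)//= lerDl; apply: sumr_ge0 => j _; exact: sqr_ge0.
Qed.

(** A crude bound free of roots, from [2 t <= t^2 + 1]. *)
Lemma norm_coord_N2 (x : V) (c : R) i : N2 x <= c -> `|x 0 i| <= c + 1.
Proof.
move=> /(le_trans (coord_le_N2 x i)) xc.
have := real_normK (num_real (x 0 i)); have := normr_ge0 (x 0 i).
move: xc; set t := `|_|; move=> xc t0 tE; rewrite -tE in xc.
have := sqr_ge0 (t - 1); nra.
Qed.

Lemma leb_cball0_fin c : (lam (cball0 c) < +oo)%E.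
Proof.
have [c0|c0] := ltP c 0.
  rewrite (_ : cball0 c = set0) ?measure0// -subset0 => x /= xc.
  by have := le_lt_trans (le_trans (N2_ge0 x) xc) c0; rewrite ltxx.
apply: (@le_lt_trans _ _ (lam (@box R d (c + 1)))).
  apply: le_measure; rewrite ?inE; [exact: measurable_cball0|exact: measurable_box|].
  by move=> x xc i; exact: norm_coord_N2.
by rewrite /leb/= lebesgue_rV_box ?ltry// addr_ge0.
Qed.

Lemma leb_cball0_gt0 c : 0 < c -> (0 < lam (cball0 c))%E.
Proof.
(* On the box of half-side [a], [x_i^2 <= a^2 <= a] because [a <= 1], and the sum over [d]
   coordinates is at most [d c / (d + 1) <= c]. *)
move=> c0; pose a := Num.min 1 (c / (d%:R + 1)).
have a0 : 0 < a by rewrite lt_min ltr01 divr_gt0// ltr_wpDl.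
apply: (@lt_le_trans _ _ (lam (@box R d a))).
  rewrite /leb/= lebesgue_rV_box; last exact: ltW.
  by rewrite lte_fin exprn_gt0// mulr_gt0.
apply: le_measure; rewrite ?inE; [exact: measurable_box|exact: measurable_cball0|].
move=> x xa; rewrite /cball0/=.
have xi i : x 0 i ^+ 2 <= a.
  rewrite -(real_normK (num_real _)) expr2.
  apply: le_trans (_ : a * 1 <= _); last by rewrite mulr1.
  by apply: ler_pM => //; apply: le_trans (xa i) _; rewrite ge_min lexx.
apply: (@le_trans _ _ (\sum_(i < d) a)); first by apply: ler_sum => i _.
rewrite sumr_const card_ord -mulr_natl.
apply: (@le_trans _ _ (d%:R * (c / (d%:R + 1)))).
  by rewrite ler_wpM2l// ge_min lexx orbT.
rewrite mulrCA ler_piMr//; first exact: ltW.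
by apply/ltW; rewrite ltr_pdivrMr ?mul1r ?ltrDl// ltr_wpDl.
Qed.

(* Bounded, Borel, with bounded support. *)
Definition bbs f := measurable_fun [set: V] f /\
  exists M, forall x, `|f x| <= M /\ (M < N2 x -> f x = 0).

Lemma bounded_near_le (T : Type) (A : set T) (f : T -> R) M :
  (forall x, A x -> `|f x| <= M) -> [bounded f x | x in A].
Proof.
move=> fM; exists M; split; first exact: num_real.
by move=> y My x Ax; apply: le_trans (fM _ Ax) (ltW My).
Qed.

Lemma bbs_supp f c : measurable_fun setT f -> (exists M, forall x, `|f x| <= M) ->
  (forall x, c < N2 x -> f x = 0) -> bbs f.
Proof.
move=> mf [M fM] f0; split=> //; exists (Num.max c M) => x; split.
  by rewrite le_max fM orbT.
by rewrite gt_max => /andP[/f0].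
Qed.

Lemma bbs_integrable f : bbs f -> lam.-integrable setT (EFin \o f).
Proof.
move=> [mf [M fM]].
have -> : EFin \o f = (EFin \o f) \_ (cball0 M).
  apply/funext => x; rewrite patchE; case: ifPn => //= xM.
  rewrite (proj2 (fM x))// ltNge; apply: contra xM => xM.
  exact/mem_set.
apply/(integrable_mkcond _ (measurable_cball0 M)).
apply: measurable_bounded_integrable.
- exact: measurable_cball0.
- exact: leb_cball0_fin.
- exact: measurable_funTS.
- by apply: (@bounded_near_le _ _ _ M) => x _; have [] := fM x.
Qed.

Lemma bbs_bound f : bbs f -> exists2 M, 0 <= M & forall x, `|f x| <= M.
Proof.
move=> [mf [M fM]]; exists M; first by apply: le_trans (proj1 (fM (0 : V))).
by move=> x; have [] := fM x.
Qed.

Lemma bbsM f g : bbs f -> measurable_fun setT g ->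
  (exists M, forall x, `|g x| <= M) -> bbs (fun x => f x * g x).
Proof.
move=> [mf [M fM]] mg [N gN]; apply: (@bbs_supp _ M).
- exact: measurable_funM.
- exists (M * N) => x; rewrite normrM ler_pM//; first by have [] := fM x.
- by move=> x Mx; rewrite (proj2 (fM x)) ?mul0r.
Qed.

Lemma bbsD f g : bbs f -> bbs g -> bbs (fun x => f x + g x).
Proof.
move=> [mf [M fM]] [mg [N gN]]; apply: (@bbs_supp _ (Num.max M N)).
- exact: measurable_funD.
- exists (M + N) => x; apply: le_trans (ler_normD _ _) _; apply: lerD.
    by have [] := fM x.
  by have [] := gN x.
- move=> x; rewrite gt_max => /andP[Mx Nx].
  by rewrite (proj2 (fM x))// (proj2 (gN x))// addr0.
Qed.

Lemma bbs0 : bbs (fun=> 0).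
Proof.
apply: (@bbs_supp _ 0) => //.
by exists 0 => x; rewrite normr0.
Qed.

Lemma bbs_sum (I : Type) (r : seq I) (F : I -> V -> R) :
  (forall i, bbs (F i)) -> bbs (fun x => \sum_(i <- r) F i x).
Proof.
move=> FO; elim: r => [|i r IH].
  by under eq_fun do rewrite big_nil; exact: bbs0.
by under eq_fun do rewrite big_cons; exact: bbsD.
Qed.

Lemma bbsZ f c : bbs f -> bbs (fun x => c * f x).
Proof.
move=> bf; under eq_fun do rewrite mulrC.
by apply: bbsM => //; exists `|c| => x.
Qed.

Lemma measurable_comp_shift f (a : V) : measurable_fun setT f ->
  measurable_fun [set: V] (fun x => f (x + a)).
Proof. by move=> mf; apply: measurableT_comp => //; exact: measurable_shift. Qed.

Lemma bbs_shift f (a : V) : bbs f -> bbs (fun x => f (x + a)).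
Proof.
move=> [mf [M fM]]; apply: (@bbs_supp _ (2 * M + 2 * N2 a)).
- exact: measurable_comp_shift.
- by exists M => x; have [] := fM (x + a).
- move=> x Mx; apply: (proj2 (fM (x + a))).
  have := N2D_le (x + a) (- a); rewrite addrK N2N; lra.
Qed.

Lemma bbs_opp f : bbs f -> bbs (fun x => f (- x)).
Proof.
move=> [mf [M fM]]; split.
  by apply: measurableT_comp => //; exact: measurable_opp_rV.
by exists M => x; have := fM (- x); rewrite N2N.
Qed.

Lemma int_preserves (S : V -> V) f : preserves (lebesgue_rV R d) S -> bbs f ->
  bbs (fun x => f (S x)) -> \int[lam]_x f (S x) = \int[lam]_x f x.
Proof.
move=> pS bf bfS; rewrite /Rintegral; congr fine.
have [mS SE] := pS.
have := @integral_pushforward _ _ V V R S mS lam setT (EFin \o f).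
rewrite preimage_setT => <- //.
- by apply: eq_measure_integral => A mA _; rewrite /pushforward; exact: SE.
- by apply/measurable_EFinP; case: bf.
- exact: bbs_integrable.
Qed.

Lemma int_shift f (a : V) : bbs f -> \int[lam]_x f (x + a) = \int[lam]_x f x.
Proof.
move=> bf; apply: (@int_preserves (fun x => x + a)) => //.
  exact: lebesgue_rV_shift.
exact: bbs_shift.
Qed.

Lemma int_opp f : bbs f -> \int[lam]_x f (- x) = \int[lam]_x f x.
Proof.
move=> bf; apply: (@int_preserves (fun x => - x)) => //.
  exact: lebesgue_rV_opp.
exact: bbs_opp.
Qed.

Lemma int_le f g : bbs f -> bbs g -> (forall x, f x <= g x) ->
  \int[lam]_x f x <= \int[lam]_x g x.
Proof. by move=> bf bg fg; apply: le_Rintegral => //; exact: bbs_integrable. Qed.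

Lemma intD f g : bbs f -> bbs g ->
  \int[lam]_x (f x + g x) = \int[lam]_x f x + \int[lam]_x g x.
Proof. by move=> bf bg; apply: RintegralD => //; exact: bbs_integrable. Qed.

Lemma intZ f c : bbs f -> \int[lam]_x (c * f x) = c * \int[lam]_x f x.
Proof. by move=> bf; apply: RintegralZl => //; exact: bbs_integrable. Qed.

Lemma int_sum (I : Type) (r : seq I) (F : I -> V -> R) :
  (forall i, bbs (F i)) ->
  \int[lam]_x (\sum_(i <- r) F i x) = \sum_(i <- r) \int[lam]_x F i x.
Proof.
move=> FO; elim: r => [|i r IH].
  rewrite big_nil; under eq_Rintegral do rewrite big_nil.
  by rewrite Rintegral_cst// mul0r.
rewrite big_cons -IH -intD//; last exact: bbs_sum.
by apply: eq_Rintegral => x _; rewrite big_cons.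
Qed.

End Integrals.

Lemma is_derive1_cvg (R : realType) (f : R -> R) (x l : R) :
  h^-1 *: (f (h + x) - f x) @[h --> 0^'] --> l -> is_derive x 1 f l.
Proof.
move=> fl; apply: is_derive_cvg.
by under eq_fun do rewrite [_ *: 1]mulr1.
Qed.

Section RealIntegrable.
Variables (R : realType) (dT : measure_display) (T : measurableType dT).
Variables (m : {measure set T -> \bar R}) (D : set T) (mD : measurable D).
Implicit Types f g : T -> R.

Lemma integrable_subr f g : m.-integrable D (EFin \o f) ->
  m.-integrable D (EFin \o g) -> m.-integrable D (EFin \o (fun t => f t - g t)).
Proof.
move=> fi gi; apply: (eq_integrable mD _ _ _ (integrableB mD fi gi)) => t _ /=.
by rewrite EFinB.
Qed.

Lemma integrable_mull f c : m.-integrable D (EFin \o f) ->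
  m.-integrable D (EFin \o (fun t => c * f t)).
Proof.
move=> fi; apply: (eq_integrable mD _ _ _ (integrableZl mD c fi)) => t _ /=.
by rewrite EFinM.
Qed.

End RealIntegrable.

(** * Convolutions and differentiation under the integral sign *)

Section UnderIntegral.
Variables (R : realType) (d : nat).
Local Notation V := 'rV[R]_d.
Implicit Types (f g : V -> R).

Fixpoint bdd k f : Prop :=
  (exists M, forall x, `|f x| <= M) /\
  if k is j.+1 then forall i : 'I_d, bdd j (partial i f) else True.

Lemma bdd_bound k f : bdd k f -> exists M, forall x, `|f x| <= M.
Proof. by case: k => [|k] []. Qed.

Lemma bddW k f : bdd k.+1 f -> bdd k f.
Proof.
elim: k f => [|k IH] f [bf pf]; split=> // i; exact: IH.
Qed.

Lemma norm_coord_le (x : V) i : `|x 0 i| <= `|x|.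
Proof. by rewrite [leRHS]mx_normrE; exact: (le_bigmax _ _ (0, i)). Qed.

Lemma bdd_dirgrad f : bdd 1 f -> exists2 C, 0 <= C &
  forall x a, `|dirgrad (fun i => partial i f) x a| <= C * `|a|.
Proof.
move=> [_ pf].
have /choice[M MP] : forall i, exists M, forall x, `|partial i f x| <= M.
  by move=> i; have [] := pf i.
have M0 i : 0 <= M i by apply: le_trans (MP i (0 : V)).
exists (\sum_i M i); first by apply: sumr_ge0.
move=> x a; rewrite /dirgrad (le_trans (ler_norm_sum _ _ _))//.
rewrite mulr_suml; apply: ler_sum => i _; rewrite normrM mulrC.
by apply: ler_pM => //; exact: norm_coord_le.
Qed.

Lemma is_derive_segment (O : set V) f (x a : V) (t : R) : smooth 1 O f ->
  O (t *: a + x) ->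
  is_derive t 1 (fun s : R => f (s *: a + x)) (dirgrad (fun i => partial i f) (t *: a + x) a).
Proof.
move=> sf Ot; have := smooth_derive a sf Ot.
move=> /is_derive_line df.
have := @is_derive1_comp _ (fun h : R => f (h *: a + (t *: a + x)))
  (fun s : R => s - t) t (dirgrad (fun i => partial i f) (t *: a + x) a) 1.
rewrite subrr => /(_ df) H.
have dst : is_derive t (1 : R) (fun s : R => s - t) 1.
  have -> : (fun s : R => s - t) = id - cst t by [].
  by apply: is_derive_eq; rewrite subr0.
have := H dst; rewrite mulr1; congr is_derive; apply/funext => s /=.
by rewrite addrA -scalerDl subrK.
Qed.

Lemma bdd_lipschitz f : smooth 1 setT f -> bdd 1 f ->
  exists2 C, 0 <= C & forall x y, `|f x - f y| <= C * `|x - y|.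
Proof.
move=> sf bf; have [C C0 CP] := bdd_dirgrad bf; exists C => // x y.
have dF (t : R) := @is_derive_segment setT f y (x - y) t sf I.
have cF : {within `[0, 1], continuous (fun s : R => f (s *: (x - y) + y))}.
  apply: continuous_subspaceT => t; apply: differentiable_continuous.
  by apply/derivable1_diffP; have [] := dF t.
have [c _] := MVT_segment ler01 (fun t _ => dF t) cF.
by rewrite scale1r scale0r add0r subrK subr0 mulr1 => ->; exact: CP.
Qed.

Variables (dT : measure_display) (T : measurableType dT).
Variables (m : {measure set T -> \bar R}) (u : T -> R) (g : T -> V).
Hypothesis iu : m.-integrable setT (EFin \o u).
Hypothesis mg : measurable_fun setT g.

Let mu_ : measurable_fun setT u.
Proof. by apply/measurable_EFinP; exact: measurable_int iu. Qed.

(** A convolution whose derivatives all fall on [f], so that [u] need only be integrable. The usual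
    one is obtained for [m] the Lebesgue measure and [g t = - t]. *)
Definition superpose f (x : V) : R := \int[m]_t (u t * f (x + g t)).

Lemma superpose_measurable f (x : V) : measurable_fun setT f ->
  measurable_fun setT (fun t => f (x + g t)).
Proof.
move=> mf; under eq_fun do rewrite addrC.
by apply: (measurableT_comp (measurable_comp_shift x mf)).
Qed.

Lemma superpose_integrable f (x : V) : measurable_fun setT f ->
  (exists M, forall x, `|f x| <= M) ->
  m.-integrable setT (EFin \o (fun t => u t * f (x + g t))).
Proof.
move=> mf [M fM]; have mfx := superpose_measurable x mf.
rewrite (_ : EFin \o _ = ((EFin \o u) \* (EFin \o (fun t => f (x + g t)%R)))%E).
  apply: integrableMl => //.
  by apply: (@bounded_near_le _ _ _ _ M) => t _; exact: fM.
by apply/funext => t /=; rewrite EFinM.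
Qed.

Lemma superpose_continuous f : smooth 1 setT f -> bdd 1 f ->
  continuous (superpose f).
Proof.
move=> sf bf; have [C C0 CP] := bdd_lipschitz sf bf.
have mf := smooth_measurable sf.
pose D := \int[m]_t `|u t|.
have D0 : 0 <= D by apply: Rintegral_ge0 => t _.
have L x y : `|superpose f x - superpose f y| <= C * D * `|x - y|.
  have ix := superpose_integrable x mf (bdd_bound bf).
  have iy := superpose_integrable y mf (bdd_bound bf).
  rewrite /superpose -RintegralB//.
  apply: le_trans (le_normr_Rintegral _ _) _ => //.
    exact: integrable_subr.
  rewrite mulrAC /D -RintegralZl//; last exact: integrable_norm.
  apply: le_Rintegral => //.
  - by apply/integrable_norm/integrable_subr.
  - by apply/integrable_mull/integrable_norm.
  - move=> t _; rewrite -mulrBr normrM mulrC ler_wpM2r//.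
    apply: le_trans (CP _ _) _; rewrite ler_wpM2l//.
    by rewrite opprD addrACA subrr addr0.
move=> x; apply/(@cvgrPdist_lt _ _ _ (nbhs (x : V)) (nbhs_filter (x : V))) => e e0.
have CD : 0 < C * D + 1 by rewrite ltr_wpDl// mulr_ge0.
have ne : \forall y \near x, `|x - y| < (C * D + 1)^-1 * e.
  have e1 : 0 < (C * D + 1)^-1 * e by rewrite mulr_gt0 ?invr_gt0.
  have := @nbhsx_ballx _ V x _ e1.
  by apply: filterS => y; rewrite -ball_normE.
apply: filterS ne => y xy; apply: le_lt_trans (L _ _) _.
apply: (@le_lt_trans _ _ ((C * D + 1) * `|x - y|)).
  by rewrite ler_wpM2r// lerDl.
by rewrite -ltr_pdivlMl.
Qed.

(** Differentiation under the integral along [h |-> x + h a], dominated for [|h| < 1] by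
    [C |a| |u|], where [C] comes from the bounds on the partial derivatives of [f]. *)
Lemma superpose_derive f (x a : V) : smooth 1 setT f -> bdd 1 f ->
  is_derive x a (superpose f) (dirgrad (fun i => superpose (partial i f)) x a).
Proof.
move=> sf bf; have [C C0 CP] := bdd_dirgrad bf.
have mf := smooth_measurable sf.
apply/is_derive_line; apply: is_derive1_cvg.
pose F (h : R) t := u t * f (h *: a + x + g t).
have dF (h : R) t : is_derive h 1 (F ^~ t)
    (u t * dirgrad (fun i => partial i f) (h *: a + x + g t) a).
  have df := @is_derive_segment setT f (x + g t) a h sf I.
  have -> : F ^~ t = u t *: (fun s : R => f (s *: a + (x + g t))).
    by apply/funext => s; rewrite /F -addrA.
  by rewrite -addrA; apply: is_deriveZ.
have mpf i : measurable_fun setT (partial i f) by exact: (smooth_measurable (smooth_partial i sf)).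
have bpf i : exists M, forall y, `|partial i f y| <= M by have [_ /(_ i)[]] := bf.
have p1E h t : partial1of2 F h t = u t * dirgrad (fun i => partial i f) (h *: a + x + g t) a.
  by rewrite partial1of2E derive_val.
have -> : dirgrad (fun i => superpose (partial i f)) x a =
    \int[m]_(t in setT) partial1of2 F 0 t.
  transitivity (\int[m]_t (\sum_i a 0 i * (u t * partial i f (x + g t)))); last first.
    apply: eq_Rintegral => t _; rewrite p1E scale0r add0r /dirgrad mulr_sumr.
    by apply: eq_bigr => i _; rewrite mulrCA.
  rewrite /dirgrad /superpose /Rintegral.
  under [in RHS]eq_integral do rewrite -sumEFin.
  rewrite integral_sum//; last first.
    by move=> i; apply/integrable_mull => //; exact: superpose_integrable.
  rewrite -sum_fine; last first.
    move=> i _; apply: integrable_fin_num => //.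
    by apply/integrable_mull => //; exact: superpose_integrable.
  apply: eq_bigr => i _; under [in RHS]eq_integral do rewrite EFinM.
  rewrite integralZl//; last exact: superpose_integrable.
  rewrite fineM//; apply: integrable_fin_num => //; exact: superpose_integrable.
have := @cvg_differentiation_under_integral R _ T m F setT measurableT 0 (-1) 1.
move=> /(_ _ _ _ (fun t => `|u t| * (C * `|a|))); apply.
- by rewrite /= in_itv/= oppr_lt0 ltr01.
- by move=> h _; apply: superpose_integrable => //; exact: bdd_bound bf.
- by move=> h t _ _; have [] := dF h t.
- by move=> t; rewrite !mulr_ge0.
- rewrite (_ : (fun t => _) = (fun t => (C * `|a|) * `|u t|)).
    by apply/integrable_mull/integrable_norm.
  by apply/funext => t; rewrite mulrC.
- by move=> h t _ _; rewrite p1E normrM ler_wpM2l.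
Qed.

(** One order is lost since continuity is obtained from a Lipschitz bound, hence from bounded first
    derivatives. This costs nothing for kernels smooth to all orders. *)
Lemma superpose_smooth k f : smooth k.+1 setT f -> bdd k.+1 f ->
  smooth k setT (superpose f).
Proof.
elim: k f => [|k IH] f sf bf.
  by move=> x _; split => //; apply: superpose_continuous.
have sf1 := smooth_le (ltn0Sn k : (1 <= k.+2)%N) sf.
have bf1 : bdd 1 f by case: bf => bf pf; split => // i; case: (pf i).
apply: (@smooth_intro _ _ _ _ _ (fun i => superpose (partial i f))).
- exact: openT.
- by move=> x _; apply: superpose_continuous.
- by move=> x a _; exact: superpose_derive.
- by move=> i; apply: IH; [exact: smooth_partial|have [_ pf] := bf; exact: pf].
Qed.

End UnderIntegral.

Section Segments.
Variables (R : realType) (d : nat).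
Local Notation V := 'rV[R]_d.
Local Notation lam := (@leb R d).
Implicit Types (f g : V -> R).

(** By translation invariance the integral of [F (y + h e)] does not depend on [h]; its derivative
    at [h = 0] is the integral of [F']. Applied to a product, this is integration by parts. *)
Lemma int_partial0 (F F' : V -> R) i : bbs F -> bbs F' ->
  (forall y, is_derive y (delta_mx 0 i) F (F' y)) -> \int[lam]_y F' y = 0.
Proof.
move=> bF bF' dF; set e : V := delta_mx 0 i.
have [mF' [M F'M]] := bF'.
pose f (h : R) y := F (y + h *: e).
have df (h : R) y : is_derive h 1 (f ^~ y) (F' (y + h *: e)).
  have /is_derive_line d0 := dF (y + h *: e).
  have := @is_derive1_comp _ (fun s : R => F (s *: e + (y + h *: e)))
    (fun s : R => s - h) h (F' (y + h *: e)) 1.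
  rewrite subrr => /(_ d0) H.
  have dst : is_derive h (1 : R) (fun s : R => s - h) 1.
    have -> : (fun s : R => s - h) = id - cst h by [].
    by apply: is_derive_eq; rewrite subr0.
  have := H dst; rewrite mulr1; congr is_derive; apply/funext => s /=.
  by rewrite addrCA -scalerDl subrK.
(* [M] bounds [F'] and is also a squared radius beyond which [F'] vanishes. For [|h| <= 1], a point
   [y] with [N2 (y + h e) <= M] has [N2 y <= 2 M + 2 N2 e], so [G] dominates all the translates. *)
pose G (y : V) := M * \1_(cball0 (2 * M + 2 * N2 e)) y.
have M0 : 0 <= M by apply: le_trans (proj1 (F'M (0 : V))).
have N2Z (h : R) : `|h| <= 1 -> N2 (h *: e) <= N2 e.
  move=> h1; apply: ler_sum => j _; rewrite mxE exprMn ler_piMl ?sqr_ge0//.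
  by rewrite -real_normK ?num_real// expr_le1.
have : h^-1 *: (\int[lam]_y f (h + 0) y - \int[lam]_y f 0 y) @[h --> 0^'] -->
    \int[lam]_y partial1of2 f 0 y.
  apply: (@cvg_differentiation_under_integral R _ V lam f setT measurableT 0 (-1) 1 _ _ _ G).
  - by rewrite /= in_itv/= oppr_lt0 ltr01.
  - by move=> h _; apply/bbs_integrable/bbs_shift.
  - by move=> h t _ _; have [] := df h t.
  - by move=> t; rewrite mulr_ge0.
  - apply: bbs_integrable; apply: bbsZ; apply: (@bbs_supp _ _ _ (2 * M + 2 * N2 e)).
    + exact: measurable_indic (measurable_cball0 _).
    + by exists 1 => x; rewrite indicE; case: (_ \in _); rewrite ?normr0 ?normr1.
    + by move=> x Mx; rewrite indicE memNset//= => xM; move: Mx; rewrite ltNge xM.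
  - move=> h y; rewrite /= in_itv/= => /andP[h1 h2] _; rewrite partial1of2E derive_val /G.
    have [F'y F'y0] := F'M (y + h *: e).
    have [My|yM] := ltP M (N2 (y + h *: e)); first by rewrite F'y0// normr0 mulr_ge0.
    rewrite indicE mem_set ?mulr1// /cball0/=.
    have := N2D_le (y + h *: e) (- (h *: e)); rewrite addrK N2N.
    have h1' : `|h| <= 1 by rewrite ler_norml (ltW h1) (ltW h2).
    have := N2Z h h1'; lra.
rewrite (_ : (fun h => _) = cst 0); last first.
  by apply/funext => h /=; rewrite !int_shift// subrr scaler0.
move=> /(cvg_unique _ (cvg_cst 0)) => /(_ _)/esym H.
rewrite -[RHS]H//; apply: eq_Rintegral => y _.
by rewrite partial1of2E derive_val scale0r addr0.
Qed.

End Segments.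

(** * Smooth cutoffs and compactly supported functions *)

Section Cutoff.
Variable R : realType.

(** Nesting [ebump] gives a cutoff by composition alone: the inner difference equals [ebump (b - a)]
    for [s <= a] and is nonpositive for [s >= b]. The constant factor normalises the first value to
    1. *)
Definition cutoff (a b s : R) : R :=
  (ebump (ebump (b - a)))^-1 * ebump (ebump (b - a) - ebump (s - a)).

Lemma cutoff1 a b s : a < b -> s <= a -> cutoff a b s = 1.
Proof.
move=> ab sa; rewrite /cutoff (@ebump_le0 _ (s - a)) ?subr_le0// subr0 mulVf//.
by rewrite gt_eqF// !ebump_gt0// subr_gt0.
Qed.

Lemma cutoff0 a b s : b <= s -> cutoff a b s = 0.
Proof.
move=> bs; rewrite /cutoff [X in _ * X]ebump_le0 ?mulr0//.
by rewrite subr_le0 ebump_le// lerD2r.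
Qed.

Lemma smooth_cutoff d k (O : set 'rV[R]_d) f a b : open O -> smooth k O f ->
  smooth k O (fun x => cutoff a b (f x)).
Proof.
move=> oO fO; apply: smoothZ => //.
apply: (@smooth_comp _ _ _ _ setT (fun x => ebump (b - a) - ebump (f x - a)) (@ebump R)) => //.
  exact: rsmooth_flat.
apply: smoothD => //; first exact: smooth_cst.
rewrite (_ : (fun x => _) = (fun x => (-1) * ebump (f x - a))); last first.
  by apply/funext => x; rewrite mulN1r.
apply: smoothZ => //.
apply: (@smooth_comp _ _ _ _ setT (fun x => f x - a) (@ebump R)) => //.
  exact: rsmooth_flat.
by apply: smoothD => //; exact: smooth_cst.
Qed.

End Cutoff.

Section BoundedSupport.
Variables (R : realType) (d : nat).
Local Notation V := 'rV[R]_d.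
Local Notation lam := (@leb R d).
Implicit Types (f g v : V -> R) (O : set V).

Lemma compact_N2_le (x : V) c : compact [set y | N2 (y - x) <= c].
Proof.
apply: bounded_closed_compact.
  exists (`|x| + (c + 1)); split; first exact: num_real.
  move=> M xM y /= yc; apply: le_trans (ltW xM).
  rewrite -[y](subrK x) addrC (le_trans (ler_normD _ _))// lerD2l.
  rewrite [leLHS]mx_normrE; apply/bigmax_leP => /=; split.
    by rewrite addr_ge0// (le_trans _ yc)// N2_ge0.
  by case=> i j _ /=; rewrite (ord1 i); exact: norm_coord_N2.
apply: (@closed_comp _ _ _ [set t : R | t <= c]).
  by move=> y _; exact: N2B_continuous.
exact: closed_le.
Qed.

(** The part outside [O] of the ball of squared radius [c + 1] is compact. Unless it is empty,
    [N2 (y - x)] has a minimum there, which exceeds [c]; half of the gap can be added. *)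
Lemma ball_room O (x : V) c : open O -> (forall y, N2 (y - x) <= c -> O y) ->
  exists2 e, 0 < e & forall y, N2 (y - x) <= c + e -> O y.
Proof.
move=> oO xO; pose C := [set y | N2 (y - x) <= c + 1] `&` ~` O.
have cC : compact C.
  apply: (@subclosed_compact _ C [set y | N2 (y - x) <= c + 1]).
  - apply: closedI; last exact: open_closedC.
    by apply: compact_closed; [exact: norm_hausdorff|exact: compact_N2_le].
  - exact: compact_N2_le.
  - by move=> y [].
have [C0|C0] := pselect (C !=set0); last first.
  exists 1 => // y yc; apply: contrapT => Oy; apply: C0; exists y; split => //.
have cN : {within C, continuous (fun y => N2 (y - x))}.
  by apply: continuous_subspaceT; exact: N2B_continuous.
have [z zC zmin] := compact_EVT_min C0 cC cN.
move: zC; rewrite inE => -[zc zO].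
have cz : c < N2 (z - x) by rewrite ltNge; apply/negP => /xO.
exists (Num.min 1 ((N2 (z - x) - c) / 2)).
  by rewrite lt_min ltr01 divr_gt0// subr_gt0.
move=> y yc; apply: contrapT => Oy.
have : N2 (z - x) <= N2 (y - x).
  apply: zmin; rewrite inE; split => //=; apply: le_trans yc _.
  by rewrite lerD2l ge_min lexx.
have h2 : N2 (y - x) <= c + (N2 (z - x) - c) / 2.
  by apply: le_trans yc _; rewrite lerD2l ge_min lexx orbT.
lra.
Qed.

Lemma supp_bdd k f (x : V) c : smooth k setT f ->
  (forall y, c < N2 (y - x) -> f y = 0) -> bdd k f.
Proof.
have bcont g : continuous g -> (forall y, c < N2 (y - x) -> g y = 0) ->
    exists M, forall y, `|g y| <= M.
  move=> cg g0; pose K := [set y | N2 (y - x) <= c].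
  have [K0|K0] := pselect (K !=set0); last first.
    exists 0 => y; rewrite g0 ?normr0// ltNge; apply/negP => yc.
    by apply: K0; exists y.
  have cK : {within K, continuous (fun y => `|g y|)}.
    apply: continuous_subspaceT => y; apply: continuous_comp; first exact: cg.
    exact: norm_continuous.
  have [z _ zmax] := compact_EVT_max K0 (@compact_N2_le x c) cK.
  exists `|g z| => y; have [yc|yc] := leP (N2 (y - x)) c.
    by apply: zmax; rewrite inE.
  by rewrite g0// normr0.
elim: k f => [|k IH] f sf f0.
  by split => //; apply: bcont => // y; exact: (smooth_continuous sf).
split; first by apply: bcont => // y; exact: (smooth_continuous sf).
move=> i; apply: IH; first exact: smooth_partial.
move=> y cy; rewrite -[RHS](@partial_cst R d y i 0); apply: near_eq_derive.
apply: (@near_open _ _ [set z | c < N2 (z - x)]) cy => //.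
apply: (@open_comp _ _ _ [set t : R | c < t]); last exact: open_gt.
by move=> z _; exact: N2B_continuous.
Qed.

Lemma int_dct (f_ : nat -> V -> R) f g : bbs g ->
  (forall n, measurable_fun setT (f_ n)) -> (forall n x, `|f_ n x| <= g x) ->
  (forall x, f_ n x @[n --> \oo] --> f x) ->
  \int[lam]_x f_ n x @[n --> \oo] --> \int[lam]_x f x.
Proof.
move=> bg mf fg ff.
have mf' n : measurable_fun setT (EFin \o f_ n) by exact/measurable_EFinP.
have ff' x : setT x -> (EFin \o f_ n) x @[n --> \oo] --> (EFin \o f) x.
  by move=> _; apply: cvg_EFin; [exact: nearW|exact: ff].
have mlim : measurable_fun setT (EFin \o f).
  exact: (emeasurable_fun_cvg _ _ mf' ff').
have [If _ H] := @dominated_convergence _ _ _ lam setT measurableT _ _ (EFin \o g) mf' mlim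
  (aeW _ ff') (bbs_integrable bg) (aeW _ (fun x n _ => fg n x)).
by apply: fine_cvg; rewrite fineK//; exact: integrable_fin_num.
Qed.

Lemma int_derive (f f' : R -> V -> R) g (t : R) :
  (forall s, bbs (f s)) -> bbs g -> (forall s y, `|f' s y| <= g y) ->
  (forall (s : R) y, is_derive s 1 (f ^~ y) (f' s y)) ->
  is_derive t 1 (fun s => \int[lam]_y f s y) (\int[lam]_y f' t y).
Proof.
move=> bf bg f'g df.
apply: is_derive1_cvg.
have -> : \int[lam]_y f' t y = \int[lam]_(y in setT) partial1of2 f t y.
  by apply: eq_Rintegral => y _; rewrite partial1of2E derive_val.
apply: (@cvg_differentiation_under_integral R _ V lam f setT measurableT t (t - 1) (t + 1) _ _ _ g).
- by rewrite /= in_itv/= ltrBlDr !ltrDl ltr01.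
- by move=> h _; exact: bbs_integrable.
- by move=> h y _ _; have [] := df h y.
- by move=> y; apply: le_trans (f'g t y).
- exact: bbs_integrable.
- by move=> h y _ _; rewrite partial1of2E derive_val.
Qed.

End BoundedSupport.

(** * The submean inequality for smooth functions *)

Section SubmeanLap.
Variables (R : realType) (d : nat).
Local Notation V := 'rV[R]_d.
Local Notation lam := (@leb R d).
Implicit Types (f g v : V -> R) (O : set V).

(* A continuous approximation of the indicator of [0, c], and half of its
   primitive vanishing at infinity. *)
Definition ramp (c e s : R) : R := (Num.max (c + e - s) 0 - Num.max (c - s) 0) / e.
Definition ramp_primitive (c e s : R) : R := (possq (c + e - s) - possq (c - s)) / (4 * e).

Lemma is_derive_ramp_primitive (c e s : R) : e != 0 ->
  is_derive s 1 (ramp_primitive c e) (- (ramp c e s / 2)).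
Proof.
move=> e0.
have dB (b : R) : is_derive s 1 (fun t : R => possq (b - t)) (- (2 * Num.max (b - s) 0)).
  have d1 : is_derive s (1 : R) (fun t : R => b - t) (-1).
    have -> : (fun t : R => b - t) = cst b - id by [].
    by apply: is_derive_eq; rewrite sub0r.
  have := @is_derive1_comp _ (@possq R) (fun t => b - t) s _ _ (is_derive_possq (b - s)) d1.
  by rewrite mulrN1.
have d1 := dB (c + e); have d2 := dB c.
have -> : ramp_primitive c e =
  (4 * e)^-1 *: ((fun t : R => possq (c + e - t)) - (fun t : R => possq (c - t))).
  by apply/funext => t; rewrite /ramp_primitive mulrC.
by apply: is_derive_eq; rewrite /ramp /GRing.scale/=; field.
Qed.

Lemma ramp_itv c e s : 0 < e -> 0 <= ramp c e s <= 1.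
Proof.
move=> e0; rewrite /ramp ler_pdivrMr// mul1r; apply/andP; split.
  apply: divr_ge0; last exact: ltW.
  case: (ltrP (c + e - s) 0) => ?; case: (ltrP (c - s) 0) => ?; lra.
case: (ltrP (c + e - s) 0) => ?; case: (ltrP (c - s) 0) => ?; lra.
Qed.

Lemma ramp_eq1 c e s : 0 < e -> s <= c -> ramp c e s = 1.
Proof.
move=> e0 sc; rewrite /ramp !max_l; try lra.
by rewrite (_ : _ - _ = e) ?divff ?gt_eqF//; lra.
Qed.

Lemma ramp_eq0 c e s : 0 < e -> c + e <= s -> ramp c e s = 0.
Proof. by move=> e0 sc; rewrite /ramp !max_r; try lra. Qed.

Lemma ramp_primitive_ge0 c e s : 0 < e -> 0 <= ramp_primitive c e s.
Proof.
move=> e0; apply: divr_ge0; last by rewrite mulr_ge0// ltW.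
rewrite /possq.
case: (ltrP (c + e - s) 0) => ?; case: (ltrP (c - s) 0) => ?; nra.
Qed.

Lemma ramp_primitive_eq0 c e s : 0 < e -> c + e <= s -> ramp_primitive c e s = 0.
Proof. by move=> e0 sc; rewrite /ramp_primitive /possq !max_r ?subrr ?mul0r; try lra. Qed.

Lemma ramp_continuous c e : continuous (ramp c e).
Proof.
have cm b : continuous (fun s : R => Num.max (b - s) 0).
  move=> s; apply: (@continuous_max _ _ (fun s : R => b - s) (fun=> 0)).
    by apply: continuousB; [exact: cvg_cst|exact: cvg_id].
  exact: cvg_cst.
by move=> s; apply: cvgM; [apply: cvgB; exact: cm|exact: cvg_cst].
Qed.

Section Global.
Variables (v : V -> R) (x : V) (c e : R).
Hypotheses (sv : smooth 2 setT v) (bv : bdd 2 v) (e0 : 0 < e) (c0 : 0 <= c).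
Hypothesis lapv : forall y, N2 (y - x) <= c + e -> 0 <= lap v y.

Let rho (y : V) := ramp c e (N2 y).
Let Gam (y : V) := ramp_primitive c e (N2 y).

(** That is, [grad Gam (y) = - rho(y) y]: the factor 1/2 in [ramp_primitive] cancels the 2 of
    [grad N2 = 2 y]. The radial field [rho(y) y] that appears in [m'] is thus a gradient, which lets
    an integration by parts produce [lap v]. *)
Let dGam (y a : V) : is_derive y a Gam (\sum_i a 0 i * (- (y 0 i * rho y))).
Proof.
have e_neq0 : e != 0 by rewrite gt_eqF.
have dN : is_derive y a (@N2 R d) (dirgrad (fun i z => 2 * z 0 i) y a).
  have := smooth_derive a (@smooth_N2B R d 1 setT 0 openT) (I : setT y).
  rewrite (_ : dirgrad _ y a = dirgrad (fun i z => 2 * z 0 i) y a); last first.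
    by apply: eq_bigr => i _; rewrite partial_N2B mxE subr0.
  by rewrite (_ : (fun z : V => N2 (z - 0)) = @N2 R d)//; apply/funext => z; rewrite subr0.
have dG := is_derive_comp dN (is_derive_ramp_primitive c (N2 y) e_neq0).
apply: (is_derive_eq dG); rewrite /dirgrad mulr_sumr; apply: eq_bigr => i _.
by rewrite /rho; field.
Qed.

Let rho_itv y : 0 <= rho y <= 1.
Proof. exact: ramp_itv. Qed.

Let rho_measurable : measurable_fun [set: V] rho.
Proof.
apply: continuous_measurable_rV => y.
apply: (@continuous_comp _ _ _ (@N2 R d) (ramp c e)).
  apply: N2_continuous.
apply: ramp_continuous.
Qed.

Let rho_bbs : bbs rho.
Proof.
apply: (@bbs_supp _ _ _ (c + e)) => //.
- by exists 1 => y; have /andP[r0 r1] := rho_itv y; rewrite ger0_norm.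
- by move=> y /ltW; exact: ramp_eq0.
Qed.

Let Gam_continuous : continuous Gam.
Proof.
move=> y; apply: (@continuous_comp _ _ _ (@N2 R d) (ramp_primitive c e)).
  apply: N2_continuous.
apply: differentiable_continuous; apply/derivable1_diffP.
by have [] := is_derive_ramp_primitive c (N2 y) (lt0r_neq0 e0).
Qed.

Let Gam_bbs : bbs Gam.
Proof.
apply: (@bbs_supp _ _ _ (c + e)).
- exact: continuous_measurable_rV.
- have K0 : [set y : V | N2 (y - 0) <= c + e] !=set0.
    by exists 0; rewrite /= subr0 N20 addr_ge0// ltW.
  have [z _ zmax] := compact_EVT_max K0 (@compact_N2_le _ _ 0 (c + e))
    (continuous_subspaceT Gam_continuous).
  exists (Gam z) => y; rewrite ger0_norm; last exact: ramp_primitive_ge0.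
  have [yc|yc] := leP (N2 y) (c + e); first by apply: zmax; rewrite inE/= subr0.
  by rewrite /Gam ramp_primitive_eq0 ?ramp_primitive_ge0// ltW.
- by move=> y /ltW; exact: ramp_primitive_eq0.
Qed.

Let sub_measurable (f : V -> R) (t : R) : continuous f ->
  measurable_fun setT (fun y : V => f (t *: y + x)).
Proof.
move=> cf; apply: continuous_measurable_rV => y.
apply: (@continuous_comp _ _ _ (fun y : V => t *: y + x) f); last exact: cf.
apply: (@continuousD _ _ _ (fun y : V => t *: y) (fun=> x)).
  by apply: scaler_continuous.
by apply: cst_continuous.
Qed.

Let m (t : R) := \int[lam]_y (v (t *: y + x) * rho y).
Let m' (t : R) := \int[lam]_y (dirgrad (fun i => partial i v) (t *: y + x) y * rho y).

Let sv1 : smooth 1 setT v := smoothW sv.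
Let bv1 : bdd 1 v := bddW bv.

Let is_derive_m (t : R) : is_derive t 1 m (m' t).
Proof.
have [C C0 CP] := bdd_dirgrad bv1.
(* On the support of [rho] the sup norm of [y], the direction of derivation, is at most
   [c + e + 1]. *)
pose g y := C * (c + e + 1) * rho y.
apply: (@int_derive _ _ _ (fun t y => dirgrad (fun i => partial i v) (t *: y + x) y * rho y) g).
- move=> s; under eq_fun do rewrite mulrC.
  apply: bbsM => //; last by have [M MP] := bdd_bound bv; exists M => y.
  by apply: sub_measurable => y; exact: (smooth_continuous sv).
- exact: bbsZ.
- move=> s y; rewrite normrM /g; have /andP[r0 r1] := rho_itv y.
  have [yc|yc] := leP (N2 y) (c + e); last first.
    by rewrite /rho ramp_eq0 ?normr0 ?mulr0// ltW.
  rewrite (ger0_norm r0) ler_wpM2r// (le_trans (CP _ _))// ler_wpM2l//.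
  rewrite [leLHS]mx_normrE; apply/bigmax_leP => /=; split.
    by rewrite !addr_ge0// ltW.
  by case=> i j _ /=; rewrite (ord1 i); exact: norm_coord_N2.
- move=> s y; have dv := @is_derive_segment _ _ setT v x y s sv1 I.
  have -> : (fun s : R => v (s *: y + x) * rho y) =
    rho y *: (fun s : R => v (s *: y + x)) by apply/funext => z; rewrite mulrC.
  by apply: is_derive_eq; rewrite mulrC.
Qed.

Let m'E t : m' t = t * \int[lam]_y (lap v (t *: y + x) * Gam y).
Proof.
have bp i : exists M, forall y, `|partial i v y| <= M.
  by have [_ /(_ i)[]] := bv.
have bpp i : exists M, forall y, `|partial i (partial i v) y| <= M.
  by have [_ /(_ i)[_ /(_ i)[]]] := bv.
have cp i : continuous (partial i v).
  by move=> y; exact: (smooth_continuous (smooth_partial i sv)).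
have cpp i : continuous (partial i (partial i v)).
  by move=> y; exact: (smooth_continuous (smooth_partial i (smooth_partial i sv))).
pose A i (y : V) := Gam y * partial i (partial i v) (t *: y + x).
pose B i (y : V) := (y 0 i * rho y) * partial i v (t *: y + x).
have byr i : bbs (fun y : V => y 0 i * rho y).
  apply: (@bbs_supp _ _ _ (c + e)).
  - by apply: measurable_funM => //; exact: measurable_coord_rV.
  - exists (c + e + 1) => y; have /andP[r0 r1] := rho_itv y.
    have [yc|yc] := leP (N2 y) (c + e); last first.
      by rewrite /rho ramp_eq0 ?mulr0 ?normr0 ?addr_ge0// ltW.
    rewrite normrM -[leRHS]mulr1 ler_pM//; first exact: norm_coord_N2.
    by rewrite ger0_norm.
  - by move=> y /ltW cy; rewrite /rho ramp_eq0 ?mulr0.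
have bA i : bbs (A i).
  apply: bbsM => //; first exact: sub_measurable.
  by have [M MP] := bpp i; exists M => y.
have bB i : bbs (B i).
  apply: bbsM => //; first exact: sub_measurable.
  by have [M MP] := bp i; exists M => y.
(* The integrand is the [i]-th partial derivative of [Gam(y) (partial i v)(t y + x)], a product of
   bounded support. *)
have IBP i : \int[lam]_y (t * A i y + (-1) * B i y) = 0.
  apply: (@int_partial0 _ _ (fun y => Gam y * partial i v (t *: y + x)) _ i).
  - apply: bbsM => //; first exact: sub_measurable.
    by have [M MP] := bp i; exists M => y.
  - by apply: bbsD; apply: bbsZ.
  - move=> y.
    have d1 : is_derive y (delta_mx 0 i) Gam (- (y 0 i * rho y)).
      have := dGam y (delta_mx 0 i).
      by rewrite -[X in is_derive _ _ _ X]/(dirgrad (fun i y => - (y 0 i * rho y)) y _) dirgrad_delta.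
    have d2 : is_derive y (delta_mx 0 i) (fun y => partial i v (t *: y + x))
        (t * partial i (partial i v) (t *: y + x)).
      apply/is_derive_line.
      have := @is_derive_segment _ _ setT (partial i v) (t *: y + x) (t *: delta_mx 0 i) 0
        (smooth_partial i sv) I.
      rewrite scale0r add0r /dirgrad.
      rewrite (_ : \sum_j _ = t * partial i (partial i v) (t *: y + x)); last first.
        rewrite (bigD1 i)//= !mxE !eqxx mulr1 big1 ?addr0// => j ji.
        by rewrite !mxE eqxx (negPf ji) mulr0 mul0r.
      congr (is_derive _ _ _ _); apply/funext => s; congr (partial i v _).
      by rewrite scalerDr addrA !scalerA mulrC.
    apply: is_derive_eq; rewrite /A /B /GRing.scale/=; ring.
have AB i : \int[lam]_y B i y = t * \int[lam]_y A i y.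
  have := IBP i; rewrite intD ?intZ//; try exact: bbsZ.
  by move=> /eqP; rewrite mulN1r subr_eq0 => /eqP.
rewrite /m'.
transitivity (\int[lam]_y (\sum_i B i y)).
  apply: eq_Rintegral => y _; rewrite /dirgrad mulr_suml.
  by apply: eq_bigr => i _; rewrite /B; ring.
rewrite int_sum// (eq_bigr _ (fun i _ => AB i)) -mulr_sumr -int_sum//.
congr (_ * _); apply: eq_Rintegral => y _; rewrite /lap mulr_suml.
by apply: eq_bigr => i _; rewrite /A mulrC.
Qed.

(* [m t] is the mean of [v (x + t y)] against the radial weight; integrating by
   parts, [m' t = t * int lap v (x + t y) Gam y], so [m] increases on [0, 1]. *)
Lemma ramp_submean :
  v x * \int[lam]_y ramp c e (N2 y) <= \int[lam]_y (v (x + y) * ramp c e (N2 y)).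
Proof.
have m'0 t : 0 <= t <= 1 -> 0 <= m' t.
  move=> /andP[t0 t1]; rewrite m'E mulr_ge0//; apply: Rintegral_ge0 => y _.
  have [yc|yc] := leP (N2 y) (c + e); last first.
    by rewrite /Gam ramp_primitive_eq0 ?mulr0// ltW.
  rewrite mulr_ge0 ?ramp_primitive_ge0// lapv// addrK (le_trans _ yc)//.
  apply: ler_sum => i _; rewrite mxE exprMn ler_piMl ?sqr_ge0//.
  by rewrite expr_le1.
have cm : {within `[0, 1], continuous m}.
  apply: continuous_subspaceT => t; apply: differentiable_continuous.
  by apply/derivable1_diffP; have [] := is_derive_m t.
have [t t01] := MVT_segment ler01 (fun t _ => is_derive_m t) cm.
rewrite subr0 mulr1 => mE.
have : 0 <= m 1 - m 0 by rewrite mE m'0// -in_itv.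
rewrite subr_ge0 /m; under eq_Rintegral do rewrite scale0r add0r.
rewrite intZ//; under [in X in _ <= X -> _]eq_Rintegral do rewrite scale1r addrC.
exact.
Qed.

End Global.
End SubmeanLap.

(** * The submean inequality on balls, and the converse at a point *)

Section LocalSubmean.
Variables (R : realType) (d : nat).
Local Notation V := 'rV[R]_d.
Local Notation lam := (@leb R d).
Implicit Types (f g v : V -> R) (O : set V).

Definition vol c : R := fine (lam (@cball0 R d c)).

Lemma indic_in c (y : V) : N2 y <= c -> \1_(@cball0 R d c) y = 1 :> R.
Proof. by move=> yc; rewrite indicE mem_set. Qed.

Lemma indic_out c (y : V) : c < N2 y -> \1_(@cball0 R d c) y = 0 :> R.
Proof.
by move=> yc; rewrite indicE memNset// => yc'; move: yc; rewrite ltNge yc'.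
Qed.

Lemma bbs_indic c : bbs (fun y : V => \1_(@cball0 R d c) y : R).
Proof.
apply: (@bbs_supp _ _ _ c).
- exact: measurable_indic (measurable_cball0 c).
- by exists 1 => y; rewrite indicE; case: (_ \in _); rewrite ?normr0 ?normr1.
- exact: indic_out.
Qed.

Lemma int_indic c : \int[lam]_y (\1_(@cball0 R d c) y) = vol c.
Proof. by rewrite /Rintegral integral_indic ?setIT//; exact: measurable_cball0. Qed.

Lemma vol_gt0 c : 0 < c -> 0 < vol c.
Proof.
by move=> c0; rewrite fine_gt0// leb_cball0_gt0//; exact: leb_cball0_fin.
Qed.

Lemma continuous_bounded_N2 f (x : V) c : continuous f ->
  exists2 M, 0 <= M & forall y, N2 (y - x) <= c -> `|f y| <= M.
Proof.
move=> cf; pose K := [set y : V | N2 (y - x) <= c].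
have [K0|K0] := pselect (K !=set0); last first.
  by exists 0 => // y yc; exfalso; apply: K0; exists y.
have cK : {within K, continuous (fun y => `|f y|)}.
  apply: continuous_subspaceT => y; apply: continuous_comp; first exact: cf.
  exact: norm_continuous.
have [z _ zmax] := compact_EVT_max K0 (@compact_N2_le _ _ x c) cK.
by exists `|f z| => // y yc; apply: zmax; rewrite inE.
Qed.

Lemma bbs_continuous_indic f c : continuous f ->
  bbs (fun y => f y * \1_(@cball0 R d c) y).
Proof.
move=> cf; have [M M0 MP] := continuous_bounded_N2 0 c cf.
apply: (@bbs_supp _ _ _ c).
- apply: measurable_funM; first exact: continuous_measurable_rV.
  exact: measurable_indic (measurable_cball0 c).
- exists M => y; have [yc|yc] := leP (N2 y) c.
    by rewrite indic_in// mulr1 MP// subr0.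
  by rewrite indic_out// mulr0 normr0.
- by move=> y yc; rewrite indic_out ?mulr0.
Qed.

Lemma int_cball0 f c :
  \int[lam]_(y in @cball0 R d c) f y = \int[lam]_y (f y * \1_(@cball0 R d c) y).
Proof.
rewrite Rintegral_mkcond; apply: eq_Rintegral => y _.
by rewrite patchE indicE; case: ifP; rewrite ?mulr1 ?mulr0.
Qed.

(** [ramp_submean] wants a function smooth on the whole space and a continuous weight. The first is
    obtained by a cutoff beyond the ball, the indicator of the ball by letting the width of the ramp
    tend to 0 under dominated convergence. *)
Lemma lap_submean O v x c : open O -> smooth 2 O v ->
  (forall y, O y -> 0 <= lap v y) -> 0 <= c ->
  (forall y, N2 (y - x) <= c -> O y) ->
  v x * vol c <= \int[lam]_(y in @cball0 R d c) v (x + y).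
Proof.
move=> oO sv lapv c0 xO; have [e e0 eO] := ball_room oO xO.
(* [e] is the room [O] leaves around the ball. The function is unchanged up to squared radius [a]
   and zero from [b] on; [b < c + e] keeps the transition inside [O]. *)
pose a := c + e / 2; pose b := c + e * 3 / 4.
have ab : a < b by rewrite /a /b; lra.
pose w y := cutoff a b (N2 (y - x)) * v y.
have oN t : open [set y : V | t < N2 (y - x)].
  apply: (@open_comp _ _ _ [set s : R | t < s]); last exact: open_gt.
  by move=> z _; exact: N2B_continuous.
have oN' t : open [set y : V | N2 (y - x) < t].
  apply: (@open_comp _ _ _ [set s : R | s < t]); last exact: open_lt.
  by move=> z _; exact: N2B_continuous.
have w0 y : b <= N2 (y - x) -> w y = 0.
  by move=> by_; rewrite /w cutoff0 ?mul0r.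
have sw : smooth 2 setT w.
  move=> y _; have [yb|yb] := ltP b (N2 (y - x)).
    have : smooth 2 [set y : V | b < N2 (y - x)] w.
      apply: (@smooth_congr _ _ _ _ (fun=> 0)) => //; last exact: smooth_cst.
      by move=> z /= /ltW bz; rewrite w0.
    by move=> H; exact: (H y yb).
  have : smooth 2 O w.
    have s1 := @smooth_cutoff _ _ _ _ _ a b oO (smooth_N2B 2 x oO).
    exact: (smoothM oO s1 sv).
  by apply; apply: eO; rewrite (le_trans yb)// /b; lra.
have bw : bdd 2 w.
  by apply: (@supp_bdd _ _ _ _ x b) => // y /ltW; exact: w0.
have wv y : N2 (y - x) <= a -> w y = v y.
  by move=> ya; rewrite /w cutoff1// mul1r.
have lapw y : N2 (y - x) < a -> 0 <= lap w y.
  move=> ya; rewrite (@lap_near _ _ w v y); last first.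
    by apply: (near_open (oN' a)) ya => z /= /ltW; exact: wv.
  by apply/lapv/eO; rewrite (le_trans (ltW ya))// /a; lra.
have [M MP] := bdd_bound bw.
have mwx : measurable_fun setT (fun y => w (x + y)).
  under eq_fun do rewrite addrC.
  exact: measurable_comp_shift (smooth_measurable sw).
pose k := 2 / e.
(* The factor 1/4 keeps [c + eps n] below [a], in the region where [w] and [v] have the same
   Laplacian. *)
pose eps n : R := e / 4 * n.+1%:R^-1.
have eps0 n : 0 < eps n by rewrite mulr_gt0 ?invr_gt0// divr_gt0.
have epsle n : eps n <= e / 4.
  have i1 : n.+1%:R^-1 <= 1 :> R by rewrite invf_le1 ?ltr0n// ler1n.
  by apply: ler_piMr i1; apply: divr_ge0 => //; exact: ltW.
have H n : w x * \int[lam]_y ramp c (eps n) (N2 y) <=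
    \int[lam]_y (w (x + y) * ramp c (eps n) (N2 y)).
  apply: ramp_submean => // y yc; apply: lapw; rewrite (le_lt_trans yc)// /a.
  by have := epsle n; lra.
have rcv (y : V) : ramp c (eps n) (N2 y) @[n --> \oo] --> (\1_(@cball0 R d c) y : R).
  have [yc|yc] := leP (N2 y) c.
    rewrite indic_in// (_ : (fun _ => _) = cst 1); first exact: cvg_cst.
    by apply/funext => n; exact: ramp_eq1.
  rewrite indic_out//.
  have yce : 0 < (N2 y - c) / (e / 4) by apply: divr_gt0; rewrite ?subr_gt0// divr_gt0.
  apply/cvgrPdist_lt => t t0; near=> n.
  rewrite ramp_eq0 ?subrr ?normr0// -lerBrDl /eps mulrC -ler_pdivlMr ?divr_gt0//.
  by near: n; apply: filterS (near_infty_natSinv_lt (PosNum yce)) => n /ltW.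
have mramp n : measurable_fun setT (fun y : V => ramp c (eps n) (N2 y)).
  apply: continuous_measurable_rV => y.
  apply: (@continuous_comp _ _ _ (@N2 R d) (ramp c (eps n))).
    by apply: N2_continuous.
  by apply: ramp_continuous.
have rle n y : `|ramp c (eps n) (N2 y)| <= \1_(@cball0 R d (c + e)) y.
  have /andP[r0 r1] := ramp_itv c (N2 y) (eps0 n).
  rewrite ger0_norm//; have [yc|yc] := leP (N2 y) (c + e).
    by rewrite indic_in.
  by rewrite indic_out// ramp_eq0// (le_trans _ (ltW yc))// lerD2l (le_trans (epsle n))//; lra.
have L1 : \int[lam]_y ramp c (eps n) (N2 y) @[n --> \oo] --> vol c.
  by rewrite -int_indic; apply: int_dct rcv => //; exact: bbs_indic.
have L2 : \int[lam]_y (w (x + y) * ramp c (eps n) (N2 y)) @[n --> \oo] -->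
    \int[lam]_y (w (x + y) * \1_(@cball0 R d c) y).
  apply: (@int_dct _ _ _ _ (fun y => M * \1_(@cball0 R d (c + e)) y)).
  - exact/bbsZ/bbs_indic.
  - by move=> n; exact: measurable_funM.
  - by move=> n y; rewrite normrM ler_pM.
  - by move=> y; apply: cvgM; [exact: cvg_cst|exact: rcv].
rewrite int_cball0.
rewrite (@eq_Rintegral _ _ _ lam setT (fun y => w (x + y) * \1_(@cball0 R d c) y)); last first.
  move=> y _; have [yc|yc] := leP (N2 y) c; last by rewrite indic_out// !mulr0.
  rewrite wv// [x + y]addrC addrK (le_trans yc)// /a; lra.
have <- : w x = v x by rewrite wv// subrr N20 /a; lra.
apply: (ler_cvg_to (cvgM (cvg_cst (w x)) L1) L2).
by apply: nearW => n; exact: H.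
Unshelve. all: by end_near. Qed.

(** A small ball of squared radius [a^2] carries at most half of the volume, and off it [N2] is at
    least [a^2]. *)
Lemma int_N2_gt0 c : (0 < d)%N -> 0 < c -> 0 < \int[lam]_(y in @cball0 R d c) N2 y.
Proof.
move=> d0 c0; have L0 := vol_gt0 c0.
(* The small ball lies in the box of half-side [a], of volume [(2 a)^d]. As [2 a <= 1] and [d > 0],
   this is at most [2 a], hence at most [vol c / 2]. *)
pose a := Num.min (2^-1) (vol c / 4).
have a0 : 0 < a by rewrite lt_min invr_gt0 ltr0n/= divr_gt0.
have va : vol (a ^+ 2) <= vol c / 2.
  have -> : (vol (a ^+ 2) <= vol c / 2) = (lam (@cball0 R d (a ^+ 2)) <= (vol c / 2)%:E)%E.
    by rewrite -lee_fin {1}/vol fineK// ge0_fin_numE// leb_cball0_fin.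
  apply: (@le_trans _ _ (lam (@box R d a))).
    apply: le_measure; rewrite ?inE; [exact: measurable_cball0|exact: measurable_box|].
    move=> y ya i; have h : (y 0 i) ^+ 2 <= a ^+ 2 := le_trans (coord_le_N2 y i) ya.
    have a0' := ltW a0; move: h; rewrite -(real_normK (num_real (y 0 i))).
    by rewrite ler_pXn2r ?nnegrE.
  rewrite /leb/= lebesgue_rV_box; last exact: ltW.
  rewrite lee_fin; have a2 : 0 <= 2 * a <= 1.
    have h : a <= 2^-1 by rewrite ge_min lexx.
    by apply/andP; split; lra.
  case/andP: a2 => a2 a21; apply: (le_trans (ler_iXnr d0 a2 a21)).
  have : a <= vol c / 4 by rewrite ge_min lexx orbT.
  by move=> h; lra.
rewrite int_cball0.
apply: (@lt_le_trans _ _ (a ^+ 2 * (vol c - vol (a ^+ 2)))).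
  rewrite mulr_gt0 ?exprn_gt0// subr_gt0 (le_lt_trans va)//; lra.
have -> : a ^+ 2 * (vol c - vol (a ^+ 2)) =
  \int[lam]_y (a ^+ 2 * \1_(@cball0 R d c) y + (- a ^+ 2) * \1_(@cball0 R d (a ^+ 2)) y).
  rewrite intD ?intZ ?int_indic; try exact/bbsZ/bbs_indic; try exact: bbs_indic.
  ring.
apply: int_le.
- by apply: bbsD; exact/bbsZ/bbs_indic.
- exact/bbs_continuous_indic/N2_continuous.
- move=> y; have a2 : 0 <= a ^+ 2 by rewrite exprn_ge0// ltW.
  have [ya|ya] := leP (N2 y) (a ^+ 2); last first.
    rewrite (indic_out ya) mulr0 addr0; have [yc|yc] := leP (N2 y) c.
      by rewrite indic_in// !mulr1 ltW.
    by rewrite indic_out// !mulr0.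
  rewrite (indic_in ya) mulr1; have [yc|yc] := leP (N2 y) c.
    by rewrite indic_in// !mulr1 subrr N2_ge0.
  by rewrite indic_out// !mulr0 add0r oppr_le0.
Qed.

(* If [lap w x < 0], the submean inequality for [- w - k |y - x|^2] on a small ball
   contradicts the one for [w], since [int |y|^2 > 0]. *)
Lemma lap_ge0_submean w x c0 : (0 < d)%N -> smooth 2 setT w -> 0 < c0 ->
  (forall c, 0 < c -> c <= c0 ->
     w x * vol c <= \int[lam]_(y in @cball0 R d c) w (x + y)) ->
  0 <= lap w x.
Proof.
move=> d0 sw c00 wx; rewrite leNgt; apply/negP => lw.
(* Since [lap N2 = 2 d], this [k] makes the Laplacian of [- w - k N2 (y - x)] at [x] equal to
   [- lap w x / 2], still positive, with [k > 0]. *)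
pose k := - lap w x / (4 * d%:R).
have dR : (0 : R) < d%:R by rewrite ltr0n.
have k0 : 0 < k by rewrite /k divr_gt0 ?oppr_gt0// mulr_gt0.
pose f y := (-1) * w y + (- k) * N2 (y - x).
have sN : smooth 2 setT (fun y : V => N2 (y - x)) := smooth_N2B 2 x openT.
have s1 := @smoothZ _ _ 2 setT (-1) w openT sw.
have s2 := @smoothZ _ _ 2 setT (- k) (fun y : V => N2 (y - x)) openT sN.
have sf : smooth 2 setT f := smoothD openT s1 s2.
have lf y : lap f y = - lap w y - k * (2 * d%:R).
  rewrite (lapD openT s1 s2 I) (lapZ _ openT sw I) (lapZ _ openT sN I).
  by rewrite lap_N2B mulN1r mulNr.
pose U := [set y | 0 < lap f y].
have oU : open U.
  apply: (@open_comp _ _ _ [set t : R | 0 < t]); last exact: open_gt.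
  by move=> z _; exact: (smooth_continuous (smooth_lap openT sf)).
have Ux y : N2 (y - x) <= 0 -> U y.
  move=> yx; have /eqP : y - x = 0.
    by apply: N2_eq0; apply/eqP; rewrite eq_le yx N2_ge0.
  rewrite subr_eq0 => /eqP ->; rewrite /U/= lf /k.
  rewrite (_ : _ - _ = - lap w x / 2); first by rewrite divr_gt0// oppr_gt0.
  by field; rewrite gt_eqF.
have [e e0 eU] := ball_room oU Ux.
pose c := Num.min c0 e.
have cp : 0 < c by rewrite lt_min c00.
have H1 : f x * vol c <= \int[lam]_(y in @cball0 R d c) f (x + y).
  apply: (@lap_submean U) => //.
  - by move=> y _; exact: sf.
  - by move=> y /ltW.
  - exact: ltW.
  - move=> y yc; apply: eU; rewrite add0r (le_trans yc)// ge_min lexx orbT//.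
have H2 := wx c cp; rewrite ge_min lexx in H2; have {}H2 := H2 isT.
have cw : continuous (fun y => w (x + y)).
  move=> y; apply: (@continuous_comp _ _ _ (fun y : V => x + y) w).
    by apply: (@continuousD _ _ _ (fun=> x) id); [apply: cst_continuous|apply: cvg_id].
  exact: (smooth_continuous sw).
move: H1; rewrite !int_cball0 in H2 *.
rewrite (@eq_Rintegral _ _ _ lam setT (fun y => (-1) * (w (x + y) * \1_(@cball0 R d c) y) +
    (- k) * (N2 y * \1_(@cball0 R d c) y))); last first.
  by move=> y _; rewrite /f [x + y]addrC addrK; ring.
have bN := bbs_continuous_indic c (@N2_continuous R d).
have bW := bbs_continuous_indic c cw.
rewrite intD ?intZ; try exact: bbsZ; try by [].
rewrite {1}/f subrr N20 mulr0 addr0.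
have := int_N2_gt0 d0 cp; rewrite int_cball0.
set I1 := \int[_]_ _ _; set I2 := \int[_]_ _ _ in H2 *.
nra.
Qed.

End LocalSubmean.

(** * From squared radii back to [closed_eball] and [ball_mean] *)

Section Eball.
Variables (R : realType) (d : nat).
Local Notation V := 'rV[R]_d.
Local Notation lam := (@leb R d).
Implicit Types (f g v : V -> R) (O : set V).

Lemma closed_eballE (x : V) r : 0 <= r ->
  closed_eball x r = [set y | N2 (y - x) <= r ^+ 2].
Proof.
move=> r0; have rE : Num.sqrt (r ^+ 2) = r by rewrite sqrtr_sqr ger0_norm.
have E y : (enorm (y - x) <= r) = (N2 (y - x) <= r ^+ 2).
  by rewrite /enorm -[in LHS]rE ler_sqrt ?sqr_ge0.
by apply/seteqP; split=> y; rewrite /closed_eball/= E.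
Qed.

Lemma int_eball f (x : V) c : bbs (f \_ [set y | N2 (y - x) <= c]) ->
  \int[lam]_(y in [set y | N2 (y - x) <= c]) f y =
  \int[lam]_(y in @cball0 R d c) f (x + y).
Proof.
move=> bf; rewrite Rintegral_mkcond [RHS]Rintegral_mkcond -(int_shift x bf).
apply: eq_Rintegral => y _; rewrite !patchE [y + x]addrC.
rewrite (_ : (x + y \in [set y | N2 (y - x) <= c]) = (y \in @cball0 R d c))//.
by apply/idP/idP; rewrite !inE/cball0/= addrC addrA addNr add0r.
Qed.

Lemma leb_eball (x : V) c :
  lam [set y : V | (N2 (y - x) <= c)%R] = lam (@cball0 R d c).
Proof.
have [_ SE] := lebesgue_rV_shift x.
rewrite -(SE [set y : V | (N2 (y - x) <= c)%R]).
  by congr (lam _); apply/seteqP; split=> y; rewrite /cball0/= addrK.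
apply: measurable_closed; apply: compact_closed; first exact: norm_hausdorff.
exact: compact_N2_le.
Qed.

Lemma vol_eball (x : V) c : fine (lam [set y : V | (N2 (y - x) <= c)%R]) = vol d c.
Proof. by rewrite leb_eball. Qed.

End Eball.

Section SmoothSubharmonic.
Variables (R : realType) (d : nat).
Local Notation V := 'rV[R]_d.
Local Notation lam := (@leb R d).
Implicit Types (f g v : V -> R) (O : set V) (u : V -> \bar R).

Lemma measurable_N2B (x : V) c : measurable [set y : V | N2 (y - x) <= c].
Proof.
apply: measurable_closed; apply: compact_closed; first exact: norm_hausdorff.
exact: compact_N2_le.
Qed.

Lemma bbs_restrict f (x : V) c M :
  measurable_fun [set y : V | N2 (y - x) <= c] f ->
  (forall y, N2 (y - x) <= c -> `|f y| <= M) -> bbs (f \_ [set y : V | N2 (y - x) <= c]).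
Proof.
move=> mf fM; apply: (@bbs_supp _ _ _ (2 * c + 2 * N2 x)).
- by apply/(measurable_restrictT _ (measurable_N2B x c)).
- exists `|M| => y; rewrite patchE; case: ifPn => [|_]; last by rewrite normr0.
  by rewrite inE/= => /fM /le_trans; apply; rewrite ler_norm.
- move=> y cy; rewrite patchE memNset//= => yc.
  have := N2D_le (y - x) x; rewrite subrK; lra.
Qed.

Lemma ball_meanE u f (x : V) r : 0 < r ->
  (forall y, N2 (y - x) <= r ^+ 2 -> u y = (f y)%:E) ->
  bbs (f \_ [set y | N2 (y - x) <= r ^+ 2]) ->
  ball_mean u x r =
    ((vol d (r ^+ 2))^-1 * \int[lam]_(y in @cball0 R d (r ^+ 2)) f (x + y))%:E.
Proof.
move=> r0 uf bf; rewrite /ball_mean closed_eballE; last exact: ltW.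
rewrite EFinM -(vol_eball x) -int_eball//; congr (_ * _)%E.
rewrite /Rintegral fineK; last first.
  apply: integrable_fin_num; first exact: measurable_N2B.
  apply/(integrable_mkcond _ (measurable_N2B x _)); rewrite restrict_EFin.
  exact: bbs_integrable.
by apply: eq_integral => y; rewrite inE => /uf.
Qed.

Lemma measurable_continuous_on O f : open O ->
  (forall x, O x -> {for x, continuous f}) -> measurable_fun O f.
Proof.
move=> oO cf.
apply: (measurability _ (RGenOpens.measurableE R)) => // _ [_ [a [b ->]] <-].
suff oOf : open (O `&` f @^-1` `]a, b[%classic) by exact: measurable_open.
rewrite openE => x [Ox fx].
have : nbhs x (f @^-1` `]a, b[%classic).
  by apply: (cf x Ox); apply: open_nbhs_nbhs; split => //; exact: interval_open.
have : nbhs x O by apply: open_nbhs_nbhs.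
by apply: filterS2 => y Oy fy; split.
Qed.

Lemma bbs_continuous_on O f (x : V) c : open O ->
  (forall y, O y -> {for y, continuous f}) ->
  (forall y, N2 (y - x) <= c -> O y) ->
  bbs (f \_ [set y : V | N2 (y - x) <= c]).
Proof.
move=> oO cf xO; pose K := [set y : V | N2 (y - x) <= c].
have mf : measurable_fun K f.
  apply: (@measurable_funS _ _ _ _ O); [exact: measurable_open|by move=> y /xO|].
  exact: measurable_continuous_on.
have [K0|K0] := pselect (K !=set0); last first.
  by apply: (@bbs_restrict _ _ _ 0) => // y yc; exfalso; apply: K0; exists y.
have cK : {within K, continuous (fun y => `|f y|)}.
  apply: continuous_in_subspaceT => y; rewrite inE => Ky.
  by apply: continuous_comp; [apply: cf; exact: xO|apply: norm_continuous].
have [z _ zmax] := compact_EVT_max K0 (@compact_N2_le _ _ x c) cK.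
by apply: (@bbs_restrict _ _ _ `|f z|) => // y yc; apply: zmax; rewrite inE.
Qed.

Lemma lap_ge0_ball_mean O v u (x : V) r : open O -> smooth 2 O v ->
  (forall y, O y -> 0 <= lap v y) -> (forall y, O y -> u y = (v y)%:E) ->
  0 < r -> closed_eball x r `<=` O -> (u x <= ball_mean u x r)%E.
Proof.
move=> oO sv lapv uv r0; rewrite closed_eballE; last exact: ltW.
move=> xO; have Ox : O x by apply: xO; rewrite /= subrr N20 sqr_ge0.
rewrite (@ball_meanE _ v)//; last 2 first.
- by move=> y /xO/uv.
- by apply: (bbs_continuous_on oO _ xO) => y Oy; exact: (smooth_continuous sv).
rewrite uv// lee_fin ler_pdivlMl ?vol_gt0 ?exprn_gt0// mulrC.
by apply: (lap_submean oO sv lapv _ xO); rewrite sqr_ge0.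
Qed.

Lemma continuous_usc O v u : open O -> (forall y, O y -> {for y, continuous v}) ->
  (forall y, O y -> u y = (v y)%:E) -> upper_semicontinuous_on O u.
Proof.
move=> oO cv uv x a Ox; rewrite uv// lte_fin => xa.
have : \forall y \near x, v y < a by exact: cvgr_lt (cv x Ox) _ xa.
by apply: filterS => y ya Oy; rewrite uv// lte_fin.
Qed.

Lemma N2_conv (a b : V) t : 0 <= t <= 1 ->
  N2 (t *: a + (1 - t) *: b) <= t * N2 a + (1 - t) * N2 b.
Proof.
move=> /andP[t0 t1]; rewrite !mulr_sumr -big_split/=; apply: ler_sum => i _.
rewrite !mxE; set p := a 0 i; set q := b 0 i; rewrite -subr_ge0.
rewrite (_ : _ - _ = t * (1 - t) * (p - q) ^+ 2); last by ring.
by rewrite mulr_ge0 ?sqr_ge0// mulr_ge0// subr_ge0.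
Qed.

End SmoothSubharmonic.

(** * Dimension one: from the second derivative to local convexity *)

Section OneDim.
Variable R : realType.
Local Notation V := 'rV[R]_1.
Implicit Types (f g v : V -> R) (O : set V) (u : V -> \bar R).

(** Three mean value theorems for [h(s) = v(z + s (y - z))]: its slopes over [[0, t]] and [[t, 1]]
    are [h'(c1)] and [h'(c2)] with [c1 < c2], and the third compares these, as [h''] is [lap v]
    times the square of the only coordinate of [y - z]. *)
Lemma segment_second_derivative O v (y z : V) t : open O ->
  smooth 2 O v -> (forall x, O x -> 0 <= lap v x) ->
  (forall s, 0 <= s <= 1 -> O (s *: y + (1 - s) *: z)) -> 0 <= t <= 1 ->
  v (t *: y + (1 - t) *: z) <= t * v y + (1 - t) * v z.
Proof.
move=> oO sv lapv yzO /andP[t0' t1'].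
have [->|tn0] := eqVneq t 0.
  by rewrite scale0r mul0r !add0r subr0 scale1r mul1r.
have [->|tn1] := eqVneq t 1.
  by rewrite subrr scale0r mul0r !addr0 scale1r mul1r.
have t0 : 0 < t by rewrite lt_neqAle eq_sym tn0.
have t1 : t < 1 by rewrite lt_neqAle tn1.
have pE s : s *: y + (1 - s) *: z = s *: (y - z) + z.
  by rewrite scalerBl scale1r scalerBr addrA addrAC.
pose a := y - z; pose h s := v (s *: a + z).
pose h1 s := dirgrad (fun i => partial i v) (s *: a + z) a.
have Os s : 0 <= s <= 1 -> O (s *: a + z) by move=> /yzO; rewrite pE.
have sv1 := smoothW sv.
have dh (s : R) : 0 <= s <= 1 -> is_derive s 1 h (h1 s).
  by move=> /Os; exact: (is_derive_segment sv1).
have dh1 (s : R) : 0 <= s <= 1 ->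
    is_derive s 1 h1 (\sum_i a 0 i * dirgrad (fun j => partial j (partial i v)) (s *: a + z) a).
  move=> /Os Oss.
  have di i := is_derive_segment (smooth_partial i sv) Oss.
  have -> : h1 = \sum_i a 0 i *: (fun s : R => partial i v (s *: a + z)).
    by apply/funext => r; rewrite fct_sumE.
  by apply: is_derive_sum => i; apply: is_deriveZ.
have h2_ge0 s : 0 <= s <= 1 ->
    0 <= \sum_i a 0 i * dirgrad (fun j => partial j (partial i v)) (s *: a + z) a.
  move=> /Os/lapv; rewrite /lap /dirgrad !big_ord1 => l0.
  by rewrite mulrA mulr_ge0// -expr2 sqr_ge0.
have cont (g g' : R -> R) : (forall s : R, 0 <= s <= 1 -> is_derive s 1 g (g' s)) ->
    forall p q, 0 <= p -> q <= 1 -> {within `[p, q], continuous g}.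
  move=> dg p q p0 q1; apply: continuous_in_subspaceT => s; rewrite inE/= in_itv/=.
  move=> /andP[ps sq]; apply: differentiable_continuous; apply/derivable1_diffP.
  have s01 : 0 <= s <= 1 by rewrite (le_trans p0 ps) (le_trans sq q1).
  by have [] := dg s s01.
have mvt (g g' : R -> R) : (forall s : R, 0 <= s <= 1 -> is_derive s 1 g (g' s)) ->
    forall p q, 0 <= p -> p < q -> q <= 1 ->
    exists2 c, p < c < q & g q - g p = g' c * (q - p).
  move=> dg p q p0 pq q1.
  have dpq (s : R) : s \in `]p, q[ -> is_derive s 1 g (g' s).
    rewrite in_itv/= => /andP[ps sq]; apply: dg.
    by rewrite (le_trans p0 (ltW ps)) (le_trans (ltW sq) q1).
  have [c cpq E] := MVT pq dpq (cont _ _ dg p q p0 q1).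
  by exists c => //; move: cpq; rewrite in_itv.
have [c1 /andP[c10 c1t] E1] := mvt _ _ dh 0 t (lexx _) t0 (ltW t1).
have [c2 /andP[tc2 c21] E2] := mvt _ _ dh t 1 (ltW t0) t1 (lexx _).
have [c /andP[c1c cc2] E3] := mvt _ _ dh1 c1 c2 (ltW c10) (lt_trans c1t tc2) (ltW c21).
have c01 : 0 <= c <= 1.
  by rewrite (ltW (lt_trans c10 c1c)) (ltW (lt_trans cc2 c21)).
have h12 : h1 c1 <= h1 c2.
  by rewrite -subr_ge0 E3 mulr_ge0 ?h2_ge0// subr_ge0 (ltW (lt_trans c1t tc2)).
have h0E : h 0 = v z by rewrite /h scale0r add0r.
have hE1 : h 1 = v y by rewrite /h scale1r subrK.
rewrite pE -/a -/(h t) -h0E -hE1; rewrite subr0 in E1.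
have : 0 <= t * (1 - t) * (h1 c2 - h1 c1).
  by rewrite mulr_ge0 ?subr_ge0// mulr_ge0 ?subr_ge0 ?ltW.
have -> : h 0 = h t - h1 c1 * t by rewrite -E1; ring.
have -> : h 1 = h t + h1 c2 * (1 - t) by rewrite -E2; ring.
rewrite -subr_ge0 => H; rewrite -subr_ge0; apply: le_trans H _.
by rewrite le_eqVlt; apply/orP; left; apply/eqP; ring.
Qed.

Lemma lap_ge0_locally_convex O v u : open O -> smooth 2 O v ->
  (forall x, O x -> 0 <= lap v x) -> (forall y, O y -> u y = (v y)%:E) ->
  Defs.locally_convex O u.
Proof.
move=> oO sv lapv uv x Ox.
have Ox0 y : N2 (y - x) <= 0 -> O y.
  move=> yx; have /eqP : y - x = 0 by apply: N2_eq0; apply/eqP; rewrite eq_le yx N2_ge0.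
  by rewrite subr_eq0 => /eqP ->.
have [e e0 eO] := ball_room oO Ox0.
have r0 : 0 < Num.sqrt e by rewrite sqrtr_gt0.
have bE : closed_eball x (Num.sqrt e) = [set y | N2 (y - x) <= e].
  by rewrite closed_eballE ?sqrtr_ge0// sqr_sqrtr// ltW.
have bO : closed_eball x (Num.sqrt e) `<=` O.
  by rewrite bE => y /= ye; apply: eO; rewrite add0r.
exists (Num.sqrt e); split => // y z t By Bz t01.
have segO s : 0 <= s <= 1 -> O (s *: y + (1 - s) *: z).
  move=> s01; apply: eO; rewrite add0r.
  rewrite (_ : _ - x = s *: (y - x) + (1 - s) *: (z - x)); last first.
    by apply/rowP => i; rewrite !mxE; ring.
  apply: le_trans (N2_conv _ _ s01) _.
  move: By Bz; rewrite bE/= => ye ze; case/andP: s01 => s0 s1.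
  have s1' : 0 <= 1 - s by rewrite subr_ge0.
  have := ler_wpM2l s0 ye; have := ler_wpM2l s1' ze; lra.
rewrite !uv; [|exact: bO|exact: bO|exact: segO].
rewrite -!EFinM -EFinD lee_fin.
exact: (segment_second_derivative oO sv lapv segO t01).
Qed.

End OneDim.

(** * Subharmonic functions *)

Section Semicontinuity.
Variables (R : realType) (d : nat).
Local Notation V := 'rV[R]_d.
Local Notation lam := (@leb R d).
Implicit Types (f g v : V -> R) (O L : set V) (u : V -> \bar R).

Lemma open_N2_lt (x : V) c : open [set y | N2 (y - x) < c].
Proof.
apply: (@open_comp _ _ _ [set s : R | s < c]); last exact: open_lt.
by move=> z _; exact: N2B_continuous.
Qed.

Lemma open_N2_ball O (x : V) : open O -> O x ->
  exists2 e, 0 < e & forall y, N2 (y - x) <= e -> O y.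
Proof.
move=> oO Ox.
have Ox0 y : N2 (y - x) <= 0 -> O y.
  move=> yx; have /eqP : y - x = 0 by apply: N2_eq0; apply/eqP; rewrite eq_le yx N2_ge0.
  by rewrite subr_eq0 => /eqP ->.
have [e e0 eO] := ball_room oO Ox0.
by exists e => // y ye; apply: eO; rewrite add0r.
Qed.

Lemma nbhs_N2_lt (x : V) c : 0 < c -> nbhs x [set y | N2 (y - x) < c].
Proof.
move=> c0; apply: open_nbhs_nbhs; split; first exact: open_N2_lt.
by rewrite /= subrr N20.
Qed.

Lemma seq_pos_min (I : eqType) (s : seq I) (e : I -> R) :
  (forall i, i \in s -> 0 < e i) ->
  exists2 c, 0 < c & forall i, i \in s -> c <= e i.
Proof.
elim: s => [|i s IH] es; first by exists 1.
have [|c c0 cs] := IH; first by move=> j js; apply: es; rewrite inE js orbT.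
exists (Num.min c (e i)); first by rewrite lt_min c0 es// inE eqxx.
move=> j; rewrite inE => /orP[/eqP ->|/cs]; first by rewrite ge_min lexx orbT.
by move=> cj; rewrite ge_min cj.
Qed.

(* A Lebesgue number lemma. *)
Lemma uniform_ball L (Q : set V -> Prop) : compact L ->
  (forall A B, A `<=` B -> Q B -> Q A) ->
  (forall x, L x -> exists2 e, 0 < e & Q [set y | N2 (y - x) <= e]) ->
  exists2 c, 0 < c & forall x, L x -> Q [set y | N2 (y - x) <= c].
Proof.
move=> cL Qsub QL.
have /choice[e eP] : forall x, exists e, L x -> 0 < e /\ Q [set y | N2 (y - x) <= e].
  move=> x; have [Lx|Lx] := pselect (L x); last by exists 0.
  by have [e e0 Qe] := QL x Lx; exists e.
(* The quarter compensates the factor 2 in [N2D_le]: if both squared distances are at most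
   [e x / 4], their combination is at most [e x]. *)
move: cL; rewrite compact_cover => /(_ V L (fun x => [set y | N2 (y - x) < e x / 4])).
case.
- by move=> x _; exact: open_N2_lt.
- by move=> x Lx; exists x => //=; rewrite subrr N20 divr_gt0//; have [] := eP x Lx.
move=> D DL LD.
have [i iD|c c0 cP] := @seq_pos_min V (finmap.enum_fset D) (fun x => e x / 4).
  have /DL := iD; rewrite inE => Li; rewrite divr_gt0//; have [] := eP i Li => //.
exists c => // x Lx; have [i /= iD xi] := LD x Lx.
have /DL := iD; rewrite inE => Li; have [_ Qi] := eP i Li.
apply: Qsub Qi => y /= yx.
have := N2D_le (y - x) (x - i); rewrite addrA subrK; have := cP i iD; lra.
Qed.

Lemma usc_bounded O L u : open O -> upper_semicontinuous_on O u ->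
  (forall x, O x -> (u x < +oo)%E) -> compact L -> L `<=` O ->
  exists M : R, forall x, L x -> (u x <= M%:E)%E.
Proof.
move=> oO usc uoo; rewrite compact_cover => cL LO.
have [] := cL nat setT (fun n => interior [set y | O y -> (u y < n%:R%:E)%E]).
- by move=> n _; exact: open_interior.
- move=> x /LO Ox; have ux := uoo x Ox.
  have [n un] : exists n : nat, (u x < n%:R%:E)%E.
    move: ux; case: (u x) => [r _| //|_]; last by exists 0%N; rewrite ltNyr.
    exists (Num.truncn `|r|).+1; rewrite lte_fin.
    by apply: le_lt_trans (ler_norm r) _; exact: truncnS_gt.
  by exists n => //; exact: usc.
move=> D _ LD; exists (\max_(n <- finmap.enum_fset D) n)%N%:R => x Lx.
have [n /= nD /interior_subset/(_ (LO _ Lx)) /ltW un] := LD x Lx.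
by apply: le_trans un _; rewrite lee_fin ler_nat; exact: (@leq_bigmax_seq _ _ xpredT id).
Qed.

Lemma usc_measurable O u : open O -> upper_semicontinuous_on O u ->
  measurable_fun O u.
Proof.
move=> oO usc.
apply: (measurability _ (ErealGenInftyO.measurableE R)) => // _ [_ [a ->] <-].
suff oOf : open (O `&` u @^-1` `]-oo, a%:E[%classic) by exact: measurable_open.
rewrite openE => x [Ox ux].
have : nbhs x O by apply: open_nbhs_nbhs.
have ux' : (u x < a%:E)%E by move: ux; rewrite /= in_itv.
have := usc x a Ox ux'.
by apply: filterS2 => y uy Oy; split => //=; rewrite in_itv/=; exact: uy.
Qed.

(* Junk value [0] where [u x = +oo]. *)
Definition trunc_below u (n : nat) (x : V) : R := fine (maxe (u x) (- n%:R)%:E).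

Lemma trunc_belowE u n x : (u x < +oo)%E ->
  (trunc_below u n x)%:E = maxe (u x) (- n%:R)%:E.
Proof.
move=> ux; rewrite /trunc_below fineK//; move: ux.
case: (u x) => [r| |] // _; last by rewrite maxNye.
by rewrite -EFin_max.
Qed.

Lemma trunc_below_ge u n x : (u x < +oo)%E -> - n%:R <= trunc_below u n x.
Proof. by move=> ux; rewrite -lee_fin trunc_belowE// le_max lexx orbT. Qed.

Lemma trunc_below_le u n x (M : R) : (u x <= M%:E)%E -> 0 <= M ->
  trunc_below u n x <= M.
Proof.
move=> ux M0; rewrite -lee_fin trunc_belowE; last exact: le_lt_trans ux (ltry _).
by rewrite ge_max ux lee_fin (le_trans _ M0)// oppr_le0.
Qed.

Lemma trunc_below_bounded O L u n : open O -> upper_semicontinuous_on O u ->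
  (forall x, O x -> (u x < +oo)%E) -> compact L -> L `<=` O ->
  exists M : R, forall x, L x -> `|trunc_below u n x| <= M.
Proof.
move=> oO usc uoo cL LO; have [M MP] := usc_bounded oO usc uoo cL LO.
exists (Num.max `|M| n%:R) => x Lx; rewrite ler_norml; apply/andP; split.
  apply: le_trans (trunc_below_ge n (uoo _ (LO _ Lx))).
  by rewrite lerN2 le_max lexx orbT.
rewrite le_max; apply/orP; left; apply: trunc_below_le => //.
by apply: le_trans (MP _ Lx) _; rewrite lee_fin ler_norm.
Qed.

Lemma trunc_below_measurable O u n : open O -> upper_semicontinuous_on O u ->
  measurable_fun O (trunc_below u n).
Proof.
move=> oO usc; rewrite /trunc_below.
apply: (measurableT_comp (fine_measurable measurableT)); apply: measurable_maxe => //.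
exact: usc_measurable.
Qed.

Lemma trunc_below_bbs O u n (x : V) c : open O -> upper_semicontinuous_on O u ->
  (forall y, O y -> (u y < +oo)%E) -> (forall y, N2 (y - x) <= c -> O y) ->
  bbs (trunc_below u n \_ [set y : V | N2 (y - x) <= c]).
Proof.
move=> oO usc uoo xO.
have [M MP] := trunc_below_bounded n oO usc uoo (@compact_N2_le _ _ x c) xO.
apply: (@bbs_restrict _ _ _ _ _ M) => //.
apply: (@measurable_funS _ _ _ _ O); [exact: measurable_open|by move=> y /xO|].
exact: trunc_below_measurable.
Qed.

(** Only the upper function is integrable: [u] may take the value [-oo] and have integral [-oo].
    Positive and negative parts are therefore compared separately. *)
Lemma integral_le_real (mu : {measure set V -> \bar R}) (D : set V) u f :
  measurable D -> measurable_fun D u -> mu.-integrable D (EFin \o f) ->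
  (forall x, D x -> (u x <= (f x)%:E)%E) ->
  (\int[mu]_(x in D) u x <= \int[mu]_(x in D) (f x)%:E)%E.
Proof.
move=> mD mu_ fi uf; have mf := measurable_int _ fi.
rewrite integralE [leRHS]integralE; apply: leeB.
- apply: ge0_le_integral => //; [exact: measurable_funepos|exact: measurable_funepos|].
  by move=> x Dx; rewrite !funeposE ge_max !le_max uf// lexx orbT.
- apply: ge0_le_integral => //; [exact: measurable_funeneg|exact: measurable_funeneg|].
  by move=> x Dx; rewrite !funenegE ge_max !le_max leeN2 uf// lexx orbT.
Qed.

(** A maximum inherits the submean inequality from both of its terms: [u x] is at most the mean of
    [u], and [- n] is its own mean, both below the mean of the truncation. *)
Lemma trunc_below_submean O u n (x : V) c : open O -> upper_semicontinuous_on O u ->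
  (forall y, O y -> (u y < +oo)%E) ->
  (forall y r, 0 < r -> closed_eball y r `<=` O -> (u y <= ball_mean u y r)%E) ->
  0 < c -> (forall y, N2 (y - x) <= c -> O y) ->
  trunc_below u n x * vol d c <=
    \int[lam]_(y in @cball0 R d c) trunc_below u n (x + y).
Proof.
move=> oO usc uoo sub c0 xO; set w := trunc_below u n.
have Ox : O x by apply: xO; rewrite subrr N20 ltW.
have r0 : 0 < Num.sqrt c by rewrite sqrtr_gt0.
have rE : Num.sqrt c ^+ 2 = c by rewrite sqr_sqrtr// ltW.
have bE : closed_eball x (Num.sqrt c) = [set y | N2 (y - x) <= c].
  by rewrite closed_eballE ?sqrtr_ge0// rE.
have bw := trunc_below_bbs n oO usc uoo xO.
have iw : lam.-integrable [set y : V | N2 (y - x) <= c] (EFin \o w).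
  apply/(integrable_mkcond _ (measurable_N2B x _)); rewrite restrict_EFin.
  exact: bbs_integrable.
have v0 := vol_gt0 d c0.
rewrite mulrC -ler_pdivlMl//.
have mE := @ball_meanE _ _ (EFin \o w) w x _ r0 (fun _ _ => erefl).
rewrite rE in mE; have {}mE := mE bw.
rewrite -lee_fin -mE trunc_belowE; last exact: uoo.
rewrite ge_max; apply/andP; split.
  apply: (le_trans (sub x _ r0 _)); first by rewrite bE.
  apply: lee_wpmul2l; first by rewrite lee_fin invr_ge0 fine_ge0.
  rewrite bE; apply: (integral_le_real (measurable_N2B x c) _ iw).
    apply: (@measurable_funS _ _ _ _ O); [exact: measurable_open|by move=> y /xO|].
    exact: usc_measurable.
  by move=> y /xO Oy; rewrite trunc_belowE ?uoo// le_max lexx.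
rewrite mE lee_fin ler_pdivlMl// mulrC -int_eball//.
have -> : - n%:R * vol d c = \int[lam]_(y in [set y | N2 (y - x) <= c]) (- n%:R).
  by rewrite Rintegral_cst ?vol_eball//; exact: measurable_N2B.
apply: le_Rintegral => //; first exact: measurable_N2B.
  apply: measurable_bounded_integrable.
  - exact: measurable_N2B.
  - by have := @leb_cball0_fin R d c; rewrite -(leb_eball x c).
  - exact: measurable_cst.
  - exact: bounded_cst.
by move=> y /xO Oy; exact: trunc_below_ge (uoo _ Oy).
Qed.

End Semicontinuity.

(** * Dimension one: locally convex functions are semicontinuous and submean *)

Section LocallyConvex.
Variable R : realType.
Local Notation V := 'rV[R]_1.
Local Notation lam := (@leb R 1).
Implicit Types (f g v : V -> R) (O L : set V) (u : V -> \bar R).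

Definition convex_on u (B : set V) := forall y z (t : R), B y -> B z -> 0 <= t <= 1 ->
  (u (t *: y + (1 - t) *: z)%R <= t%:E * u y + (1 - t)%R%:E * u z)%E.

Lemma locally_convexP O u x : Defs.locally_convex O u -> O x ->
  exists2 e, 0 < e & [set y | N2 (y - x) <= e] `<=` O /\
    convex_on u [set y | N2 (y - x) <= e].
Proof.
move=> cu /cu[r [r0]]; rewrite closed_eballE; last exact: ltW.
by move=> rO cr; exists (r ^+ 2) => //; rewrite exprn_gt0.
Qed.

Lemma N2_1 (x : V) : N2 x = x 0 0 ^+ 2.
Proof. by rewrite /N2 big_ord1. Qed.

(** A point near [x] is a convex combination of [x] and of the end of the interval on its side, with
    a small weight [t] on the end. With [M] bounding [u] at both ends, [u y <= t M + (1 - t) b]; no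
    lower bound on [u] enters, and a real [b] in place of [u x] covers the value [-oo]. *)
Lemma locally_convex_usc O u : open O -> (forall x, O x -> (u x < +oo)%E) ->
  Defs.locally_convex O u -> upper_semicontinuous_on O u.
Proof.
move=> oO uoo cu x a Ox xa.
have [e e0 [eO ce]] := locally_convexP cu Ox.
pose r := Num.sqrt e; have r0 : 0 < r by rewrite sqrtr_gt0.
have rE : r ^+ 2 = e by rewrite sqr_sqrtr// ltW.
pose B := [set y | N2 (y - x) <= e].
have Bx : B x by rewrite /B/= subrr N20 ltW.
have [M MP] : exists M : R, forall s : R, `|s| = 1 ->
    (u (x + (s * r) *: const_mx 1)%R <= M%:E)%E /\ B (x + (s * r) *: const_mx 1).
  have BS s : `|s| = 1 -> B (x + (s * r) *: const_mx 1).
    move=> s1; rewrite /B/= [x + _]addrC addrK N2_1 !mxE mulr1 exprMn rE.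
    by rewrite -(real_normK (num_real s)) s1 expr1n mul1r.
  have bd s : `|s| = 1 -> exists M : R, (u (x + (s * r) *: const_mx 1)%R <= M%:E)%E.
    move=> s1; have := uoo _ (eO _ (BS s s1)).
    by case: (u _) => [q _| //|_]; [exists q|exists 0; rewrite leNye].
  have [M1 h1] := bd 1 (normr1 _); have [M2 h2] := bd (-1) (normrN1 _).
  exists (Num.max M1 M2) => s s1; split; last exact: BS.
  have [s0|s0] := leP 0 s.
    have -> : s = 1 by rewrite -s1 ger0_norm.
    by apply: le_trans h1 _; rewrite lee_fin le_max lexx.
  have -> : s = -1 by rewrite -s1 ltr0_norm// opprK.
  by apply: le_trans h2 _; rewrite lee_fin le_max lexx orbT.
have [b xb ba] : exists2 b : R, (u x <= b%:E)%E & b < a.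
  move: xa; case: (u x) => [q| |]; rewrite ?lte_fin// => qa; first by exists q.
  by exists (a - 1); rewrite ?leNye// ltrBlDr ltrDl.
pose K := `|M - b| + 1; have K0 : 0 < K by rewrite ltr_wpDl.
(* With [t = |k| / r], the bound [q <= r] ensures [t <= 1], and the other one [t K < a - b], hence
   [t (M - b) < a - b]. *)
pose q := Num.min r (r * (a - b) / K).
have q0 : 0 < q by rewrite lt_min r0 divr_gt0// mulr_gt0// subr_gt0.
have := nbhs_N2_lt x (exprn_gt0 2 q0); apply: filterS => y /= yq Oy.
pose k := y 0 0 - x 0 0.
have kq : `|k| < q.
  move: yq; rewrite N2_1 !mxE -/k -(real_normK (num_real k)).
  by rewrite ltr_pXn2r ?nnegrE// ltW.
pose s := Num.sg k; pose t := `|k| / r.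
have t0 : 0 <= t by rewrite divr_ge0// ltW.
have t1 : t <= 1.
  by rewrite ler_pdivrMr// mul1r (le_trans (ltW kq))// ge_min lexx.
have [k0|k0] := eqVneq k 0.
  have -> : y = x by apply/rowP => i; rewrite (ord1 i); apply/eqP; rewrite -subr_eq0 -/k k0.
  exact: le_lt_trans xb _.
have s1 : `|s| = 1 by rewrite /s normr_sg k0.
have [uM Bs] := MP s s1.
have -> : y = t *: (x + (s * r) *: const_mx 1) + (1 - t) *: x.
  apply/rowP => i; rewrite !mxE (ord1 i) mulr1.
  have -> : y 0 0 = x 0 0 + k by rewrite /k addrC subrK.
  rewrite {1}(numEsg k) -/s /t; field; exact: lt0r_neq0.
have t01 : 0 <= t <= 1 by rewrite t0.
apply: (le_lt_trans (ce _ _ t Bs Bx t01)).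
apply: (@le_lt_trans _ _ (t * M + (1 - t) * b)%:E).
  rewrite [leRHS]EFinD !EFinM; apply: leeD; apply: lee_wpmul2l => //.
  by rewrite lee_fin subr_ge0.
rewrite lte_fin.
have tK : t * K < a - b.
  rewrite -ltr_pdivlMr// ltr_pdivrMr// mulrC mulrA (lt_le_trans kq)//.
  by rewrite ge_min lexx orbT.
have : t * (M - b) <= t * K.
  by rewrite ler_wpM2l// /K (le_trans (ler_norm _))// lerDl.
lra.
Qed.

Lemma trunc_below_midpoint u n (x y : V) : (u x < +oo)%E ->
  (u (x + y)%R < +oo)%E -> (u (x - y)%R < +oo)%E ->
  (u x <= 2^-1%:E * u (x + y)%R + (1 - 2^-1)%R%:E * u (x - y)%R)%E ->
  trunc_below u n x <= 2^-1 * trunc_below u n (x + y) + 2^-1 * trunc_below u n (x - y).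
Proof.
move=> ux uy uz H; rewrite -lee_fin trunc_belowE// ge_max; apply/andP; split.
  apply: le_trans H _; rewrite [leRHS]EFinD !EFinM (_ : 1 - 2^-1 = 2^-1 :> R); last by field.
  have h0 : (0 <= (2^-1)%:E :> \bar R)%E by rewrite lee_fin invr_ge0.
  by apply: leeD; apply: lee_wpmul2l => //; rewrite trunc_belowE// le_max lexx.
rewrite lee_fin; have := trunc_below_ge n uy; have := trunc_below_ge n uz.
lra.
Qed.

(** The ball is symmetric, so the integrand may be averaged with its reflection [y |-> - y];
    midpoint convexity between [x + y] and [x - y] then bounds it below by the value at [x]. *)
Lemma locally_convex_submean O u n (x : V) c : open O ->
  upper_semicontinuous_on O u -> (forall y, O y -> (u y < +oo)%E) ->
  (forall y, N2 (y - x) <= c -> O y) -> convex_on u [set y | N2 (y - x) <= c] ->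
  0 < c ->
  trunc_below u n x * vol 1 c <=
    \int[lam]_(y in @cball0 R 1 c) trunc_below u n (x + y).
Proof.
move=> oO usc uoo xO cu c0; set w := trunc_below u n.
have bw := bbs_shift x (trunc_below_bbs n oO usc uoo xO).
pose F (y : V) := \1_(@cball0 R 1 c) y * w (x + y).
have bF : bbs F.
  rewrite (_ : F = fun y => (w \_ [set y | N2 (y - x) <= c]) (y + x))//.
  apply/funext => y; rewrite patchE /F; have [yc|yc] := leP (N2 y) c.
    by rewrite indic_in// mul1r mem_set ?[x + y]addrC//= addrK.
  by rewrite indic_out// mul0r memNset//= addrK leNgt yc.
have bFN := bbs_opp bF.
have -> : \int[lam]_(y in @cball0 R 1 c) w (x + y) =
    \int[lam]_y (2^-1 * F y + 2^-1 * F (- y)).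
  rewrite intD ?intZ ?int_opp//; try exact: bbsZ.
  rewrite -mulrDl (_ : 2^-1 + 2^-1 = 1 :> R) ?mul1r; last by field.
  by rewrite int_cball0; apply: eq_Rintegral => y _; rewrite mulrC.
rewrite -int_indic -intZ; last exact: bbs_indic.
apply: int_le; first exact/bbsZ/bbs_indic.
  by apply: bbsD; exact: bbsZ.
move=> y; rewrite /F.
have [yc|yc] := leP (N2 y) c; last by rewrite !indic_out ?N2N// !mulr0 !mul0r !mulr0 addr0.
rewrite !indic_in ?N2N// mulr1 !mul1r.
have By : N2 (x + y - x) <= c by rewrite [x + y]addrC addrK.
have Bz : N2 (x - y - x) <= c by rewrite [x - y]addrC addrK N2N.
have Bx : N2 (x - x) <= c by rewrite subrr N20 ltW.
apply: trunc_below_midpoint; try exact/uoo/xO.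
have h01 : 0 <= (2^-1 : R) <= 1 by apply/andP; split; lra.
have := cu (x + y) (x - y) _ By Bz h01; congr (u _ <= _)%E.
by apply/rowP => i; rewrite !mxE; field.
Qed.

End LocallyConvex.

Section Regularity.
Variables (R : realType) (d : nat).
Local Notation V := 'rV[R]_d.
Local Notation lam := (@leb R d).

(** The two definitions of [sbh] merge here, and what follows about subharmonic functions rests on
    these three properties. For [d = 1] the submean inequality comes only from balls on which [u] is
    convex, so a radius uniform over compact sets is extracted. *)
Lemma sbh_regular (O : set V) (u : V -> \bar R) : open O -> sbh O u ->
  [/\ forall x, O x -> (u x < +oo)%E, upper_semicontinuous_on O u &
    forall L : set V, compact L -> L `<=` O -> exists2 c0, 0 < c0 & forall x, L x ->
    (forall y, N2 (y - x) <= c0 -> O y) /\ forall n c, 0 < c -> c <= c0 ->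
      trunc_below u n x * vol d c <=
        \int[lam]_(y in @cball0 R d c) trunc_below u n (x + y)].
Proof.
move=> oO [uoo]; case: eqP => [d1|_].
  subst d => lcu; have usc := locally_convex_usc oO uoo lcu.
  split=> // L cL LO.
  have [|x Lx|c c0 cP] := @uniform_ball _ _ L (fun A => A `<=` O /\ convex_on u A) cL.
  - move=> A B AB [BO cB]; split; first exact: subset_trans BO.
    by move=> y z t /AB By /AB Bz; exact: cB.
  - by have [e e0 eP] := locally_convexP lcu (LO _ Lx); exists e.
  exists c => // x /cP[xO cu]; split=> // n k k0 kc.
  have xk y : N2 (y - x) <= k -> N2 (y - x) <= c by move=> /le_trans; apply.
  apply: (locally_convex_submean n oO) => //; first by move=> y /xk/xO.
  by move=> y z t /xk By /xk Bz; exact: cu.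
move=> [usc sub]; split=> // L cL LO.
have [|x Lx|c c0 cP] := @uniform_ball _ _ L (fun A => A `<=` O) cL.
- by move=> A B AB BO; exact: subset_trans BO.
- by have [e e0 eP] := open_N2_ball oO (LO _ Lx); exists e.
exists c => // x /cP xO; split=> // n k k0 kc.
apply: (trunc_below_submean n oO usc uoo sub k0) => y yk; apply: xO; exact: le_trans yk kc.
Qed.

End Regularity.

(** * Mollification *)

Section Mollifier.
Variables (R : realType) (d : nat).
Local Notation V := 'rV[R]_d.
Local Notation lam := (@leb R d).
Implicit Types (f g v : V -> R).

Definition mollifier (e : R) (y : V) : R := ebump (e - N2 y).

Lemma smooth_mollifier k e : smooth k setT (mollifier e).
Proof.
have s1 : smooth k setT (fun y : V => e + (-1) * N2 (y - 0)).
  apply: (smoothD openT (smooth_cst k e openT)).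
  exact: (@smoothZ _ _ k setT (-1) _ openT (smooth_N2B k 0 openT)).
have := smooth_comp (I := setT) openT (fun _ _ => I) (rsmooth_flat k setT 1) s1.
by under eq_fun do rewrite subr0 mulN1r.
Qed.

Lemma mollifierN e y : mollifier e (- y) = mollifier e y.
Proof. by rewrite /mollifier N2N. Qed.

Lemma mollifier_ge0 e y : 0 <= mollifier e y.
Proof. exact: ebump_ge0. Qed.

Lemma mollifier_out e y : e <= N2 y -> mollifier e y = 0.
Proof. by move=> ye; rewrite /mollifier ebump_le0// subr_le0. Qed.

Lemma mollifier_bdd k e : bdd k (mollifier e).
Proof.
apply: (@supp_bdd _ _ _ _ 0 e); first exact: smooth_mollifier.
by move=> y /ltW; rewrite subr0; exact: mollifier_out.
Qed.

Lemma mollifier_bbs e : bbs (mollifier e).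
Proof.
apply: (@bbs_supp _ _ _ e).
- exact: (smooth_measurable (smooth_mollifier 0 e)).
- exact: (bdd_bound (mollifier_bdd 0 e)).
- by move=> y /ltW; exact: mollifier_out.
Qed.

Lemma mollifier_int_gt0 e : 0 < e -> 0 < \int[lam]_y mollifier e y.
Proof.
move=> e0; have e2 : 0 < e / 2 by rewrite divr_gt0.
apply: (@lt_le_trans _ _ (ebump (e / 2) * vol d (e / 2))).
  by rewrite mulr_gt0 ?ebump_gt0 ?vol_gt0.
rewrite -int_indic -intZ; last exact: bbs_indic.
apply: int_le; [exact/bbsZ/bbs_indic|exact: mollifier_bbs|].
move=> y; have [ye|ye] := leP (N2 y) (e / 2).
  by rewrite indic_in// mulr1 ebump_le//; lra.
by rewrite indic_out// mulr0 mollifier_ge0.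
Qed.

(** Solving [e^(-1/(e - N2 y)) >= s] for [N2 y]. Since [ln s < 0] the squared radius is below [e];
    it can be negative, and the ball is then empty. *)
Lemma mollifier_superlevel e s y : 0 < s -> s < 1 ->
  (s <= mollifier e y) = (N2 y <= e + (ln s)^-1).
Proof.
move=> s0 s1; have ls : ln s < 0 by rewrite ln_lt0// s0.
have [ye|ye] := leP e (N2 y).
  rewrite mollifier_out// leNgt s0/=; apply/esym/negbTE; rewrite -ltNge.
  by apply: lt_le_trans ye; rewrite gtrDl invr_lt0.
have ey : 0 < e - N2 y by rewrite subr_gt0.
rewrite /mollifier /ebump /flat ey hornerE mul1r -{1}(lnK s0) ler_expR.
rewrite lerNr.
have -> : ((e - N2 y)^-1 <= - ln s) = ((- ln s)^-1 <= e - N2 y).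
  by rewrite -[in RHS](invrK (e - N2 y)) lef_pV2 ?posrE ?invr_gt0 ?oppr_gt0.
by rewrite invrN; apply/idP/idP => ?; lra.
Qed.

Lemma mollifier_lt1 e y : mollifier e y < 1.
Proof.
rewrite /mollifier /ebump /flat; case: ifP => // ey.
by rewrite hornerE mul1r expR_lt1 oppr_lt0 invr_gt0.
Qed.

(* Layer-cake: the floor sums exhibit a mollifier as a limit of nonnegative
   combinations of indicators of balls. *)
Lemma mollifier_submean f x e : bbs f -> 0 < e ->
  (forall c, 0 < c -> c <= e ->
    f x * vol d c <= \int[lam]_(y in @cball0 R d c) f (x + y)) ->
  f x * \int[lam]_y mollifier e y <= \int[lam]_y (f (x + y) * mollifier e y).
Proof.
move=> bf e0 fx.
have bfx : bbs (fun y => f (x + y)).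
  by have := bbs_shift x bf; under eq_fun do rewrite addrC.
(* Level [k] is the superlevel set at height [(k + 1) / (n + 1)]. Height 1 is left out: the
   mollifier stays below 1, and the formula for the radius holds only for heights below 1. *)
pose S (n : nat) (y : V) : R :=
  \sum_(k < n) n.+1%:R^-1 * \1_(@cball0 R d (e + (ln (k.+1%:R / n.+1%:R))^-1)) y.
have bS n : bbs (S n) by apply: bbs_sum => k; exact/bbsZ/bbs_indic.
have bfS n : bbs (fun y => f (x + y) * S n y).
  have [mS _] := bS n; have [M _ MP] := bbs_bound (bS n).
  by apply: bbsM => //; exists M.
(* For [c <= 0] the ball contains at most the origin, where both integrands agree. *)
have step c : c < e -> f x * vol d c <= \int[lam]_y (f (x + y) * \1_(@cball0 R d c) y).
  move=> ce; rewrite -int_cball0; have [c0|c0] := ltP 0 c; first exact/fx/ltW.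
  rewrite int_cball0 -int_indic -intZ; last exact: bbs_indic.
  apply: int_le; first exact/bbsZ/bbs_indic.
    apply: bbsM => //; first by case: (bbs_indic d c).
    by have [M _ MP] := bbs_bound (@bbs_indic R d c); exists M.
  move=> y; have [yc|yc] := leP (N2 y) c; last by rewrite indic_out// !mulr0.
  have -> : y = 0 by apply: N2_eq0; apply/eqP; rewrite eq_le N2_ge0 (le_trans yc c0).
  by rewrite addr0.
have SH n : f x * \int[lam]_y S n y <= \int[lam]_y (f (x + y) * S n y).
  have -> : \int[lam]_y (f (x + y) * S n y) =
      \sum_(k < n) n.+1%:R^-1 * \int[lam]_y
        (f (x + y) * \1_(@cball0 R d (e + (ln (k.+1%:R / n.+1%:R))^-1)) y).
    have bI c : bbs (fun y => f (x + y) * \1_(@cball0 R d c) y).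
      apply: bbsM => //; first by case: (bbs_indic d c).
      by have [M _ MP] := bbs_bound (@bbs_indic R d c); exists M.
    transitivity (\int[lam]_y \sum_(k < n) n.+1%:R^-1 *
        (f (x + y) * \1_(@cball0 R d (e + (ln (k.+1%:R / n.+1%:R))^-1)) y)).
      apply: eq_Rintegral => y _; rewrite mulr_sumr.
      by apply: eq_bigr => k _; rewrite mulrCA.
    rewrite int_sum; last by move=> k; exact/bbsZ/bI.
    by apply: eq_bigr => k _; rewrite intZ.
  rewrite int_sum; last by move=> k; exact/bbsZ/bbs_indic.
  rewrite mulr_sumr; apply: ler_sum => k _; rewrite intZ; last exact: bbs_indic.
  rewrite int_indic mulrCA ler_wpM2l ?invr_ge0//; apply: step.
  rewrite gtrDl invr_lt0 ln_lt0// divr_gt0//= ltr_pdivrMr// mul1r ltr_nat.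
  exact: (leq_ltn_trans (ltn_ord k)).
(* The number of heights [(k + 1) / (n + 1)] not exceeding the mollifier at [y]. Hence [S n] lies
   below the mollifier by less than [1 / (n + 1)]. *)
pose m n y := Num.truncn (n.+1%:R * mollifier e y).
have SE n y : S n y = n.+1%:R^-1 * (m n y)%:R.
  have mn : (m n y <= n)%N.
    rewrite -ltnS truncn_lt_nat ?mulr_ge0 ?mollifier_ge0//.
    by rewrite -[ltRHS]mulr1 ltr_pM2l ?ltr0n// mollifier_lt1.
  rewrite /S -mulr_sumr; congr (_ * _).
  transitivity (\sum_(k < n | (k < m n y)%N) (1 : R)); last first.
    by rewrite -(big_ord_widen n (fun=> 1) mn) sumr_const card_ord.
  rewrite [RHS]big_mkcond; apply: eq_bigr => k _.
  have k1 : k.+1%:R / n.+1%:R < 1 :> R.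
    by rewrite ltr_pdivrMr// mul1r ltr_nat ltnS ltn_ord.
  have k0 : 0 < k.+1%:R / n.+1%:R :> R by rewrite divr_gt0.
  have E := mollifier_superlevel e y k0 k1.
  have -> : (k < m n y)%N = (k.+1%:R / n.+1%:R <= mollifier e y).
    by rewrite /m truncn_gt_nat ler_pdivrMr// mulrC.
  rewrite E; case: ifP => h; first by rewrite indic_in.
  by rewrite indic_out// ltNge h.
have mI n y : (m n y)%:R <= n.+1%:R * mollifier e y < (m n y).+1%:R.
  by apply: truncn_itv; rewrite mulr_ge0// mollifier_ge0.
have S0 n y : 0 <= S n y by rewrite SE mulr_ge0.
have Sle' n y : S n y <= mollifier e y.
  by have /andP[h _] := mI n y; rewrite SE ler_pdivrMl.
have Scv y : S n y @[n --> \oo] --> mollifier e y.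
  apply/cvgrPdist_lt => t t0; near=> n.
  rewrite ger0_norm ?subr_ge0// ltrBlDr.
  apply: (@lt_trans _ _ (n.+1%:R^-1 + S n y)).
    rewrite SE -{1}[n.+1%:R^-1]mulr1 -mulrDr ltr_pdivlMl//.
    by have /andP[_] := mI n y; rewrite -[(m n y).+1%:R]natr1 addrC.
  rewrite ltrD2r; near: n; exact: (near_infty_natSinv_lt (PosNum t0)).
have Sle n y : `|S n y| <= \1_(@cball0 R d e) y.
  rewrite ger0_norm//; apply: le_trans (Sle' n y) _.
  have [ye|/ltW ye] := leP (N2 y) e; first by rewrite indic_in// ltW// mollifier_lt1.
  by rewrite mollifier_out.
have L1 : \int[lam]_y S n y @[n --> \oo] --> \int[lam]_y mollifier e y.
  apply: (int_dct (bbs_indic d e) _ Sle Scv).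
  by move=> n; have [] := bS n.
have [M M0 MP] := bbs_bound bfx.
have L2 : \int[lam]_y (f (x + y) * S n y) @[n --> \oo] -->
    \int[lam]_y (f (x + y) * mollifier e y).
  apply: (@int_dct _ _ _ _ (fun y => M * \1_(@cball0 R d e) y)).
  - exact/bbsZ/bbs_indic.
  - by move=> n; have [] := bfS n.
  - by move=> n y; rewrite normrM ler_pM.
  - by move=> y; apply: cvgM; [exact: cvg_cst|exact: Scv].
apply: (ler_cvg_to (cvgM (cvg_cst (f x)) L1) L2).
by apply: nearW => n; exact: SH.
Unshelve. all: by end_near. Qed.

End Mollifier.

(** * The mollified function: smoothness, bounds, submean inequality *)

Section Mollify.
Variables (R : realType) (d : nat).
Local Notation V := 'rV[R]_d.
Local Notation lam := (@leb R d).
Implicit Types (f g v : V -> R).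

Definition mollify (e : R) f (x : V) : R :=
  (\int[lam]_y mollifier e y)^-1 *
    superpose lam f (fun t => - t) (mollifier e) x.

(** The two forms of the convolution: with the kernel shifted, derivatives fall on the smooth
    factor; with [f] shifted, the integral is a mean of [f] around [x]. They agree by translation
    invariance and evenness of the kernel. *)
Lemma superposeE f e x : bbs f ->
  superpose lam f (fun t => - t) (mollifier e) x =
    \int[lam]_y (f (x + y) * mollifier e y).
Proof.
move=> bf; rewrite /superpose.
have bF : bbs (fun t => f t * mollifier e (x + - t)).
  apply: bbsM => //.
    have [m _] := bbs_opp (bbs_shift x (mollifier_bbs d e)).
    by under eq_fun do rewrite addrC.
  by have [M MP] := bdd_bound (@mollifier_bdd R d 0 e); exists M.
rewrite -(int_shift x bF); apply: eq_Rintegral => y _.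
by rewrite opprD addrCA subrr addr0 mollifierN addrC.
Qed.

Lemma mollifyE f e x : bbs f -> mollify e f x =
  (\int[lam]_y mollifier e y)^-1 * \int[lam]_y (f (x + y) * mollifier e y).
Proof. by move=> bf; rewrite /mollify superposeE. Qed.

Lemma smooth_mollify k f e : bbs f -> smooth k setT (mollify e f).
Proof.
move=> bf; apply: (@smoothZ _ _ k setT _ _ openT).
apply: superpose_smooth.
- exact: bbs_integrable.
- exact: measurable_opp_rV.
- exact: smooth_mollifier.
- exact: mollifier_bdd.
Qed.

Lemma bbs_mollifier_mul f e x : bbs f -> bbs (fun y => f (x + y) * mollifier e y).
Proof.
move=> bf; apply: bbsM.
- by have := bbs_shift x bf; under eq_fun do rewrite addrC.
- by have [] := mollifier_bbs d e.
- by have [M MP] := bdd_bound (@mollifier_bdd R d 0 e); exists M.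
Qed.

Lemma mollify_ge f e x : bbs f -> 0 < e ->
  (forall c, 0 < c -> c <= e ->
    f x * vol d c <= \int[lam]_(y in @cball0 R d c) f (x + y)) ->
  f x <= mollify e f x.
Proof.
move=> bf e0 fx; rewrite mollifyE// ler_pdivlMl ?mollifier_int_gt0// mulrC.
exact: mollifier_submean.
Qed.

Lemma mollify_le f e x a : bbs f -> 0 < e ->
  (forall y, N2 y <= e -> f (x + y) <= a) -> mollify e f x <= a.
Proof.
move=> bf e0 fa; rewrite mollifyE// ler_pdivrMl ?mollifier_int_gt0//.
rewrite mulrC -intZ; last exact: mollifier_bbs.
apply: int_le; [exact: bbs_mollifier_mul|exact/bbsZ/mollifier_bbs|].
move=> y; have [ye|/ltW ye] := leP (N2 y) e; last by rewrite mollifier_out// !mulr0.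
by rewrite ler_wpM2r ?mollifier_ge0// fa.
Qed.

Lemma mollify_ge_cst f e x a : bbs f -> 0 < e ->
  (forall y, N2 y <= e -> a <= f (x + y)) -> a <= mollify e f x.
Proof.
move=> bf e0 fa; rewrite mollifyE// ler_pdivlMl ?mollifier_int_gt0//.
rewrite mulrC -intZ; last exact: mollifier_bbs.
apply: int_le; [exact/bbsZ/mollifier_bbs|exact: bbs_mollifier_mul|].
move=> y; have [ye|/ltW ye] := leP (N2 y) e; last by rewrite mollifier_out// !mulr0.
by rewrite ler_wpM2r ?mollifier_ge0// fa.
Qed.

Lemma eq_bbs f g : f =1 g -> bbs f -> bbs g.
Proof. by move=> /funext ->. Qed.

Lemma bbs_integralE g : bbs g ->
  (\int[lam]_y (g y)%:E = (\int[lam]_y g y)%R%:E)%E.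
Proof.
move=> bg; rewrite /Rintegral fineK//.
by apply: integrable_fin_num => //; exact: bbs_integrable.
Qed.

Lemma measurable_addition :
  measurable_fun [set: V * V] (fun p : V * V => p.1 + p.2 : V).
Proof.
apply: measurable_fun_rV => i; under eq_fun do rewrite mxE.
apply: measurable_funD.
  exact: (measurableT_comp (measurable_coord_rV i) measurable_fst).
exact: (measurableT_comp (measurable_coord_rV i) measurable_snd).
Qed.

Lemma norm_mul3_le (a b c M N : R) : 0 <= a -> `|b| <= M -> `|c| <= N ->
  `|b * (a * c)| <= M * N * a.
Proof.
move=> a0 bM cN; rewrite mulrCA normrM (ger0_norm a0) mulrC ler_wpM2r// normrM.
exact: ler_pM.
Qed.

Lemma mul_shuffle_le (a b v c : R) : 0 <= a -> b * v <= c -> v * (b * a) <= a * c.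
Proof. by move=> a0 h; rewrite mulrA mulrC ler_wpM2l// mulrC. Qed.

(** Averaging over the ball and averaging against the mollifier commute by Fubini, the joint
    integrand being bounded with bounded support. The hypothesis, weighted by the mollifier, is then
    integrated in [y]. *)
Lemma mollify_submean f e x c : bbs f -> 0 < e ->
  (forall y, N2 y <= e ->
    f (x + y) * vol d c <= \int[lam]_(z in @cball0 R d c) f (x + y + z)) ->
  mollify e f x * vol d c <= \int[lam]_(z in @cball0 R d c) mollify e f (x + z).
Proof.
move=> bf e0 fx.
pose ind (z : V) : R := \1_(@cball0 R d c) z.
have bind : bbs ind := bbs_indic d c.
have [M M0 MP] := bbs_bound bf.
have [Mm Mm0 MmP] := bbs_bound (mollifier_bbs d e).
have indb z : 0 <= ind z <= 1.
  by have [zc|zc] := leP (N2 z) c; rewrite /ind ?(indic_in zc) ?(indic_out zc) ?lexx ?ler01.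
pose F (p : V * V) : R := f (x + (p.1 + p.2)) * (ind p.1 * mollifier e p.2).
have mF : measurable_fun setT F.
  apply: measurable_funM.
    have mf : measurable_fun setT (fun y : V => f (x + y)).
      by have := bbs_shift x bf; under eq_fun do rewrite addrC; case.
    exact: (measurableT_comp mf measurable_addition).
  apply: measurable_funM.
    by apply: (measurableT_comp _ measurable_fst); case: bind.
  by apply: (measurableT_comp _ measurable_snd); case: (mollifier_bbs d e).
pose A : set (V * V) := @cball0 R d c `*` @cball0 R d e.
have mA : measurable A by apply: measurableX; exact: measurable_cball0.
have iF : (lam \x lam)%E.-integrable setT (EFin \o F).
  have -> : EFin \o F = (EFin \o F) \_ A.
    apply/funext => -[z y]; rewrite patchE; case: ifPn => //= zyA.
    congr EFin; rewrite /F/=.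
    have [zc|zc] := leP (N2 z) c; last by rewrite /ind (indic_out zc) mul0r mulr0.
    have [ye|/ltW ye] := leP (N2 y) e; last by rewrite mollifier_out// !mulr0.
    by exfalso; move/negP: zyA; apply; rewrite inE.
  apply: (iffLR (integrable_mkcond (mu := (lam \x lam)%E) (EFin \o F) mA)).
  apply: measurable_bounded_integrable => //.
  - apply: (@le_lt_trans _ _ (lam (@cball0 R d c) * lam (@cball0 R d e))%E).
      have E := @product_measure1E _ _ _ _ R lam lam _ _
        (@measurable_cball0 R d c) (@measurable_cball0 R d e).
      by rewrite le_eqVlt; apply/orP; left; apply/eqP; exact: E.
    by rewrite lte_mul_pinfty// ?leb_cball0_fin// ge0_fin_numE// leb_cball0_fin.
  - exact: measurable_funTS.
  - apply: (@bounded_near_le _ _ _ _ (M * (1 * Mm))) => -[z y] _.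
    rewrite /F !normrM /=; have /andP[i0 i1] := indb z.
    by rewrite ler_pM ?mulr_ge0// ler_pM// ger0_norm.
have FU := @Fubini _ _ _ _ R lam lam (EFin \o F) iF.
have bF1 z : bbs (fun y => F (z, y)).
  apply: eq_bbs (bbsZ (ind z) (bbs_mollifier_mul e (x + z) bf)) => y.
  by rewrite /F/= addrA mulrCA.
have bF2 y : bbs (fun z => F (z, y)).
  have bs : bbs (fun z => f (x + y + z)).
    by have := bbs_shift (x + y) bf; under eq_fun do rewrite addrC.
  have H z : `|ind z| <= 1 by have /andP[i0 i1] := indb z; rewrite ger0_norm.
  have bsi := bbsM bs (proj1 bind) (ex_intro _ 1 H).
  apply: eq_bbs (bbsZ (mollifier e y) bsi) => z.
  by rewrite /F/= [z + y]addrC addrA [in RHS]mulrA mulrC.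
have EF1 z := bbs_integralE (bF1 z).
have EF2 y := bbs_integralE (bF2 y).
have FR : \int[lam]_z (\int[lam]_y F (z, y)) = \int[lam]_y (\int[lam]_z F (z, y)).
  apply: (congr1 (@fine R)).
  transitivity (\int[lam]_z \int[lam]_y (EFin \o F) (z, y))%E.
    by apply: eq_integral => z _; rewrite -EF1.
  by rewrite FU; apply: eq_integral => y _; rewrite -EF2.
pose k := (\int[lam]_y mollifier e y)^-1.
have k0 : 0 < k by rewrite invr_gt0 mollifier_int_gt0.
pose Sf := superpose lam f (fun t => - t) (mollifier e).
have SfE z : Sf z = \int[lam]_y (f (z + y) * mollifier e y) := superposeE e z bf.
have F1E z : \int[lam]_y F (z, y) = Sf (x + z) * ind z.
  rewrite SfE mulrC.
  have <- := @intZ R d _ (ind z) (bbs_mollifier_mul e (x + z) bf).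
  by apply: eq_Rintegral => y _; rewrite /F/= addrA mulrCA.
have cS : continuous (fun z => Sf (x + z)).
  move=> z; apply: (@continuous_comp _ _ _ (fun z : V => x + z) Sf).
    by apply: (@continuousD _ _ _ (fun=> x) id); [apply: cst_continuous|apply: cvg_id].
  apply: superpose_continuous.
  - exact: bbs_integrable.
  - exact: measurable_opp_rV.
  - exact: smooth_mollifier.
  - exact: mollifier_bdd.
have bI := bbs_continuous_indic c cS.
have LE : \int[lam]_(z in @cball0 R d c) mollify e f (x + z) =
    k * \int[lam]_z (\int[lam]_y F (z, y)).
  have -> : \int[lam]_z (\int[lam]_y F (z, y)) = \int[lam]_z (Sf (x + z) * ind z).
    by apply: eq_Rintegral => z _; exact: F1E.
  have <- := @intZ R d _ k bI.
  rewrite int_cball0; apply: eq_Rintegral => z _.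
  by rewrite /mollify -/k -mulrA.
have mE : mollify e f x = k * Sf x by [].
move: bF1 EF1 EF2 FU mF => _ _ _ _ _.
rewrite LE FR mE -mulrA (ler_pM2l k0) SfE mulrC.
have <- := @intZ R d _ (vol d c) (bbs_mollifier_mul e x bf).
have F2E y : \int[lam]_z F (z, y) =
    mollifier e y * \int[lam]_(z in @cball0 R d c) f (x + y + z).
  have bs : bbs (fun z => f (x + y + z) * ind z).
    apply: bbsM; first by have := bbs_shift (x + y) bf; under eq_fun do rewrite addrC.
      by case: bind.
    by exists 1 => z; have /andP[i0 i1] := indb z; rewrite ger0_norm.
  rewrite int_cball0; have <- := @intZ R d _ (mollifier e y) bs.
  by apply: eq_Rintegral => z _; rewrite /F/= [z + y]addrC addrA [in RHS]mulrA mulrC; ring.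
have bMi : bbs (fun z => M * Mm * ind z) by exact: bbsZ.
have FM z y : `|F (z, y)| <= M * Mm * ind z.
  have /andP[i0 _] := indb z.
  exact: (norm_mul3_le i0 (MP (x + (z + y))) (MmP y)).
have F2M y : `|\int[lam]_z F (z, y)| <= \int[lam]_z (M * Mm * ind z).
  rewrite ler_norml; apply/andP; split; last first.
    apply: (int_le (bF2 y) bMi) => z; exact: le_trans (ler_norm _) (FM z y).
  rewrite -mulN1r; have <- := @intZ R d _ (-1) bMi.
  apply: (int_le (bbsZ (-1) bMi) (bF2 y)) => z.
  by rewrite mulN1r; have := FM z y; rewrite ler_norml => /andP[].
have bF2I : bbs (fun y => \int[lam]_z F (z, y)).
  apply: (@bbs_supp _ _ _ e).
  - have mG := measurable_fubini_G iF.
    exact: (measurableT_comp (fine_measurable measurableT) mG).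
  - by exists (\int[lam]_z (M * Mm * ind z)).
  - by move=> y ye; have E := mollifier_out (ltW ye); rewrite (F2E y) E mul0r.
apply: (int_le (bbsZ (vol d c) (bbs_mollifier_mul e x bf)) bF2I) => y.
rewrite (F2E y); have [ye|/ltW/mollifier_out E] := leP (N2 y) e; last first.
  by rewrite E mulr0 mul0r mulr0.
exact: (mul_shuffle_le (mollifier_ge0 e y) (fx y ye)).
Qed.

End Mollify.

(** * Extending a locally subharmonic function *)

Section Exhaustion.
Variables (R : realType) (d : nat).
Local Notation V := 'rV[R]_d.
Implicit Types (f g v W U : V -> R) (O K L : set V).

Lemma smoothX k O f n : open O -> smooth k O f -> smooth k O (fun x => f x ^+ n).
Proof.
move=> oO sf; elim: n => [|n IH].
  by under eq_fun do rewrite expr0; exact: smooth_cst.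
under eq_fun do rewrite exprS; exact: smoothM oO sf IH.
Qed.

Lemma smooth_invN2X k O (a : V) n : open O -> ~ O a ->
  smooth k O (fun x => (N2 (x - a))^-1 ^+ n).
Proof.
move=> oO Oa; apply: smoothX => //.
apply: (smooth_comp oO _ (rsmooth_inv R k) (smooth_N2B k a oO)) => x Ox /=.
apply/eqP => /N2_eq0/eqP; rewrite subr_eq0 => /eqP xa.
by apply: Oa; rewrite -xa.
Qed.

(** With [t = |x - a|^2] the Laplacian is [n t^(-n-1) (4 (n + 1) - 2 d)], and [n >= d] makes the
    bracket positive. *)
Lemma lap_invN2X_ge0 O (a x : V) n : open O -> ~ O a -> O x -> (d <= n)%N ->
  0 <= lap (fun x => (N2 (x - a))^-1 ^+ n) x.
Proof.
move=> oO Oa Ox dn.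
have n0 y : O y -> N2 (y - a) != 0.
  by move=> Oy; apply/eqP => /N2_eq0/eqP; rewrite subr_eq0 => /eqP ya; apply: Oa; rewrite -ya.
have dh1 (t : R) : t != 0 -> is_derive t 1 (fun s : R => - (n%:R * s^-1 ^+ n.+1))
    (n%:R * n.+1%:R * t^-1 ^+ n.+2).
  move=> tn0; have dI := is_derive_invX n.+1 tn0.
  have -> : (fun s : R => - (n%:R * s^-1 ^+ n.+1)) =
    (- n%:R) *: (fun s : R => s^-1 ^+ n.+1) by apply/funext => s; rewrite -mulNr.
  by apply: is_derive_eq; rewrite /GRing.scale/= mulrNN mulrA.
rewrite (@lap_comp _ _ O (fun x => N2 (x - a)) (fun t => t^-1 ^+ n)
  (fun t => - (n%:R * t^-1 ^+ n.+1)) (fun t => n%:R * n.+1%:R * t^-1 ^+ n.+2) x oO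
  (smooth_N2B 2 a oO) _ _ Ox); last 2 first.
- by move=> y Oy; exact: (is_derive_invX n (n0 y Oy)).
- by move=> y Oy; exact: (dh1 _ (n0 y Oy)).
rewrite grad_N2B lap_N2B; set t := N2 (x - a).
have t0 : 0 < t by rewrite lt_neqAle eq_sym n0// N2_ge0.
have -> : n%:R * n.+1%:R * t^-1 ^+ n.+2 * (4 * t) + - (n%:R * t^-1 ^+ n.+1) * (2 * d%:R) =
    n%:R * t^-1 ^+ n.+1 * (4 * n.+1%:R - 2 * d%:R).
  by rewrite [t^-1 ^+ n.+2]exprSr; field; rewrite gt_eqF.
apply: mulr_ge0; first by rewrite mulr_ge0// exprn_ge0// invr_ge0 ltW.
rewrite subr_ge0.
have : d%:R <= n%:R :> R by rewrite ler_nat.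
by rewrite -[n.+1%:R]natr1; have : 0 <= n%:R :> R by []; lra.
Qed.

Lemma pole_sum O (s : seq V) (b : R) n : open O -> 0 <= b -> (d <= n)%N ->
  (forall a, a \in s -> ~ O a) ->
  (forall k, smooth k O (fun x => \sum_(a <- s) (b * (N2 (x - a))^-1) ^+ n)) /\
  forall x, O x -> 0 <= lap (fun x => \sum_(a <- s) (b * (N2 (x - a))^-1) ^+ n) x.
Proof.
move=> oO b0 dn; elim: s => [|a s IH] sO.
  split=> [k|x Ox]; first by under eq_fun do rewrite big_nil; exact: smooth_cst.
  under eq_fun do rewrite big_nil.
  have E i : partial i (fun=> 0 : R) = (fun=> 0) :> (V -> R).
    by apply/funext => y; exact: partial_cst.
  by rewrite /lap big1// => i _; rewrite !E.
have sO' c : c \in s -> ~ O c by move=> cs; apply: sO; rewrite inE cs orbT.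
have [IHs IHl] := IH sO'.
have Oa : ~ O a by apply: sO; rewrite inE eqxx.
have E : (fun x => \sum_(c <- a :: s) (b * (N2 (x - c))^-1) ^+ n) =
    fun x => b ^+ n * (N2 (x - a))^-1 ^+ n + \sum_(c <- s) (b * (N2 (x - c))^-1) ^+ n.
  by apply/funext => x; rewrite big_cons exprMn.
have st k := @smoothZ _ _ k O (b ^+ n) _ oO (smooth_invN2X k n oO Oa).
split=> [k|x Ox]; rewrite E; first exact: (smoothD oO (st k) (IHs k)).
rewrite (lapD oO (st 2) (IHs 2) Ox) (lapZ _ oO (smooth_invN2X 2 n oO Oa) Ox).
rewrite addr_ge0 ?IHl// mulr_ge0 ?exprn_ge0//.
exact: (lap_invN2X_ge0 oO Oa Ox dn).
Qed.

(** The source of strict subharmonicity in [W], the poles giving only [>= 0]: the first-order term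
    contains [lap N2 = 2 d > 0]. *)
Lemma lap_power_gt0 (x : V) n : (0 < d)%N ->
  0 < lap (fun x => (1 + N2 (x - 0)) ^+ n.+2) x.
Proof.
move=> d0.
have dl (m : nat) (t : R) : is_derive t 1 (fun s : R => (1 + s) ^+ m.+1) (m.+1%:R * (1 + t) ^+ m).
  have d1 : is_derive t (1 : R) (fun s : R => 1 + s) 1.
    have -> : (fun s : R => 1 + s) = cst 1 + id by [].
    by apply: is_derive_eq; rewrite add0r.
  by have := @is_derive_pow _ _ (fun s : R => 1 + s) m.+1 t 1 1 d1; rewrite mulr1.
have dl2 (t : R) : is_derive t 1 (fun s : R => n.+2%:R * (1 + s) ^+ n.+1)
    (n.+2%:R * (n.+1%:R * (1 + t) ^+ n)).
  have d1 := dl n t.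
  have -> : (fun s : R => n.+2%:R * (1 + s) ^+ n.+1) =
      n.+2%:R *: (fun s : R => (1 + s) ^+ n.+1) by [].
  exact: is_deriveZ.
rewrite (@lap_comp _ _ setT (fun x => N2 (x - 0)) (fun t => (1 + t) ^+ n.+2)
  (fun t => n.+2%:R * (1 + t) ^+ n.+1) (fun t => n.+2%:R * (n.+1%:R * (1 + t) ^+ n)) x openT
  (smooth_N2B 2 0 openT) (fun y _ => dl n.+1 _) (fun y _ => dl2 _) I).
rewrite grad_N2B lap_N2B; have t0 := N2_ge0 (x - 0).
have t1 : 0 < 1 + N2 (x - 0) by rewrite ltr_pwDl.
apply: ltr_wpDl; first by rewrite !mulr_ge0// exprn_ge0// ltW.
by rewrite !mulr_gt0 ?exprn_gt0// ltr0n.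
Qed.

Lemma compact_N2_bound K : compact K -> exists2 B, 0 <= B & forall x, K x -> N2 x <= B.
Proof.
move=> cK; have [K0|K0] := pselect (K !=set0); last first.
  by exists 0 => // x Kx; exfalso; apply: K0; exists x.
have [z _ zmax] := compact_EVT_max K0 cK (continuous_subspaceT (@N2_continuous R d)).
exists (N2 z); first exact: N2_ge0.
by move=> x Kx; apply: zmax; rewrite inE.
Qed.

(** Fixes the common exponent of all terms of [W]: [d <= n] is for the poles, [2 <= n] for
    [lap_power_gt0] and for [t^n > 2] when [t >= 2]. *)
Lemma power_small (m : R) : 0 <= m -> exists2 n, (d <= n)%N /\ (2 <= n)%N &
  m * (9 / 16) ^+ n < 2^-1.
Proof.
move=> m0.
have q1 : `|9 / 16 : R| < 1 by rewrite ger0_norm; lra.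
have m1 : 0 < (m + 1)^-1 * 2^-1 :> R by rewrite mulr_gt0 ?invr_gt0 ?ltr_wpDl.
have /cvgrPdist_lt/(_ _ m1)[N _ NP] := @cvg_expr R (9 / 16) q1.
exists (maxn N (maxn d 2)); first by split; rewrite !leq_max leqnn ?orbT.
have := NP (maxn N (maxn d 2)) (leq_maxl _ _).
rewrite sub0r normrN ger0_norm ?exprn_ge0// => h.
apply: (@le_lt_trans _ _ ((m + 1) * (9 / 16) ^+ maxn N (maxn d 2))).
  by rewrite ler_wpM2r ?exprn_ge0// lerDl.
by rewrite -ltr_pdivlMl// ltr_wpDl.
Qed.

(* The poles form an [s]-net of the part of the complement of [O] near which
   [1 + |x|^2] alone does not make [W] large. On [K] every base is at most 9/16,
   while on [O] outside [L] some base is at least 2. *)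
Lemma exhaustion O K : (0 < d)%N -> open O -> compact K -> K `<=` O ->
  exists W : V -> R, exists L : set V,
    [/\ forall k, smooth k O W, forall x, O x -> 0 < lap W x,
        compact L /\ L `<=` O, forall x, K x -> W x < 2^-1 &
        forall x, O x -> W x <= 2 -> L x].
Proof.
move=> d0 oO cK KO.
have [|x Kx|c c0 cP] := @uniform_ball _ _ K (fun A => A `<=` O) cK.
- by move=> A B AB BO; exact: subset_trans BO.
- by have [e e0 eP] := open_N2_ball oO (KO _ Kx); exists e.
have [B B0 BP] := compact_N2_bound cK.
(* For [x] in [K] and [a] outside [O], [N2 (x - a) > c = 16 s], so the base [9 s / N2 (x - a)] is
   below 9/16. A point within [s] of a net element's neighbour outside [O] is within [4 s] of a
   pole, by [N2D_le], and has there a base at least 9/4. *)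
pose s := c / 16; have s0 : 0 < s by rewrite divr_gt0.
(* The base [(1 + N2 x) / P] is at most 1/2 on [K], and exceeds 2 once [1 + N2 x > 2 P], the bound
   used in [L]. *)
pose P := 2 * (1 + B); have P0 : 0 < P by rewrite mulr_gt0// ltr_pwDl.
pose L := [set x | 1 + N2 x <= 2 * P] `&` \bigcap_(a in ~` O) [set x | s <= N2 (x - a)].
(* If [1 + N2 x <= 2 P] and [N2 (x - a) < s], then [N2 a <= 4 P + 2 s]: poles are wanted only near
   this compact part of the complement. *)
pose F := [set a | N2 (a - 0) <= 4 * P + 2 * s] `&` ~` O.
have cF : compact F.
  apply: (@subclosed_compact _ F _ _ (@compact_N2_le _ _ 0 (4 * P + 2 * s))).
    apply: closedI; last exact: open_closedC.
    by apply: compact_closed; [exact: norm_hausdorff|exact: compact_N2_le].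
  by move=> y [].
have cL : compact L.
  apply: (@subclosed_compact _ L _ _ (@compact_N2_le _ _ 0 (2 * P))).
    apply: closedI.
      rewrite (_ : mkset _ = [set x | N2 (x - 0) <= 2 * P - 1]); last first.
        by apply/seteqP; split=> x /=; rewrite subr0 lerBrDl.
      by apply: compact_closed; [exact: norm_hausdorff|exact: compact_N2_le].
    apply: closed_bigI => a _.
    apply: (@closed_comp _ _ _ [set t : R | s <= t]); last exact: closed_ge.
    by move=> x _; exact: N2B_continuous.
  by move=> x [/= xP _]; rewrite subr0; apply: le_trans xP; rewrite lerDr.
have LO : L `<=` O.
  move=> x [_ Lx]; apply: contrapT => Ox.
  by have := Lx x Ox; rewrite /= subrr N20 leNgt s0.
have := cF; rewrite {1}compact_cover => /(_ V F (fun a => [set y | N2 (y - a) < s])).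
case.
- by move=> a _; exact: open_N2_lt.
- by move=> a Fa; exists a => //=; rewrite subrr N20.
move=> D DF FD; pose S : seq V := finmap.enum_fset D.
have SO a : a \in S -> ~ O a by move=> /DF; rewrite inE => -[].
(* The terms of [W] are the [size S] poles and [Q]; on [K] each is at most [(9/16)^n]. *)
have [n [dn n2] nP] := @power_small ((size S).+1%:R) (ler0n _ _).
pose T (x : V) : R := \sum_(a <- S) (9 * s * (N2 (x - a))^-1) ^+ n.
pose Q (x : V) : R := P^-1 ^+ n * (1 + N2 (x - 0)) ^+ n.
have b0 : 0 <= 9 * s by rewrite mulr_ge0// ltW.
have [sT lT] := pole_sum oO b0 dn SO.
have sN k : smooth k O (fun x : V => (1 + N2 (x - 0)) ^+ n).
  exact: (smoothX n oO (smoothD oO (smooth_cst k 1 oO) (smooth_N2B k 0 oO))).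
have sQ k : smooth k O Q := @smoothZ _ _ k O (P^-1 ^+ n) _ oO (sN k).
exists (fun x => T x + Q x), L; split.
- by move=> k; exact: (smoothD oO (sT k) (sQ k)).
- move=> x Ox; rewrite (lapD oO (sT 2) (sQ 2) Ox) (lapZ _ oO (sN 2) Ox).
  apply: ltr_wpDl; first exact: lT.
  rewrite mulr_gt0 ?exprn_gt0 ?invr_gt0//.
  by case: (n) n2 => [//|[//|n'] _]; exact: lap_power_gt0.
- exact: (conj cL LO).
- move=> x Kx; apply: le_lt_trans nP.
  rewrite -natr1 mulrDl mul1r; apply: lerD.
    apply: (@le_trans _ _ (\sum_(a <- S) (9 / 16) ^+ n)).
      rewrite /T big_seq [leRHS]big_seq; apply: ler_sum => a /SO Oa.
      have ca : c < N2 (x - a).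
        by rewrite ltNge; apply/negP => h; apply: Oa; apply: (cP x Kx); rewrite /= N2B.
      have a0 : 0 < N2 (x - a) by apply: lt_trans ca.
      apply: lerXn2r; rewrite ?nnegrE ?mulr_ge0 ?invr_ge0 ?ltW//.
      rewrite ltr_pdivrMr// /s; lra.
    by rewrite big_const_seq count_predT iter_addr_0 [leRHS]mulr_natl.
  rewrite /Q -exprMn subr0; apply: lerXn2r; rewrite ?nnegrE ?mulr_ge0 ?invr_ge0
    ?addr_ge0 ?N2_ge0 ?ltW//.
  rewrite mulrC ltr_pdivrMr// /P; have := BP x Kx; lra.
- move=> x Ox; apply: contraPP => Lx; apply/negP; rewrite -ltNge.
  have T0 : 0 <= T x.
    by apply: sumr_ge0 => a _; rewrite exprn_ge0// mulr_ge0 ?invr_ge0 ?N2_ge0.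
  have Q0 : 0 <= Q x.
    by rewrite mulr_ge0 ?exprn_ge0 ?invr_ge0 ?addr_ge0 ?N2_ge0// ltW.
  have big (t : R) : 2 <= t -> 2 < t ^+ n.
    move=> t2; apply: (@lt_le_trans _ _ (t ^+ 2)); first by rewrite expr2; nra.
    by rewrite ler_weXn2l//; lra.
  have [xP|xP] := leP (1 + N2 x) (2 * P); last first.
    apply: (@lt_le_trans _ _ (Q x)); last by rewrite lerDr.
    rewrite /Q -exprMn subr0 big// mulrC ler_pdivlMr// ltW//.
  have [a [Oa xa]] : exists a, ~ O a /\ N2 (x - a) < s.
    apply: contrapT => H; apply: Lx; split=> // a Oa /=.
    by rewrite leNgt; apply/negP => xa; apply: H; exists a.
  have Fa : F a.
    split=> //=; rewrite subr0.
    have := N2D_le (a - x) x; rewrite subrK N2B; lra.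
  have [a' /= a'D a'a] := FD a Fa.
  have Oa' : ~ O a' := SO a' a'D.
  have xa' : N2 (x - a') <= 4 * s.
    have := N2D_le (x - a) (a - a'); rewrite addrA subrK; lra.
  have a'0 : 0 < N2 (x - a').
    rewrite lt_neqAle N2_ge0 andbT eq_sym; apply/eqP => /N2_eq0/eqP.
    by rewrite subr_eq0 => /eqP E; apply: Oa'; rewrite -E.
  apply: (@lt_le_trans _ _ (T x)); last by rewrite lerDl.
  rewrite /T (big_rem a')//=; apply: (@lt_le_trans _ _ ((9 * s * (N2 (x - a'))^-1) ^+ n)).
    by apply: big; rewrite ler_pdivlMr//; lra.
  rewrite lerDl; apply: sumr_ge0 => i _.
  by rewrite exprn_ge0// mulr_ge0 ?invr_ge0 ?N2_ge0.
Qed.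

Lemma absorb_ge0 (a b q p : R) : 0 < q -> q <= p -> `|b| <= a -> 0 <= b + a / q * p.
Proof.
move=> q0 qp ba; have a0 : 0 <= a := le_trans (normr_ge0 b) ba.
rewrite -lerBlDl sub0r; apply: (le_trans (ler_norm _)); rewrite normrN.
apply: (le_trans ba); rewrite -mulrA ler_peMr// ler_pdivlMl// mulr1.
exact: qp.
Qed.

Lemma lap_cst (c : R) (x : V) : lap (fun=> c) x = 0.
Proof.
have E i : partial i (fun=> c) = (fun=> 0) :> (V -> R).
  by apply/funext => y; exact: partial_cst.
by rewrite /lap big1// => i _; rewrite E partial_cst.
Qed.

(** [P] is [psi(W)] with [psi(s) = (s - a) e^(-1/(s - a))] for [s > a]. In
    [psi''(W) |grad W|^2 + psi'(W) lap W] both terms are nonnegative, and the second is positive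
    where [W > a]. *)
Lemma lap_tebump O W (a : R) : open O -> (forall k, smooth k O W) ->
  (forall y, O y -> 0 < lap W y) ->
  exists P : V -> R, [/\ forall k, smooth k O P, forall y, O y -> 0 <= lap P y,
    forall y, O y -> a < W y -> 0 < lap P y & forall y, W y <= a -> P y = 0].
Proof.
move=> oO sW lW; pose T y := W y + - a.
have sT k : smooth k O T := smoothD oO (sW k) (smooth_cst k (- a) oO).
have lT y : O y -> lap T y = lap W y.
  by move=> Oy; rewrite (lapD oO (sW 2) (smooth_cst 2 (- a) oO) Oy) lap_cst addr0.
pose P y := T y * ebump (T y).
have lP y : O y -> lap P y =
    flat 'X^3 (T y) * (\sum_i partial i T y ^+ 2) + flat (1 + 'X) (T y) * lap T y.
  move=> Oy; exact: (lap_comp oO (sT 2) (fun z _ => is_derive_tebump (T z))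
    (fun z _ => is_derive_tebump2 (T z)) Oy).
have g0 y : 0 <= flat 'X^3 (T y) * (\sum_i partial i T y ^+ 2).
  rewrite mulr_ge0// ?sumr_ge0// => [|i _]; last exact: sqr_ge0.
  by apply: flat_ge0 => s s0; rewrite hornerXn exprn_ge0.
exists P; split=> [k|y Oy|y Oy Wy|y Wy].
- exact: (smoothM oO (sT k) (smooth_comp (I := setT) oO (fun _ _ => I)
    (rsmooth_flat k setT 1) (sT k))).
- rewrite lP// lT//; apply: addr_ge0; first exact: g0.
  apply: mulr_ge0; last exact/ltW/lW.
  by apply: flat_ge0 => s s0; rewrite !hornerE addr_ge0.
- rewrite lP// lT// ltr_wpDl// mulr_gt0 ?lW// flat_gt0 ?subr_gt0// !hornerE.
  by rewrite addr_gt0// invr_gt0 subr_gt0.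
- by rewrite /P ebump_le0 ?mulr0// subr_le0.
Qed.

(** Three zones. Where [W < 1] the cutoff is locally 1 and [lap U >= 0] because the point is in [L];
    where [W > 2] the cut function is locally 0. In between, the point is in the compact [L], where
    the Laplacian of the cut function is bounded and [lap P] is bounded away from 0. *)
Lemma lap_ge0_extension O W L U : open O -> (forall k, smooth k O W) ->
  (forall x, O x -> 0 < lap W x) -> compact L -> L `<=` O ->
  (forall x, O x -> W x <= 2 -> L x) ->
  (forall k, smooth k setT U) -> (forall x, L x -> 0 <= lap U x) ->
  exists v : V -> R, [/\ forall k, smooth k O v, forall x, O x -> 0 <= lap v x &
    forall x, O x -> W x < 2^-1 -> v x = U x].
Proof.
move=> oO sW lW cL LO WL sU lU.
have [P [sP lP lP' P0]] := @lap_tebump O W 2^-1 oO sW lW.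
pose C x := cutoff 1 2 (W x) * U x.
have sUO k : smooth k O U := smooth_sub (@subsetT _ O) (sU k).
have sC k : smooth k O C := smoothM oO (smooth_cutoff 1 2 oO (sW k)) (sUO k).
have lt12 : (1 : R) < 2 by rewrite ltrDl.
have h21 : (2^-1 : R) < 1 by rewrite invf_lt1.
have [A A0 AP] : exists2 A, 0 <= A & forall x, L x -> 1 <= W x -> 0 <= lap C x + A * lap P x.
  have [L0|L0] := pselect (L !=set0); last first.
    by exists 0 => // x Lx; exfalso; apply: L0; exists x.
  (* [lap P] is known to be positive only for [W > 1/2]. The added term is positive exactly for
     [W < 1] and zero elsewhere, so [q] is positive on all of [L], where its minimum exists, and
     equals [lap P] where [W >= 1]. *)
  pose q x := lap P x + ebump (1 + (-1) * W x).
  have sq : smooth 0 O q.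
    apply: (smoothD oO (smooth_lap oO (sP 2))).
    apply: (smooth_comp (I := setT) oO (fun _ _ => I) (rsmooth_flat 0 setT 1)).
    exact: (smoothD oO (smooth_cst 0 1 oO) (@smoothZ _ _ 0 O (-1) _ oO (sW 0))).
  have cq : {within L, continuous q}.
    by apply: continuous_in_subspaceT => y; rewrite inE => /LO Oy; exact: (smooth_continuous sq Oy).
  have cC : {within L, continuous (fun x => `|lap C x|)}.
    apply: continuous_in_subspaceT => y; rewrite inE => /LO Oy.
    apply: continuous_comp; last by apply: norm_continuous.
    exact: (smooth_continuous (smooth_lap oO (sC 2)) Oy).
  have [z zL zmin] := compact_EVT_min L0 cL cq.
  have [z' _ zmax] := compact_EVT_max L0 cL cC.
  have Oz : O z by apply: LO; move: zL; rewrite inE.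
  have q0 : 0 < q z.
    have [Wz|Wz] := ltP 2^-1 (W z).
      by apply: ltr_pwDl; [exact: lP'|exact: ebump_ge0].
    apply: ltr_wpDl; first exact: lP.
    by apply: ebump_gt0; rewrite mulN1r subr_gt0 (le_lt_trans Wz).
  exists (`|lap C z'| / q z); first by rewrite divr_ge0// ltW.
  move=> x Lx Wx; have xL : x \in L by rewrite inE.
  have := zmin x xL; rewrite {2}/q ebump_le0 ?addr0; last first.
    by rewrite mulN1r subr_le0.
  move=> qx; have := zmax x xL => /= Cx.
  exact: (absorb_ge0 q0 qx Cx).
have sAP k : smooth k O (fun x => A * P x) := @smoothZ _ _ k O A _ oO (sP k).
exists (fun x => C x + A * P x); split=> [k|x Ox|x Ox Wx].
- exact: (smoothD oO (sC k) (sAP k)).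
- rewrite (lapD oO (sC 2) (sAP 2) Ox) (lapZ A oO (sP 2) Ox).
  have AP0 : 0 <= A * lap P x by rewrite mulr_ge0// lP.
  have cW := smooth_continuous (sW 0) Ox.
  have [W1|W1] := ltP (W x) 1.
    have -> : lap C x = lap U x.
      apply: lap_near; have : \forall y \near x, W y < 1 by exact: cvgr_lt cW _ W1.
      by apply: filterS => y /ltW Wy; rewrite /C cutoff1// mul1r.
    apply: addr_ge0 AP0; apply: lU; apply: (WL _ Ox).
    exact: (ltW (lt_trans W1 lt12)).
  have [W2|W2] := leP (W x) 2; first exact: (AP _ (WL _ Ox W2) W1).
  have -> : lap C x = lap (fun=> 0) x.
    apply: lap_near; have : \forall y \near x, 2 < W y by exact: cvgr_gt cW _ W2.
    by apply: filterS => y /ltW Wy; rewrite /C cutoff0// mul0r.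
  by rewrite lap_cst add0r.
- by rewrite P0 ?ltW// mulr0 addr0 /C cutoff1 ?mul1r// ltW// (lt_trans Wx).
Qed.

Lemma smooth_lap_sbh O v : open O -> (forall k, smooth k O v) ->
  (forall x, O x -> 0 <= lap v x) -> (sbh O `&` Cinfty O) (EFin \o v).
Proof.
move=> oO sv lv; split; last by exists v => // k; exact: smooth_Ck.
split=> [x _|]; first exact: ltry.
case: eqP => [d1|_].
  subst d; exact: (lap_ge0_locally_convex oO (sv 2) lv (fun _ _ => erefl)).
split; first exact: (continuous_usc oO (fun y => smooth_continuous (sv 0)) (fun _ _ => erefl)).
move=> x r r0; exact: (lap_ge0_ball_mean oO (sv 2) lv (fun _ _ => erefl) r0).
Qed.

Lemma mollify_lap_ge0 f e x c0 : (0 < d)%N -> bbs f -> 0 < e -> 0 < c0 ->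
  (forall y c, N2 y <= e -> 0 < c -> c <= c0 ->
    f (x + y) * vol d c <= \int[@leb R d]_(z in @cball0 R d c) f (x + y + z)) ->
  0 <= lap (mollify e f) x.
Proof.
move=> d0 bf e0 c00 fx.
apply: (lap_ge0_submean d0 (smooth_mollify 2 e bf) c00) => c cp cc0.
by apply: mollify_submean => // y ye; exact: fx.
Qed.

End Exhaustion.

(** * Balayage *)

Section Approximation.
Variables (R : realType) (d : nat).
Local Notation V := 'rV[R]_d.
Local Notation lam := (@leb R d).
Implicit Types (f g v : V -> R) (O K L : set V) (u : V -> \bar R).

Definition thicken L (c : R) : set V :=
  (fun p : V * V => p.1 + p.2) @` (L `*` [set z | N2 (z - 0) <= c]).

Lemma mem_thicken L c x y : L x -> N2 y <= c -> thicken L c (x + y).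
Proof. by move=> Lx yc; exists (x, y) => //=; split=> //=; rewrite subr0. Qed.

Lemma compact_thicken L c : compact L -> compact (thicken L c).
Proof.
move=> cL; apply: continuous_compact; last exact: compact_setX cL (@compact_N2_le _ _ 0 c).
by apply: continuous_subspaceT => p; exact: add_continuous.
Qed.

Lemma thicken_sub L c O :
  (forall x, L x -> forall y, N2 (y - x) <= c -> O y) -> thicken L c `<=` O.
Proof.
move=> LO _ [[x y] /= [Lx yc] <-]; apply: (LO x Lx).
by rewrite addrAC subrr add0r -(subr0 y).
Qed.

Lemma measurable_compact K : compact K -> measurable K.
Proof.
move=> cK; apply: measurable_closed.
by apply: compact_closed cK; exact: norm_hausdorff.
Qed.

Lemma bbs_compact O K f M : measurable O -> measurable_fun O f -> compact K -> K `<=` O ->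
  (forall x, K x -> `|f x| <= M) -> bbs (f \_ K).
Proof.
move=> mO mf cK KO fM; split.
  apply/(measurable_restrictT f (measurable_compact cK)).
  exact: (measurable_funS mO KO).
have [B B0 BP] := compact_N2_bound cK.
exists (Num.max `|M| B) => x; split.
  rewrite patchE; case: ifPn => [|_]; last by rewrite normr0 le_max normr_ge0.
  by rewrite inE => /fM Mx; rewrite le_max (le_trans Mx) ?ler_norm.
rewrite gt_max => /andP[_ Bx]; rewrite patchE memNset// => /BP.
by rewrite leNgt Bx.
Qed.

Lemma N2D_quarter_le (c : R) (y z : V) : N2 y <= c / 4 -> N2 z <= c / 4 -> N2 (y + z) <= c.
Proof. by have := N2D_le y z; lra. Qed.

Lemma quarter_le (c t : R) : 0 < c -> t <= c / 4 -> t <= c.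
Proof. by move=> c0 tc; lra. Qed.

Lemma inv_succ_le (c : R) j : 0 < c -> c / j.+1%:R <= c.
Proof. by move=> c0; rewrite ler_pdivrMr// ler_peMr ?ler1n// ltW. Qed.

Lemma inv_succ_small (c e : R) : 0 < c -> 0 < e -> \forall j \near \oo, c / j.+1%:R <= e.
Proof.
move=> c0 e0; exists (Num.truncn (c / e)) => // j /= je.
rewrite ler_pdivrMr// -ler_pdivrMl// mulrC ltW//.
apply: (lt_le_trans (truncnS_gt _)); by rewrite ler_nat.
Qed.

Lemma sbh_mollify_approx O L u n : (0 < d)%N -> open O -> compact L -> L `<=` O ->
  sbh O u -> exists (U : nat -> V -> R) (M : R),
  [/\ forall j k, smooth k setT (U j), forall j x, L x -> 0 <= lap (U j) x,
      forall j x, L x -> trunc_below u n x <= U j x,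
      forall j x, L x -> `|U j x| <= M &
      forall x, L x -> U ^~ x @ \oo --> trunc_below u n x].
Proof.
move=> d0 oO cL LO su; have [uoo usc reg] := sbh_regular oO su.
have [|x Lx|c1 c10 c1P] := @uniform_ball _ _ L (fun A => A `<=` O) cL.
- by move=> A B AB BO; exact: subset_trans BO.
- by have [e e0 eP] := open_N2_ball oO (LO _ Lx); exists e.
(* [w] is cut to the compact [L2], which makes it bounded with bounded support, and the submean
   inequality is taken at the points of [L3]. Two successive shifts of a point of [L], each of
   squared length at most [c1 / 4], stay in [L2] by [N2D_le], so the cut is not felt. *)
pose w := trunc_below u n; pose L2 := thicken L c1; pose L3 := thicken L (c1 / 4).
have c40 : 0 < c1 / 4 by rewrite divr_gt0.
have L2O : L2 `<=` O by apply: thicken_sub => x Lx y; exact: c1P.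
have L3O : L3 `<=` O.
  apply: thicken_sub => x Lx y yc; apply: (c1P x Lx) => /=.
  exact: quarter_le c10 yc.
have cL2 : compact L2 := compact_thicken cL.
have cL3 : compact L3 := compact_thicken cL.
have [c0 c00 c0P] := reg L3 cL3 L3O.
have [M MP] := trunc_below_bounded n oO usc uoo cL2 L2O.
pose f := w \_ L2.
have bf : bbs f := bbs_compact (measurable_open oO) (trunc_below_measurable n oO usc) cL2 L2O MP.
have fE x y : L x -> N2 y <= c1 -> f (x + y) = w (x + y).
  by move=> Lx yc; rewrite /f patchE mem_set//; exact: mem_thicken.
have [N N0 NP] := bbs_bound bf.
pose r := Num.min c0 (c1 / 4); have r0 : 0 < r by rewrite lt_min c00.
pose e j := r / j.+1%:R.
have e0 j : 0 < e j by rewrite divr_gt0.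
have er j : e j <= r := inv_succ_le j r0.
have rc1 : r <= c1 / 4 by rewrite ge_min lexx orbT.
have rc0 : r <= c0 by rewrite ge_min lexx.
have le41 (t : R) : t <= c1 / 4 -> t <= c1 := quarter_le c10.
have sub x y c : L x -> N2 y <= r -> 0 < c -> c <= r ->
    f (x + y) * vol d c <= \int[lam]_(z in @cball0 R d c) f (x + y + z).
  move=> Lx yr cp cr; have yc : N2 y <= c1 / 4 := le_trans yr rc1.
  have [_ /(_ n c cp (le_trans cr rc0))] := c0P _ (mem_thicken Lx yc).
  rewrite (fE _ _ Lx (le41 _ yc)) => /le_trans; apply; rewrite le_eqVlt; apply/orP; left.
  apply/eqP; apply: eq_Rintegral => z; rewrite inE /= => zc; rewrite -addrA fE//.
  by apply: N2D_quarter_le => //; exact: (le_trans zc (le_trans cr rc1)).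
have f0 x : L x -> f x = w x.
  by move=> Lx; rewrite -[x]addr0 fE// N20 ltW.
exists (fun j => mollify (e j) f), N; split.
- by move=> j k; exact: smooth_mollify.
- move=> j x Lx; apply: (mollify_lap_ge0 d0 bf (e0 j) r0) => y c ye.
  exact: (sub x y c Lx (le_trans ye (er j))).
- move=> j x Lx; rewrite -[leLHS](f0 x Lx); apply: (mollify_ge bf (e0 j)) => c cp ce.
  have := sub x 0 c Lx; rewrite N20 addr0; apply => //; [exact: ltW|].
  exact: le_trans ce (er j).
- move=> j x Lx; rewrite ler_norml; apply/andP; split.
    apply: (mollify_ge_cst bf (e0 j)) => y _.
    by have := NP (x + y); rewrite ler_norml => /andP[].
  apply: (mollify_le bf (e0 j)) => y _.
  by have := NP (x + y); rewrite ler_norml => /andP[].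
- move=> x Lx; apply/cvgrPdist_le => eps eps0.
  have wx : (u x < (w x + eps)%:E)%E.
    apply: (@le_lt_trans _ _ (w x)%:E); last by rewrite lte_fin ltrDl.
    by rewrite trunc_belowE ?le_max ?lexx//; exact: uoo (LO _ Lx).
  have nx : - n%:R < w x + eps.
    by apply: (le_lt_trans (trunc_below_ge n (uoo x (LO _ Lx)))); rewrite ltrDl.
  (* Upper semicontinuity passes from [u] to its truncation because [- n] also lies below
     [w x + eps]. *)
  have [t t0 tP] : exists2 t, 0 < t & forall y, N2 (y - x) <= t -> O y -> w y <= w x + eps.
    have /nbhs_interior := usc x _ (LO _ Lx) wx.
    rewrite nbhsE => -[A [oA Ax] AP].
    have [t t0 tA] := open_N2_ball oA Ax; exists t => // y /tA /AP yu Oy.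
    have uy := interior_subset yu Oy.
    rewrite -lee_fin trunc_belowE; last exact: uoo.
    by rewrite ge_max (ltW uy) lee_fin ltW.
  have := inv_succ_small r0 t0; apply: filterS => j jt.
  have lo : w x <= mollify (e j) f x.
    rewrite -(f0 x Lx); apply: (mollify_ge bf (e0 j)) => c cp ce.
    have := sub x 0 c Lx; rewrite N20 addr0; apply => //; [exact: ltW|].
    exact: le_trans ce (er j).
  rewrite distrC ger0_norm ?subr_ge0// lerBlDl.
  apply: (mollify_le bf (e0 j)) => y ye.
  have yr : N2 y <= c1 := le41 _ (le_trans ye (le_trans (er j) rc1)).
  rewrite (fE _ _ Lx yr); apply: tP; first by rewrite addrAC subrr add0r (le_trans ye).
  exact: L2O (mem_thicken Lx yr).
Qed.

(** [W] and [L] depend on [K] alone, so they are fixed before [u] is mollified on [L]. The extension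
    is done separately for each [j]; bounds and convergence survive because nothing changes on
    [K]. *)
Lemma sbh_smooth_approx O K u n : (0 < d)%N -> open O -> compact K -> K `<=` O ->
  sbh O u -> exists (v : nat -> V -> R) (M : R),
  [/\ forall j, (sbh O `&` Cinfty O) (EFin \o v j),
      forall j x, K x -> trunc_below u n x <= v j x,
      forall j x, K x -> `|v j x| <= M &
      forall x, K x -> v ^~ x @ \oo --> trunc_below u n x].
Proof.
move=> d0 oO cK KO su.
have [W [L [sW lW [cL LO] WK WL]]] := exhaustion d0 oO cK KO.
have [U [M [sU lU Ule UM Ucvg]]] := sbh_mollify_approx n d0 oO cL LO su.
have /choice[v vP] : forall j, exists v : V -> R, [/\ forall k, smooth k O v,
    forall x, O x -> 0 <= lap v x & forall x, O x -> W x < 2^-1 -> v x = U j x].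
  by move=> j; exact: (lap_ge0_extension oO sW lW cL LO WL (sU j) (lU j)).
have vE j x : K x -> v j x = U j x.
  by move=> Kx; have [_ _] := vP j; apply; [exact: KO|exact: WK].
have KL x : K x -> L x.
  move=> Kx; apply: WL; first exact: KO.
  apply: (le_trans (ltW (WK x Kx))); apply: (@le_trans _ _ 1); last by rewrite ler1n.
  by rewrite invf_le1 ?ler1n.
exists v, M; split=> [j|j x Kx|j x Kx|x Kx].
- by have [sv lv _] := vP j; exact: smooth_lap_sbh.
- by rewrite vE//; exact: Ule (KL x Kx).
- by rewrite vE//; exact: UM (KL x Kx).
- by under eq_fun do rewrite vE//; exact: Ucvg (KL x Kx).
Qed.

End Approximation.

(** * Supports of measures and passage to the limit in the integrals *)

Section Measures.
Variables (R : realType) (d : nat).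
Local Notation V := 'rV[R]_d.
Implicit Types (O K : set V) (u : V -> \bar R).

(** Each point off the support has a null open neighbourhood, hence lies in a null ball with
    rational centre and radius [1 / (k + 1)]; there are countably many of these. *)
Lemma measure_setC_support (m : {measure set V -> \bar R}) :
  measurable (~` measure_support m) /\ m (~` measure_support m) = 0%E.
Proof.
have null x : ~ measure_support m x -> exists U, [/\ open U, U x & m U = 0%E].
  move=> Sx; apply: contrapT => H; apply: Sx => U oU Ux.
  rewrite lt_neqAle measure_ge0 andbT eq_sym; apply/negP => /eqP mU.
  by apply: H; exists U.
have mS : measurable (~` measure_support m).
  apply: measurable_open; rewrite openE => x /null[U [oU Ux mU]].
  rewrite /interior; apply: filterS (open_nbhs_nbhs (conj oU Ux)) => y Uy Sy.
  by have := Sy U oU Uy; rewrite mU ltxx.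
split=> //; apply/(negligibleP m mS).
pose F (k : nat) : set V := if pickle_inv k is Some p then
  (if `[< m (qball p) = 0%E >] then qball p else set0) else set0.
apply: (@negligibleS _ _ _ _ (\bigcup_k F k)).
  move=> x /null[U [oU Ux mU]].
  have := Ux; rewrite {1}(open_bigcup_qball oU) => -[p _].
  case: asboolP => // pU px; exists (pickle p) => //; rewrite /F pickleK_inv.
  case: asboolP => // H; exfalso; apply: H.
  apply: (@subset_measure0 _ _ _ m (qball p) U) => //.
  - by apply: measurable_open; exact: ball_open.
  - exact: measurable_open.
apply: negligible_bigcup => k; rewrite /F.
case: pickle_inv => [p|]; last exact: negligible_set0.
case: asboolP => [mp|_]; last exact: negligible_set0.
by apply/negligibleP => //; apply: measurable_open; exact: ball_open.
Qed.

Lemma integral_support (m : {measure set V -> \bar R}) O K u :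
  measurable O -> measurable K -> K `<=` O -> measure_support m `<=` K ->
  measurable_fun O u -> (\int[m]_(x in O) u x = \int[m]_(x in K) u x)%E.
Proof.
move=> mO mK KO SK mu_; have [mS S0] := measure_setC_support m.
have mOK : measurable (O `\` K) by exact: measurableD.
have OK0 : m (O `\` K) = 0%E.
  by apply: (subset_measure0 mOK mS _ S0) => x [_ Kx] /SK.
have OKE : O `\` (O `\` K) = K by rewrite setDD setIidr.
rewrite integralE [RHS]integralE; congr (_ - _)%E.
- rewrite (ge0_negligible_integral mOK mO _ _ OK0) ?OKE//.
  exact: measurable_funepos.
- rewrite (ge0_negligible_integral mOK mO _ _ OK0) ?OKE//.
  exact: measurable_funeneg.
Qed.

(** Truncation leaves the positive part unchanged, since [- n <= 0], and replaces the negative part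
    by [min(u^-, n)], which increases to [u^-]. The positive part has a finite integral, by the
    bound [M] and finiteness of [m], so the difference converges even to [-oo]. *)
Lemma trunc_below_integral_cvg (m : {finite_measure set V -> \bar R}) K u (M : R) :
  measurable K -> measurable_fun K u -> (forall x, K x -> (u x <= M%:E)%E) ->
  (\int[m]_(x in K) (trunc_below u n x)%:E @[n --> \oo] --> \int[m]_(x in K) u x)%E.
Proof.
move=> mK mu_ uM; have uoo x : K x -> (u x < +oo)%E.
  by move=> Kx; exact: le_lt_trans (uM x Kx) (ltry _).
have n0 n : ((- n%:R)%:E <= 0 :> \bar R)%E by rewrite lee_fin oppr_le0.
pose g n x : \bar R := mine (u^\- x)%E n%:R%:E.
have tE n x : K x -> (EFin \o trunc_below u n) x = maxe (u x) (- n%:R)%:E.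
  by move=> /uoo; exact: trunc_belowE.
have posE n : (\int[m]_(x in K) ((EFin \o trunc_below u n)^\+ x) = \int[m]_(x in K) u^\+ x)%E.
  apply: eq_integral => x; rewrite inE => Kx; rewrite !funeposE tE//.
  by rewrite -maxA (max_idPr (n0 n)).
have negE n : (\int[m]_(x in K) ((EFin \o trunc_below u n)^\- x) = \int[m]_(x in K) g n x)%E.
  apply: eq_integral => x; rewrite inE => Kx; rewrite /g !funenegE tE//.
  by rewrite oppe_max max_minl -EFinN opprK (@max_idPl _ _ n%:R%:E _ _)// lee_fin.
under eq_fun do rewrite (integralE m K (EFin \o _)) posE negE.
rewrite (integralE m K u).
have mg n : measurable_fun K (g n) by apply: measurable_mine => //; exact: measurable_funeneg.
have ng n x : K x -> (0 <= g n x)%E.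
  by move=> _; rewrite le_min; apply/andP; split; [exact: funeneg_ge0|rewrite lee_fin ler0n].
have pfin : (\int[m]_(x in K) u^\+ x)%E \is a fin_num.
  rewrite ge0_fin_numE; last by apply: integral_ge0.
  apply: (@le_lt_trans _ _ (\int[m]_(x in K) `|M|%:E)%E).
    apply: ge0_le_integral => //; first exact: measurable_funepos.
    move=> x Kx; rewrite funeposE ge_max lee_fin normr_ge0 andbT.
    by apply: le_trans (uM x Kx) _; rewrite lee_fin ler_norm.
  rewrite integral_cst//; apply: lte_mul_pinfty => //.
  by rewrite -ge0_fin_numE//; exact: fin_num_measure.
apply: cvgeB.
- exact: fin_num_adde_defr.
- exact: cvg_cst.
have gcvg x : K x -> limn (g ^~ x) = (u^\- x)%E.
  move=> Kx; apply/cvg_lim => //; rewrite /g; have := funeneg_ge0 u x.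
  case: (u^\- x)%E => [r|_|//].
    move=> _; apply: cvg_near_cst; exists (Num.truncn r).+1 => // n /= rn.
    apply/min_idPl; rewrite lee_fin ltW// (lt_le_trans (truncnS_gt _))// ler_nat//.
  under eq_fun do rewrite min_r ?leey//.
  by apply/cvgeryP; exact: cvgr_idn.
rewrite (eq_integral (fun x => limn (g ^~ x))); last first.
  by move=> x; rewrite inE => Kx; rewrite gcvg.
apply: (cvg_monotone_convergence mK mg ng) => x Kx n p np.
by rewrite /g le_min2// lee_fin ler_nat.
Qed.

Lemma balayage_trunc O (mu theta : {finite_measure set V -> \bar R}) K u n : (0 < d)%N ->
  open O -> compact K -> K `<=` O -> measure_support mu `<=` K ->
  measure_support theta `<=` K -> balayage O (sbh O `&` Cinfty O) theta mu -> sbh O u ->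
  (\int[theta]_(x in K) (trunc_below u n x)%:E <= \int[mu]_(x in K) (trunc_below u n x)%:E)%E.
Proof.
move=> d0 oO cK KO SmK StK bal su.
have [v [M [vS vge vM vcvg]]] := sbh_smooth_approx n d0 oO cK KO su.
have [uoo usc _] := sbh_regular oO su.
have mK := measurable_compact cK; have mO := measurable_open oO.
have mw : measurable_fun K (EFin \o trunc_below u n).
  apply/measurable_EFinP; apply: (measurable_funS mO KO).
  exact: trunc_below_measurable.
have mvO j : measurable_fun O (EFin \o v j).
  have [[voo _] [f fC fE]] := vS j.
  apply: (@eq_measurable_fun _ _ _ _ _ (EFin \o f)).
    by move=> x; rewrite inE => Ox; rewrite fE.
  apply/measurable_EFinP; apply: measurable_continuous_on => // x Ox.
  by have [cf _] := fC 0%N; exact: cf.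
have mv j : measurable_fun K (EFin \o v j) := measurable_funS mO KO (mvO j).
have iv (m : {finite_measure set V -> \bar R}) j : m.-integrable K (EFin \o v j).
  apply: measurable_bounded_integrable => //.
  - by rewrite -ge0_fin_numE//; exact: fin_num_measure.
  - exact/measurable_EFinP.
  - by apply: (@bounded_near_le _ _ _ _ M) => x Kx; exact: vM.
have lim_mu : (\int[mu]_(x in K) (v j x)%:E @[j --> \oo] -->
    \int[mu]_(x in K) (trunc_below u n x)%:E)%E.
  have cv x : K x -> (EFin \o v j) x @[j --> \oo] --> (EFin \o trunc_below u n) x.
    move=> Kx; apply: cvg_EFin; last exact: vcvg.
    by apply: nearW.
  have iM := finite_measure_integrable_cst mu M mK.
  have vM' x j : K x -> (`|(EFin \o v j) x| <= (EFin \o cst M) x)%E.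
    by move=> Kx; rewrite /= lee_fin vM.
  by have [_ _] := dominated_convergence mK mv mw (aeW mu cv) iM
    (aeW mu (fun x j Kx => vM' x j Kx)).
(* Only the side of [mu] needs the limit in [j]; on the side of [theta] the domination by [v j]
   suffices. Integrals over [K] and [O] are exchanged as both supports lie in [K]. *)
apply: (cvge_ge _ lim_mu); near=> j.
apply: (@le_trans _ _ (\int[theta]_(x in K) (v j x)%:E)%E).
  apply: (integral_le_real mK mw (iv theta j)) => x Kx.
  by rewrite lee_fin vge.
rewrite -(integral_support mO mK KO StK (mvO j)) -(integral_support mO mK KO SmK (mvO j)).
exact: bal (vS j).
Unshelve. all: by end_near.
Qed.

End Measures.

Theorem theorem3 (R : realType) (d : nat) (d_ge1 : (1 <= d)%N)
    (O : set 'rV[R]_d) (mu theta : {finite_measure set 'rV[R]_d -> \bar R})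
    (O_nonempty : O !=set0) (O_greenian : greenian O)
    (mu_supp : compactly_supported_in O mu)
    (theta_supp : compactly_supported_in O theta)
    (bal : balayage O (sbh O `&` Cinfty O) theta mu) :
  balayage O (sbh O) theta mu.
Proof.
have [oO _] := O_greenian; have [cmu muO] := mu_supp; have [cth thO] := theta_supp.
move=> u su; have [uoo usc _] := sbh_regular oO su.
pose K := measure_support mu `|` measure_support theta.
have cK : compact K by exact: compactU.
have KO : K `<=` O by rewrite subUset.
have mK := measurable_compact cK; have mO := measurable_open oO.
have muO' := usc_measurable oO usc.
have [M uM] := usc_bounded oO usc uoo cK KO.
rewrite (integral_support mO mK KO (@subsetUr _ _ _) muO').
rewrite (integral_support mO mK KO (@subsetUl _ _ _) muO').
have muK := measurable_funS mO KO muO'.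
(* Again the limit, now in [n], is taken for [mu] alone: for [theta] it is enough that [u] lies
   below each of its truncations. *)
apply: (cvge_ge _ (trunc_below_integral_cvg (m := mu) mK muK uM)); apply: nearW => n.
apply: le_trans (balayage_trunc n d_ge1 oO cK KO (@subsetUl _ _ _) (@subsetUr _ _ _) bal su).
apply: (integral_le_real mK muK).
  apply: measurable_bounded_integrable => //.
  - by rewrite -ge0_fin_numE//; exact: fin_num_measure.
  - exact: (measurable_funS mO KO (trunc_below_measurable n oO usc)).
  have [B BP] := trunc_below_bounded n oO usc uoo cK KO.
  exact: (bounded_near_le BP).
move=> x Kx; rewrite trunc_belowE ?le_max ?lexx//; exact: uoo (KO _ Kx).
Qed.
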